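(* Let $a,b > 0$ be real numbers that are linearly independent over the rationals. Then there exist a real sequence $\{\lambda_n\}_{n=1}^{\infty}$ with $\lambda_{n+1} - \lambda_n \in \{a,b\}$ for all $n \geq 1$, and a nonnegative Schwartz function $g$ on $\mathbb{R}$, such that the system of translates $\{g(x - \lambda_n)\}_{n=1}^{\infty}$ is complete in $L^p(\mathbb{R})$ for every $p>1$.
   Context: Here $p$ ranges over real numbers $1<p<\infty$, and $L^p(\mathbb{R})$ is the (complex) Lebesgue space. A system of vectors in a topological vector space is called complete if its finite linear combinations are dense in the space. *)

(* Defs.v *)
From HB Require Import structures.
From mathcomp Require Import all_boot all_order all_algebra.
From mathcomp Require Import complex.
From mathcomp Require Import all_classical all_reals all_analysis.

Set Implicit Arguments.
Unset Strict Implicit.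
Unset Printing Implicit Defensive.

Import Order.TTheory GRing.Theory Num.Theory.
Import numFieldNormedType.Exports.

Local Open Scope classical_set_scope.
Local Open Scope ring_scope.

Definition rat_lin_indep2 (R : realType) (a b : R) : Prop :=
  forall q r : rat, ratr q * a + ratr r * b = 0 -> q = 0 /\ r = 0.

Definition smooth (R : realType) (g : R -> R) : Prop :=
  forall (k : nat) (x : R), derivable (derive1n k g) x 1.

Definition schwartz (R : realType) (g : R -> R) : Prop :=
  smooth g /\
  forall m k : nat, exists M : R, forall x : R, `|x ^+ m * derive1n k g x| <= M.

(* [`|z|] for [z : R[i]] lives in [R[i]]; [normc z] is the same modulus in [R]. *)
Definition cLnorm (R : realType) (p : R) (f : R -> R[i]) : \bar R :=
  Lnorm (@lebesgue_measure R) p%:E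
    (fun x : R => (ComplexField.Normc.normc (f x))%:E).

(* Representatives of the elements of complex L^p(R); measurability is Borel
   measurability, which does not change the space of a.e. classes. *)
Definition cLfun (R : realType) (p : R) (f : R -> R[i]) : Prop :=
  [/\ measurable_fun [set: R] (fun x : R => complex.Re (f x)),
      measurable_fun [set: R] (fun x : R => complex.Im (f x)) &
      (cLnorm p f < +oo)%E].

(* A finite linear combination of the u_k is one over an initial segment of
   the indices, padding with zero coefficients. *)
Definition complete_in_Lp (R : realType) (p : R) (u : nat -> R -> R[i]) : Prop :=
  (forall n : nat, cLfun p (u n)) /\
  forall f : R -> R[i], cLfun p f ->
  forall e : R, 0 < e ->
  exists (N : nat) (c : nat -> R[i]),
    (cLnorm p (fun x : R => (f x - \sum_(k < N) c k * u k x)%R) < e%:E)%E.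

Definition translate (R : realType) (g : R -> R) (t : R) : R -> R[i] :=
  fun x : R => Complex (g (x - t)) 0.

(* Main.v *)
Require Import Defs.
From HB Require Import structures.
From mathcomp Require Import all_boot all_order all_algebra.
From mathcomp Require Import complex.
From mathcomp Require Import all_classical all_reals all_analysis.
From mathcomp Require Import measurable_realfun.
From mathcomp Require Import ring lra zify.

Set Implicit Arguments.
Unset Strict Implicit.
Unset Printing Implicit Defensive.

Import Order.TTheory GRing.Theory Num.Theory.
Import numFieldNormedType.Exports.

Local Open Scope classical_set_scope.
Local Open Scope ring_scope.


(* Let gauss x = exp (- x^2) and g x = \sum_(n in Z) U_|n| gauss (x - n a), where the U_n are
   the squared cosine coefficients of a smooth even function [hump] supported where cos >= 0.
   Thus Uh = \sum_n U_|n| z^n, z = e^(it), is even, decreasing on [0, pi], positive on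
   ]-pi, pi[ and flat at pi, of order exp (- 4 / (1 + cos t)).

   Combinations of the translates of g by n a with n >= N correspond to z^N P(z) Uh with P a
   polynomial.  The flatness of Uh at z = -1 makes its logarithm non-integrable, so (a Szego
   phenomenon, here with the explicit functions h = (1 + (1 - 2 eta) z) / (1 + (1 - eta) z),
   h(0) = 1, for which h^n Uh is small) the C^1 closure of the P(z) Uh is stable under z^-1.
   It therefore contains z^-N (1 - W^r) with W = 1 - Uh / max Uh, and W^r has uniformly small
   Fourier coefficients c_m with m c_m bounded, since W is monotone on [0, pi].  Hence gauss
   is a limit of combinations of g (x - n a), n >= N, in the sense of uniform convergence
   with bound C / (1 + |x|), so in L^p for all p > 1.

   Since the multiples of b are dense modulo a, the sequence can be built in stages: b-steps
   until it passes near a prescribed real modulo a, then a-steps through the finitely many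
   translates needed there.  So the closed span contains all translates of gauss.
   Differentiating in the translation parameter gives x^n gauss, Taylor expansion of
   exp (- x^2 / 2) gives the polynomials in y = exp (- x^2 / 2) divisible by y^2, then
   1 - (1 - y^n)^M gives indicators of intervals, and a pi-lambda argument concludes. *)

(** Since Uh vanishes at z = -1, the error 1 - z^N P(z) Uh equals 1 there whatever P is, so its
    Fourier coefficients c_m can never be small in l^1. What can be reached is that they are
    uniformly small while m c_m stays bounded, and this dictates the C^1 norm: a derivative in t is
    a factor m on the coefficients, that is a factor x on the line, and the envelope 1 / (1 + |x|)
    lies in L^p precisely for p > 1. Taking squares for the U_n serves two ends at once: g is
    nonnegative, and Uh is a convolution of [hump] with itself, from which its positivity, its
    monotonicity and its explicit rate of flatness are read off. The constant of the envelope
    depends neither on N nor on the precision. Hence countably many requirements (a rational centre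
    and a precision) suffice for the sequence, and it serves all p > 1 simultaneously. Rational
    independence enters only through the density of the multiples of b modulo a. *)

(** * Rules of differentiation on the line *)

Definition der (R : realType) (f f' : R -> R) := forall x : R, is_derive x 1 f (f' x).

Definition Int (R : realType) (a b : R) (f : R -> R) : R :=
  \int[@lebesgue_measure R]_(x in `[a, b]) f x.

Lemma der_cont (R : realType) (f f' : R -> R) : der f f' -> continuous f.
Proof.
move=> df x; apply: differentiable_continuous; apply/derivable1_diffP.
exact: ex_derive.
Qed.

Lemma der_ext (R : realType) (f f' g g' : R -> R) :
  der f f' -> f =1 g -> f' =1 g' -> der g g'.
Proof. by move=> df /funext <- /funext <-. Qed.

Lemma der_D (R : realType) (f f' g g' : R -> R) : der f f' -> der g g' ->
  der (fun x => f x + g x) (fun x => f' x + g' x).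
Proof. by move=> df dg x; apply: is_deriveD. Qed.

Lemma der_B (R : realType) (f f' g g' : R -> R) : der f f' -> der g g' ->
  der (fun x => f x - g x) (fun x => f' x - g' x).
Proof. by move=> df dg x; apply: is_deriveB. Qed.

Lemma der_M (R : realType) (f f' g g' : R -> R) : der f f' -> der g g' ->
  der (fun x => f x * g x) (fun x => f' x * g x + f x * g' x).
Proof.
move=> df dg x.
have := @is_deriveM _ _ f g x 1 _ _ (df x) (dg x).
by move/is_derive_eq; apply; rewrite /GRing.scale /= addrC mulrC.
Qed.

Lemma der_Z (R : realType) (k : R) (f f' : R -> R) : der f f' ->
  der (fun x => k * f x) (fun x => k * f' x).
Proof. by move=> df x; apply: is_deriveZ. Qed.

Lemma der_cst (R : realType) (k : R) : der (fun=> k) (fun=> 0).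
Proof. by move=> x; apply: is_derive_cst. Qed.

Lemma der_id (R : realType) : der (fun x : R => x) (fun=> 1).
Proof. by move=> x; apply: is_derive_id. Qed.

Lemma der_comp (R : realType) (f f' g g' : R -> R) : der f f' -> der g g' ->
  der (fun x => f (g x)) (fun x => g' x * f' (g x)).
Proof.
move=> df dg x.
have := @is_derive1_comp _ f g x _ _ (df (g x)) (dg x).
by move/is_derive_eq; apply; rewrite mulrC.
Qed.

Lemma der_exp (R : realType) : der (@expR R) (@expR R).
Proof. by move=> x; apply: is_derive_expR. Qed.

Lemma der_sin (R : realType) : der (@sin R) (@cos R).
Proof. by move=> x; apply: is_derive_sin. Qed.

Lemma der_cos (R : realType) : der (@cos R) (fun x => - sin x).
Proof. by move=> x; apply: is_derive_cos. Qed.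

(** * Integration of continuous functions over segments *)

Section IntegralLayer.
Context (R : realType).
Implicit Types (a b c k : R) (f g : R -> R).

Lemma Int_itg a b f : continuous f ->
  (@lebesgue_measure R).-integrable `[a, b] (EFin \o f).
Proof.
move=> cf; apply: continuous_compact_integrable; first exact: segment_compact.
exact: continuous_subspaceT.
Qed.

Lemma IntD a b f g : continuous f -> continuous g ->
  Int a b (fun x => f x + g x) = Int a b f + Int a b g.
Proof. by move=> cf cg; rewrite /Int RintegralD//; exact: Int_itg. Qed.

Lemma IntB a b f g : continuous f -> continuous g ->
  Int a b (fun x => f x - g x) = Int a b f - Int a b g.
Proof. by move=> cf cg; rewrite /Int RintegralB//; exact: Int_itg. Qed.

Lemma IntZ a b k f : continuous f ->
  Int a b (fun x => k * f x) = k * Int a b f.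
Proof. by move=> cf; rewrite /Int RintegralZl//; exact: Int_itg. Qed.

Lemma Int_le a b f g : continuous f -> continuous g ->
  (forall x, a <= x <= b -> f x <= g x) -> Int a b f <= Int a b g.
Proof.
move=> cf cg fg; rewrite /Int; by apply: le_Rintegral => //; exact: Int_itg.
Qed.

Lemma Int_cst a b k : a <= b -> Int a b (fun=> k) = k * (b - a).
Proof.
move=> ab; rewrite /Int Rintegral_cst//; have := @lebesgue_measure_itv R `[a, b].
rewrite /= lte_fin => ->; case: ltgtP ab => //= -> _; by rewrite subrr !mulr0.
Qed.

Lemma Int_ge0 a b f : (forall x, a <= x <= b -> 0 <= f x) -> 0 <= Int a b f.
Proof.
by move=> f0; apply: Rintegral_ge0 => x /=; rewrite in_itv/=; exact: f0.
Qed.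

Lemma Int_norm a b f k : a <= b -> continuous f ->
  (forall x, a <= x <= b -> `|f x| <= k) -> `|Int a b f| <= k * (b - a).
Proof.
move=> ab cf fk; rewrite -Int_cst// ler_norml.
have c_cst : forall k0, continuous (fun _ : R => k0) by move=> k0 x; exact: cvg_cst.
apply/andP; split.
  rewrite -[X in - X]mulr1 -mulrN mulrC -IntZ//.
  apply: Int_le => // x /fk.
  by rewrite mulN1r ler_norml => /andP[].
by apply: Int_le => // x /fk; rewrite ler_norml => /andP[].
Qed.

Lemma Int_abs_le a b f g : continuous f -> continuous g ->
  (forall x, a <= x <= b -> `|f x| <= g x) -> `|Int a b f| <= Int a b g.
Proof.
move=> cf cg fg; rewrite ler_norml; apply/andP; split.
  rewrite -[X in - X]mulr1 -mulrN mulrC -IntZ//.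
  apply: Int_le => // [x|x /fg]; first by apply: cvgM; [exact: cvg_cst|exact: cg].
  by rewrite mulN1r ler_norml => /andP[].
by apply: Int_le => // x /fg; rewrite ler_norml => /andP[].
Qed.

Lemma Int_split a b c f : a <= b -> b <= c -> continuous f ->
  Int a c f = Int a b f + Int b c f.
Proof.
move=> ab bc cf; rewrite /Int.
have itg := @Int_itg a c f cf.
have := @Rintegral_itvB R f (BLeft a) (BRight c) b itg.
rewrite !bnd_simp => /(_ ab bc) E.
rewrite -[X in _ = _ + X]Rintegral_itv_obnd_cbnd; last first.
  apply: (integrableS _ _ _ (@Int_itg b c f cf)) => //.
  exact: subset_itv_oc_cc.
by rewrite -E addrCA subrr addr0.
Qed.

Lemma Int_FTC a b f F : a <= b -> continuous f -> der F f ->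
  Int a b f = F b - F a.
Proof.
rewrite le_eqVlt => /predU1P[->|ab] cf dF.
  by rewrite subrr /Int set_itv1 Rintegral_set1.
rewrite /Int /Rintegral (@continuous_FTC2 _ f F)//.
- exact: continuous_subspaceT.
- have cF := der_cont dF; split.
  + by move=> x _; exact: ex_derive.
  + by apply: cvg_at_right_filter; exact: cF.
  + by apply: cvg_at_left_filter; exact: cF.
- by move=> x _; rewrite derive1E; have := dF x => dFx; rewrite derive_val.
Qed.

Lemma Int_oppr a f : 0 <= a -> continuous f ->
  Int (- a) a f = Int (- a) a (fun x => f (- x)).
Proof.
move=> a0 cf; rewrite /Int /Rintegral.
have := @integration_by_substitution_oppr R f (- a) a.
rewrite opprK => -> //; first by lra.
exact: continuous_subspaceT.
Qed.

Lemma Int_oppr0 a f : 0 <= a -> continuous f ->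
  Int (- a) 0 f = Int 0 a (fun x => f (- x)).
Proof.
move=> a0 cf; rewrite /Int /Rintegral.
have := @integration_by_substitution_oppr R f 0 a.
rewrite oppr0 => -> //.
exact: continuous_subspaceT.
Qed.

Lemma Int_eq a b f g : (forall x, a <= x <= b -> f x = g x) ->
  Int a b f = Int a b g.
Proof.
by move=> fg; apply: eq_Rintegral => x; rewrite inE/= in_itv/=; exact: fg.
Qed.

Lemma Int_gt0 a b f x0 : continuous f -> (forall x, a <= x <= b -> 0 <= f x) ->
  a < x0 < b -> 0 < f x0 -> 0 < Int a b f.
Proof.
move=> cf f0 /andP[ax xb] fx0.
have : \forall x \near x0, f x0 / 2 < f x.
  by apply: (cvgr_gt (f x0) (cf x0)); lra.
move=> /nbhs_ballP[e /= e0 He].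
pose d := Num.min (e / 2) (Num.min (x0 - a) (b - x0)).
have d0 : 0 < d by rewrite /d !lt_min; apply/and3P; split; lra.
have [de da db] : [/\ d <= e / 2, d <= x0 - a & d <= b - x0].
  by rewrite /d !ge_min !lexx !orbT.
rewrite (@Int_split a (x0 - d) b)//; [|lra..].
rewrite (@Int_split (x0 - d) x0 b)//; [|lra..].
have p1 : 0 <= Int a (x0 - d) f.
  by apply: Int_ge0 => x /andP[? ?]; apply: f0; apply/andP; split; lra.
have p2 : 0 <= Int x0 b f.
  by apply: Int_ge0 => x /andP[? ?]; apply: f0; apply/andP; split; lra.
have p3 : f x0 / 2 * (x0 - (x0 - d)) <= Int (x0 - d) x0 f.
  rewrite -Int_cst; last lra.
  apply: Int_le => // x; first exact: cvg_cst.
  move=> /andP[xl xr]; apply/ltW/He; rewrite /ball /= ltr_norml.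
  by apply/andP; split; lra.
have : 0 < f x0 / 2 * d by apply: mulr_gt0 => //; lra.
rewrite opprB addrC subrK in p3; lra.
Qed.

Lemma Int_IBP a b f f' g g' : a <= b -> der f f' -> der g g' ->
  continuous f' -> continuous g' ->
  Int a b (fun x => f' x * g x) =
  f b * g b - f a * g a - Int a b (fun x => f x * g' x).
Proof.
move=> ab df dg cf' cg'.
have [cf cg] := (der_cont df, der_cont dg).
have cM : forall u v : R -> R, continuous u -> continuous v ->
    continuous (fun x => u x * v x).
  by move=> u v cu cv x; apply: cvgM; [exact: cu|exact: cv].
rewrite -(Int_FTC ab _ (der_M df dg)); last first.
  by move=> x; apply: cvgD; apply: cM.
by rewrite IntD ?addrK//; exact: cM.
Qed.
End IntegralLayer.

(** * Series with an explicit tail rate, and their termwise calculus *)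

Section SeriesLayer.
Context (R : realType).
Implicit Types (u v : nat -> R) (C : R).

(* The weights telescope, so a series dominated by [C * wt] has tails at most
   [C / N.+1]; this explicit rate stands in for summability throughout. *)
Definition wt (n : nat) : R := ((n.+1 * n.+2)%N%:R)^-1.

Definition qs C u := forall n, `|u n| <= C * wt n.

Definition sums u (l : R) :=
  exists C, forall N, `|l - \sum_(n < N) u n| <= C / N.+1%:R.

Definition Ssum u : R := limn (series u).

Lemma wt_gt0 n : 0 < wt n.
Proof. by rewrite invr_gt0 ltr0n. Qed.

Lemma wtE n : wt n = n.+1%:R^-1 - n.+2%:R^-1.
Proof.
rewrite /wt natrM.
have h1 : n.+1%:R != 0 :> R by rewrite pnatr_eq0.
have h2 : n.+2%:R != 0 :> R by rewrite pnatr_eq0.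
have -> : n.+2%:R = n.+1%:R + 1 :> R by rewrite -natr1.
rewrite -natr1 in h2; move: h1 h2; move: n.+1%:R => t h1 h2.
by field; rewrite h1 h2.
Qed.

Lemma sum_wt m n : (m <= n)%N ->
  \sum_(m <= k < n) wt k = m.+1%:R^-1 - n.+1%:R^-1.
Proof.
move=> mn; under eq_bigr do rewrite wtE -opprB.
by rewrite sumrN telescope_sumr// opprB.
Qed.

Lemma qs_ge0 C u : qs C u -> 0 <= C.
Proof.
move=> qu; have := qu 0; have := wt_gt0 0; have := normr_ge0 (u 0).
by move=> ? ? ?; rewrite -(pmulr_lge0 _ (wt_gt0 0)); lra.
Qed.

Lemma qs_part C u m n : qs C u -> (m <= n)%N ->
  `|\sum_(m <= k < n) u k| <= C / m.+1%:R.
Proof.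
move=> qu mn; apply: le_trans (ler_norm_sum _ _ _) _.
have C0 := qs_ge0 qu.
apply: le_trans (_ : \sum_(m <= k < n) C * wt k <= _).
  by apply: ler_sum => k _; exact: qu.
rewrite -mulr_sumr sum_wt// ler_wpM2l// lerBlDr lerDl.
by rewrite invr_ge0.
Qed.

Lemma qs_cvg C u : qs C u -> cvgn (series u).
Proof.
move=> qu; apply: normed_cvg.
apply: (@series_le_cvg _ _ (fun n => C * wt n)) => //.
- by move=> n; rewrite /=.
- by move=> n; apply: mulr_ge0; [exact: qs_ge0 qu|exact/ltW/wt_gt0].
- apply: nondecreasing_is_cvgn.
    apply: nondecreasing_series => n _ _.
    by apply: mulr_ge0; [exact: qs_ge0 qu|exact/ltW/wt_gt0].
  exists C => _ [n _ <-]; rewrite /series /= -mulr_sumr sum_wt//.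
  rewrite ler_piMr ?(qs_ge0 qu)// invr1 lerBlDr lerDl invr_ge0.
  exact: ler0n.
Qed.

Lemma qs_tail C u N : qs C u -> `|Ssum u - \sum_(n < N) u n| <= C / N.+1%:R.
Proof.
move=> qu; rewrite -[_ - _]opprB normrN.
have cu := qs_cvg qu.
have c2 : (fun m => `|series u N - series u m|) @ \oo --> `|series u N - Ssum u|.
  by apply: cvg_norm; apply: cvgB => //; exact: cvg_cst.
have -> : \sum_(n < N) u n = series u N by rewrite /series /= big_mkord.
rewrite -(cvg_lim _ c2)//; apply: limr_le; first exact: (cvgP _ c2).
near=> m; have Nm : (N <= m)%N by near: m; exact: nbhs_infty_ge.
rewrite distrC sub_series_geq//; exact: qs_part qu _.
Unshelve. all: by end_near.
Qed.

Lemma qs_sums C u : qs C u -> sums u (Ssum u).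
Proof. by move=> qu; exists C => N; exact: qs_tail. Qed.

Lemma sums_cvg u l : sums u l -> (fun N => \sum_(n < N) u n) @ \oo --> l.
Proof.
case=> C hC; apply/cvgrPdist_le => e e0.
have /cvgrPdist_le := @cvg_harmonic R.
have C1 : 0 < `|C| + 1 by rewrite ltr_wpDl.
move=> /(_ (e / (`|C| + 1))); rewrite divr_gt0// => /(_ isT).
apply: filterS => N /=; rewrite sub0r normrN /harmonic.
rewrite ger0_norm ?invr_ge0// => h.
apply: le_trans (hC N) _; apply: le_trans (_ : (`|C| + 1) / N.+1%:R <= _).
  by rewrite ler_wpM2r ?invr_ge0//; have := ler_norm C; lra.
by rewrite mulrC -ler_pdivlMr.
Qed.

Lemma sums_uniq u l l' : sums u l -> sums u l' -> l = l'.
Proof.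
move=> /sums_cvg h /sums_cvg h'.
exact: (cvg_unique _ h h').
Qed.

Lemma sums_Ssum u l : sums u l -> Ssum u = l.
Proof.
move=> /sums_cvg h; rewrite /Ssum; apply/cvg_lim => //.
rewrite /series /=; under eq_fun do rewrite big_mkord.
exact: h.
Qed.

Lemma sums_D u v l l' : sums u l -> sums v l' ->
  sums (fun n => u n + v n) (l + l').
Proof.
move=> [C hC] [D hD]; exists (C + D) => N.
rewrite big_split /= opprD addrACA mulrDl.
by apply: le_trans (ler_normD _ _) _; apply: lerD; [exact: hC|exact: hD].
Qed.

Lemma sums_Z u l k : sums u l -> sums (fun n => k * u n) (k * l).
Proof.
move=> [C hC]; exists (`|k| * C) => N.
by rewrite -mulr_sumr -mulrBr normrM -mulrA ler_wpM2l.
Qed.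

Lemma sums_B u v l l' : sums u l -> sums v l' ->
  sums (fun n => u n - v n) (l - l').
Proof.
move=> su sv; have := sums_D su (sums_Z (-1) sv).
rewrite mulN1r; by under eq_fun do rewrite mulN1r.
Qed.

Lemma sums_tail C u l N : qs C u -> sums u l ->
  `|l - \sum_(n < N) u n| <= C / N.+1%:R.
Proof. by move=> qu /sums_Ssum <-; exact: qs_tail. Qed.

Lemma sums_bound C u l : qs C u -> sums u l -> `|l| <= C.
Proof. by move=> qu /(sums_tail 0 qu); rewrite big_ord0 subr0 divr1. Qed.

(** The tail rate C / (N + 1) is uniform on [a, b], so integrating the remainder only multiplies it
    by the length b - a. *)
Lemma Int_sums C (a b : R) (f : nat -> R -> R) (F : R -> R) : a <= b ->
  (forall n, continuous (f n)) -> continuous F ->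
  (forall x, sums (f ^~ x) (F x)) ->
  (forall n x, a <= x <= b -> `|f n x| <= C * wt n) ->
  sums (fun n => Int a b (f n)) (Int a b F).
Proof.
move=> ab cf cF sF fC; exists (C * (b - a)) => N.
have cS : forall N, continuous (fun x => \sum_(n < N) f n x).
  move=> M x; apply: (@cvg_big _ _ +%R) => //.
    by move=> y; apply: add_continuous.
  by move=> i _; exact: cf.
have -> : \sum_(n < N) Int a b (f n) = Int a b (fun x => \sum_(n < N) f n x).
  elim: N => [|N IH].
    rewrite big_ord0; under [RHS]Int_eq do rewrite big_ord0.
    by rewrite Int_cst// mul0r.
  rewrite big_ord_recr /= IH -IntD//.
  by apply: Int_eq => x _; rewrite big_ord_recr.
rewrite -IntB// mulrAC; apply: Int_norm => //.
  by move=> x; apply: cvgB; [exact: cF|exact: cS].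
move=> x xab; have qx : qs C (f ^~ x) by move=> n; exact: fC.
rewrite -[F x](sums_Ssum (sF x)).
have cu := qs_cvg qx.
have c2 : (fun m => `|series (f ^~ x) m - series (f ^~ x) N|) @ \oo -->
    `|Ssum (f ^~ x) - series (f ^~ x) N|.
  by apply: cvg_norm; apply: cvgB => //; exact: cvg_cst.
have -> : \sum_(n < N) f n x = series (f ^~ x) N by rewrite /series /= big_mkord.
rewrite -(cvg_lim _ c2)//; apply: limr_le; first exact: (cvgP _ c2).
near=> m; have Nm : (N <= m)%N by near: m; exact: nbhs_infty_ge.
rewrite sub_series_geq//; exact: qs_part qx _.
Unshelve. all: by end_near.
Qed.

(** A quadratic Taylor remainder with an explicit constant survives summation, so differentiating a
    series amounts to adding up the bounds of its terms ([quad_series]). *)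
Lemma is_derive_quad (f : R -> R) (x d B : R) :
  (forall h, `|f (x + h) - f x - h * d| <= B * h ^+ 2) -> is_derive x 1 f d.
Proof.
move=> HB.
have cv : (fun h : R => h^-1 *: (f (h *: 1 + x) - f x)) @ 0^' --> d.
  apply/cvgrPdist_le => e e0.
  have B1 : 0 < `|B| + 1 by rewrite ltr_wpDl.
  rewrite /= near_withinE.
  have [de] : exists2 d, 0 < d & d = e / (`|B| + 1).
    by exists (e / (`|B| + 1)) => //; exact: divr_gt0.
  move=> de0 deE; apply/nbhs_ballP; exists de => //= h.
  rewrite /ball /= sub0r normrN => hde hn0.
  rewrite /GRing.scale /= mulr1 [h + x]addrC.
  have hh : 0 < `|h| by rewrite normr_gt0.
  rewrite -(ler_pM2l hh) -normrM mulrBr mulrA divff// mul1r distrC.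
  apply: le_trans (HB h) _.
  rewrite -[h ^+ 2]ger0_norm ?sqr_ge0// normrX expr2 mulrA mulrC.
  rewrite ler_wpM2l//.
  apply: le_trans (_ : (`|B| + 1) * `|h| <= _).
    by rewrite ler_wpM2r//; have := ler_norm B; lra.
  by rewrite mulrC -ler_pdivlMr// -deE ltW.
apply: DeriveDef; first exact: (cvgP _ cv).
exact: (cvg_lim _ cv).
Qed.

Lemma der_quad (f f' : R -> R) :
  (forall x, exists B, forall h, `|f (x + h) - f x - h * f' x| <= B * h ^+ 2) ->
  der f f'.
Proof. by move=> H x; have [B HB] := H x; exact: is_derive_quad HB. Qed.

Lemma quad_series C (f f' : nat -> R -> R) (F F' : R -> R) (x h : R) :
  (forall x, sums (f ^~ x) (F x)) -> (forall x, sums (f' ^~ x) (F' x)) ->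
  (forall n, `|f n (x + h) - f n x - h * f' n x| <= C * wt n * h ^+ 2) ->
  `|F (x + h) - F x - h * F' x| <= C * h ^+ 2.
Proof.
move=> sf sf' H.
apply: (@sums_bound _ (fun n => f n (x + h) - f n x - h * f' n x)).
  by move=> n; rewrite mulrAC.
by apply: sums_B; [exact: sums_B|exact: sums_Z].
Qed.

Lemma MVT_der (f f' : R -> R) (x y : R) : der f f' ->
  exists2 c, `|c - x| <= `|y - x| & f y - f x = f' c * (y - x).
Proof.
move=> df; have [xy|yx] := leP x y.
  have [|c] := @MVT_segment R f f' x y xy (fun z _ => df z).
    by apply: continuous_subspaceT; exact: der_cont df.
  rewrite in_itv /= => /andP[xc cy] E; exists c => //.
  by rewrite !ger0_norm; lra.
have [|c] := @MVT_segment R f f' y x (ltW yx) (fun z _ => df z).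
  by apply: continuous_subspaceT; exact: der_cont df.
rewrite in_itv /= => /andP[yc cx] E; exists c => //.
  by rewrite !ler0_norm; lra.
by rewrite -[LHS]opprB E; ring.
Qed.

Lemma quad_der2 (f f' f'' : R -> R) (B x h : R) : der f f' -> der f' f'' ->
  (forall y, `|f'' y| <= B) ->
  `|f (x + h) - f x - h * f' x| <= B * h ^+ 2.
Proof.
move=> df df' HB.
have [c cx ->] := MVT_der x (x + h) df.
rewrite [x + h]addrC addrK in cx *.
rewrite [_ * h]mulrC -mulrBr normrM.
have [d dx ->] := MVT_der x c df'.
rewrite normrM mulrCA -[h ^+ 2]ger0_norm ?sqr_ge0// normrX expr2.
apply: ler_pM => //.
by rewrite ler_wpM2l.
Qed.

End SeriesLayer.

(** * The flat function, the bump built on it, and the decay of its Fourier coefficients *)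

Section FlatFunctions.
Context (R : realType).
Implicit Types (c s : R) (f : R -> R).

(* [xi 0] is smooth and flat at 0, and its derivatives are combinations of the [xi j]. *)
Definition xi (j : nat) (c : R) : R :=
  if 0 < c then c^-1 ^+ j * expR (- (c^-1 ^+ 2)) else 0.

(** For |y| > 1 the single term of degree n + 1 in the series of exp (y^2) beats |y|^n; for |y| <= 1
    the power is at most 1. *)
Lemma exp_poly_bound (n : nat) (y : R) :
  `|y| ^+ n * expR (- y ^+ 2) <= 1 + (n.+1)`!%:R.
Proof.
rewrite expRN ler_pdivrMr ?expR_gt0//.
have E := expR_ge1Dxn n (sqr_ge0 y).
have F0 : 0 < (n.+1)`!%:R :> R by rewrite ltr0n fact_gt0.
have h1 : (y ^+ 2) ^+ n.+1 <= (n.+1)`!%:R * expR (y ^+ 2).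
  rewrite -ler_pdivrMl// mulrC; apply: le_trans E; lra.
have h2 : `|y| ^+ n <= 1 + (y ^+ 2) ^+ n.+1.
  rewrite -[y ^+ 2]ger0_norm ?sqr_ge0// normrX.
  have [y1|y1] := leP `|y| 1.
    apply: le_trans (_ : 1 <= _); first by rewrite exprn_ile1.
    by rewrite lerDl exprn_ge0// exprn_ge0.
  apply: le_trans (_ : (`|y| ^+ 2) ^+ n.+1 <= _); last by lra.
  rewrite -exprM; apply: ler_weXn2l; first exact: ltW.
  lia.
have h3 : 1 <= expR (y ^+ 2) by rewrite -expR0 ler_expR sqr_ge0.
nra.
Qed.

(** The preceding bound at y = 1 / c with exponent j + k: flatness at 0 to every order k. *)
Lemma xi_small (j k : nat) c : `|xi j c| <= (1 + ((j + k).+1)`!%:R) * `|c| ^+ k.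
Proof.
rewrite /xi; case: ifPn => c0; last first.
  by rewrite normr0 mulr_ge0// ?exprn_ge0// addr_ge0// ler0n.
have := exp_poly_bound (j + k) c^-1.
have ci : 0 < c^-1 by rewrite invr_gt0.
rewrite !gtr0_norm// ?mulr_gt0 ?exprn_gt0 ?expR_gt0// => H.
rewrite -ler_pdivrMr ?exprn_gt0//; apply: le_trans H.
by rewrite exprD -exprVn mulrAC.
Qed.

Lemma xi_bound (j : nat) c : `|xi j c| <= 1 + (j.+1)`!%:R.
Proof. by have := xi_small j 0 c; rewrite expr0 mulr1 addn0. Qed.

Lemma der_xi (j : nat) :
  der (xi j) (fun c => - j%:R * xi j.+1 c + 2 * xi j.+3 c).
Proof.
move=> c; have [c0|c0|c0] := ltgtP c 0.
- have -> : - j%:R * xi j.+1 c + 2 * xi j.+3 c = 0.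
    by rewrite /xi ltNge (ltW c0) !mulr0 addr0.
  apply: (@near_eq_is_derive _ _ _ (cst 0)).
    near=> x; rewrite /xi ltNge ltW//; near: x; exact: lt_nbhsl.
- have -> : - j%:R * xi j.+1 c + 2 * xi j.+3 c =
     ((j%:R * c^-1 ^+ j.-1 * (- (c ^- 2))) * expR (- (c^-1 ^+ 2)) +
      c^-1 ^+ j * ((- (2 * c^-1 * (- c ^- 2))) * expR (- (c^-1 ^+ 2)))).
    rewrite /xi c0 -!exprVn; move: (expR _) => e; move: c^-1 => y.
    by case: j => [|j] /=; rewrite !exprS ?expr0; ring.
  have ei : is_derive c 1 (fun x : R => x^-1) (- c ^- 2).
    have := @is_deriveV R id c 1 1 (lt0r_neq0 c0) (is_derive_id _ _).
    by move/is_derive_eq; apply; rewrite /GRing.scale /= mulr1.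
  apply: (@near_eq_is_derive _ _ _
    (fun x : R => x^-1 ^+ j * expR (- (x^-1 ^+ 2)))).
    near=> x; rewrite /xi ifT//; near: x; exact: lt_nbhsr.
  have e1 : is_derive c 1 (fun x : R => x^-1 ^+ j)
     (j%:R * c^-1 ^+ j.-1 * (- c ^- 2)).
    have := @is_deriveX _ _ (fun x : R => x^-1) j c 1 _ ei.
    rewrite ?exprfctE.
    by move/is_derive_eq; apply; rewrite /GRing.scale /= -mulr_natl.
  have e2 : is_derive c 1 (fun x : R => - (x^-1 ^+ 2))
     (- (2 * c^-1 * (- c ^- 2))).
    have := is_deriveN (@is_deriveX _ _ (fun x : R => x^-1) 2 c 1 _ ei).
    rewrite ?exprfctE.
    by move/is_derive_eq; apply; rewrite /GRing.scale /= expr1 -mulr_natl.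
  have e3 := @is_derive1_comp _ expR _ c _ _ (is_derive_expR _) e2.
  have := is_deriveM e1 e3.
  move/is_derive_eq; apply; rewrite /GRing.scale /=.
  ring.
- rewrite c0; have -> : - j%:R * xi j.+1 0 + 2 * xi j.+3 0 = 0 :> R.
    by rewrite /xi ltxx !mulr0 addr0.
  (* At 0, flatness of order 2 is exactly the quadratic remainder for the derivative 0. *)
  apply: (is_derive_quad (B := 1 + ((j + 2).+1)`!%:R)) => h.
  rewrite add0r mulr0 subr0 {2}/xi ltxx subr0.
  by rewrite -[X in _ <= _ * X]ger0_norm ?sqr_ge0// normrX; exact: xi_small.
Unshelve. all: by end_near.
Qed.

Lemma xi0_ge0 c : 0 <= xi 0 c.
Proof. by rewrite /xi; case: ifP => // _; rewrite mul1r expR_ge0. Qed.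

Lemma xi0_le c d : c <= d -> xi 0 c <= xi 0 d.
Proof.
move=> cd; rewrite {1}/xi; case: ifPn => [c0|_]; last exact: xi0_ge0.
rewrite /xi (lt_le_trans c0 cd) !mul1r ler_expR lerN2.
have d0 := lt_le_trans c0 cd.
by apply: lerXn2r; rewrite ?nnegrE ?invr_ge0 ?lef_pV2 ?posrE// ltW.
Qed.

(** A class containing [hump], closed under differentiation, whose members are bounded and agree at
    - pi and pi: all that iterated integration by parts requires. *)
Inductive cls : (R -> R) -> Prop :=
| cls_b i j l : cls (fun s => xi j (cos s) * sin s ^+ i * cos s ^+ l)
| cls_D f g : cls f -> cls g -> cls (fun s => f s + g s)
| cls_Z k f : cls f -> cls (fun s => k * f s).

Lemma cls_per f : cls f -> f (- pi) = f pi.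
Proof.
elim=> [i j l|{}f g _ -> _ -> //|k {}f _ -> //].
by rewrite cosN sinN sinpi oppr0.
Qed.

Lemma cls_bound f : cls f -> exists M, forall s, `|f s| <= M.
Proof.
elim=> [i j l|{}f g _ [M HM] _ [N HN]|k {}f _ [M HM]].
- exists (1 + (j.+1)`!%:R) => s; rewrite -mulrA normrM -[X in _ <= X]mulr1.
  apply: ler_pM => //; first exact: xi_bound.
  rewrite normrM !normrX.
  by apply: mulr_ile1; rewrite ?exprn_ge0// exprn_ile1//; [exact: sin_max|exact: cos_max].
- exists (M + N) => s; apply: le_trans (ler_normD _ _) _.
  by apply: lerD; [exact: HM|exact: HN].
- by exists (`|k| * M) => s; rewrite normrM ler_wpM2l.
Qed.

Lemma der_X (g g' : R -> R) n : der g g' ->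
  der (fun x => g x ^+ n) (fun x => n%:R * g x ^+ n.-1 * g' x).
Proof.
move=> dg x; have := @is_deriveX _ _ g n x 1 _ (dg x).
rewrite exprfctE.
by move/is_derive_eq; apply; rewrite /GRing.scale /= -mulr_natl.
Qed.

Lemma cls_der f : cls f -> exists2 f', cls f' & der f f'.
Proof.
elim=> [i j l|{}f g _ [f' cf' df] _ [g' cg' dg]|k {}f _ [f' cf' df]].
- exists (fun s => (j%:R * (xi j.+1 (cos s) * sin s ^+ i.+1 * cos s ^+ l) +
    (-2) * (xi j.+3 (cos s) * sin s ^+ i.+1 * cos s ^+ l)) +
    (i%:R * (xi j (cos s) * sin s ^+ i.-1 * cos s ^+ l.+1) +
    (- l%:R) * (xi j (cos s) * sin s ^+ i.+1 * cos s ^+ l.-1))).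
    by apply: cls_D; apply: cls_D; apply: cls_Z; exact: cls_b.
  apply: der_ext (der_M (der_M (der_comp (der_xi j) (@der_cos R))
    (der_X i (@der_sin R))) (der_X l (@der_cos R))) _ _ => // s.
  rewrite !exprS; ring.
- by exists (fun s => f' s + g' s); [exact: cls_D|exact: der_D].
- by exists (fun s => k * f' s); [exact: cls_Z|exact: der_Z].
Qed.

Lemma cls_cont f : cls f -> continuous f.
Proof. by move=> /cls_der[f' _ /der_cont]. Qed.

Definition coscoef f (n : nat) := Int (- pi) pi (fun s => f s * cos (n%:R * s)).
Definition sincoef f (n : nat) := Int (- pi) pi (fun s => f s * sin (n%:R * s)).

Lemma sin_npi n : sin (n%:R * pi) = 0 :> R.
Proof.
elim: n => [|n IH]; first by rewrite mul0r sin0.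
by rewrite -natr1 mulrDl mul1r sinDpi IH oppr0.
Qed.

Lemma der_cosn (k : R) : der (fun s => cos (k * s)) (fun s => - k * sin (k * s)).
Proof.
apply: der_ext (der_comp (@der_cos R) (der_Z k (@der_id R))) _ _ => // s.
by rewrite mulr1 mulrN mulNr.
Qed.

Lemma der_sinn (k : R) : der (fun s => sin (k * s)) (fun s => k * cos (k * s)).
Proof.
apply: der_ext (der_comp (@der_sin R) (der_Z k (@der_id R))) _ _ => // s.
by rewrite mulr1.
Qed.

Lemma contM (u v : R -> R) : continuous u -> continuous v ->
  continuous (fun x => u x * v x).
Proof. by move=> cu cv x; apply: cvgM; [exact: cu|exact: cv]. Qed.

Lemma contZ k (u : R -> R) : continuous u -> continuous (fun x => k * u x).
Proof. by move=> cu x; apply: cvgM; [exact: cvg_cst|exact: cu]. Qed.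

Lemma pile : - pi <= pi :> R.
Proof. by have := @pi_ge0 R; lra. Qed.

Lemma coscoef_IBP f f' n : der f f' -> continuous f' ->
  n%:R * coscoef f n = - sincoef f' n.
Proof.
move=> df cf'; have dn := der_sinn n%:R.
have cn := der_cont (der_cosn n%:R).
have := Int_IBP pile df dn cf' (contZ (k := n%:R) cn).
rewrite mulrN sinN sin_npi oppr0 !mulr0 subrr sub0r /sincoef => ->.
rewrite opprK /coscoef -IntZ; last by apply: contM cn; exact: der_cont df.
by apply: Int_eq => s _; rewrite mulrCA.
Qed.

Lemma sincoef_IBP f f' n : der f f' -> continuous f' -> f (- pi) = f pi ->
  n%:R * sincoef f n = coscoef f' n.
Proof.
move=> df cf' fp; have dn := der_cosn n%:R.
have cn := der_cont (der_sinn n%:R).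
have := Int_IBP pile df dn cf' (contZ (k := - n%:R) cn).
rewrite mulrN cosN fp subrr sub0r /coscoef => ->.
rewrite /sincoef -[RHS]mulN1r -IntZ; last first.
  by apply: contM cn; exact: der_cont df.
rewrite -IntZ; last by apply: contM; [exact: der_cont df|exact: contZ].
by apply: Int_eq => s _; ring.
Qed.

(** Each integration by parts turns a factor n into a derivative, which is again in the class. The
    boundary terms vanish, by sin (n pi) = 0 in one case and by the equal values at both ends in the
    other. *)
Lemma cls_decay k f : cls f -> exists C, forall n,
  n%:R ^+ k * `|coscoef f n| <= C /\ n%:R ^+ k * `|sincoef f n| <= C.
Proof.
elim: k f => [|k IH] f cf.
  have [M HM] := cls_bound cf; exists (M * (pi - - pi)) => n.
  rewrite !mul1r; split; apply: Int_norm => //; try exact: pile.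
  - exact: contM (cls_cont cf) (der_cont (der_cosn _)).
  - move=> s _; rewrite normrM -[M]mulr1; apply: ler_pM => //; exact: cos_max.
  - exact: contM (cls_cont cf) (der_cont (der_sinn _)).
  - move=> s _; rewrite normrM -[M]mulr1; apply: ler_pM => //; exact: sin_max.
have [f' cf' df] := cls_der cf; have [C HC] := IH _ cf'.
exists C => n; have [h1 h2] := HC n.
have n0 : `|n%:R| = n%:R :> R by rewrite ger0_norm.
have e1 : n%:R * `|coscoef f n| = `|sincoef f' n|.
  by rewrite -{1}n0 -normrM (coscoef_IBP n df (cls_cont cf')) normrN.
have e2 : n%:R * `|sincoef f n| = `|coscoef f' n|.
  by rewrite -{1}n0 -normrM (sincoef_IBP n df (cls_cont cf') (cls_per cf)).
by rewrite !exprSr -!mulrA e1 e2.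
Qed.

Definition hump s := xi 0 (cos s).

Lemma cls_hump : cls hump.
Proof.
have := cls_b 0 0 0; congr cls; apply/funext => s.
by rewrite !expr0 !mulr1.
Qed.

Lemma hump_ge0 s : 0 <= hump s. Proof. exact: xi0_ge0. Qed.

Lemma hump_even s : hump (- s) = hump s. Proof. by rewrite /hump cosN. Qed.

Lemma sincoef_hump n : sincoef hump n = 0.
Proof.
have humpc : continuous (fun s => hump s * sin (n%:R * s)).
  exact: contM (cls_cont cls_hump) (der_cont (der_sinn _)).
have : sincoef hump n = - sincoef hump n.
  rewrite {1}/sincoef Int_oppr//; last exact: pi_ge0.
  rewrite /sincoef -[in RHS]mulN1r -IntZ//; apply: Int_eq => s _.
  by rewrite hump_even mulrN sinN mulN1r mulrN.
lra.
Qed.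

End FlatFunctions.

(** * Rapidly decreasing cosine series, and uniqueness of cosine coefficients *)

Section Rapid.
Context (R : realType).
Implicit Types (u v : nat -> R) (D : R -> R).

Definition rap u := forall k, exists C, forall n, n.+1%:R ^+ k * `|u n| <= C.

Lemma rap_qs u k : rap u -> exists C, qs C (fun n => n.+1%:R ^+ k * `|u n|).
Proof.
(* Two extra powers pay for the weight, as (n + 1) (n + 2) is at most 2 (n + 1)^2. *)
move=> /(_ k.+2)[C HC]; exists (2 * C) => n.
rewrite ger0_norm ?mulr_ge0 ?exprn_ge0//.
rewrite /wt ler_pdivlMr ?ltr0n//.
apply: le_trans (ler_wpM2l _ (HC n)) => //.
have -> : n.+1%:R ^+ k.+2 * `|u n| = n.+1%:R ^+ 2 * (n.+1%:R ^+ k * `|u n|).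
  by rewrite mulrA -exprD.
have h : 0 <= n.+1%:R ^+ k * `|u n| by rewrite mulr_ge0 ?exprn_ge0.
move: (n.+1%:R ^+ k * `|u n|) h => w w0.
rewrite mulrCA mulrA [X in _ <= X]mulrC ler_wpM2l// natrM expr2.
by rewrite -!natrM ler_nat; lia.
Qed.

Lemma rap_le u v M : rap u -> (forall n, `|v n| <= M * `|u n|) -> rap v.
Proof.
move=> ru uv k; have [C HC] := ru k; exists (`|M| * C) => n.
apply: le_trans (ler_wpM2l _ (HC n)) => //.
rewrite mulrCA ler_wpM2l// ?exprn_ge0//; apply: le_trans (uv n) _.
by rewrite ler_wpM2r// ler_norm.
Qed.

Lemma rap_natmul u : rap u -> rap (fun n => n%:R * u n).
Proof.
move=> ru k; have [C HC] := ru k.+1; exists C => n.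
apply: le_trans (HC n); rewrite normrM exprSr -mulrA ler_wpM2l ?exprn_ge0//.
by rewrite ler_wpM2r// ger0_norm// ler_nat.
Qed.

Lemma rap_bqs u (b : nat -> R) M : rap u -> (forall n, `|b n| <= M) ->
  exists C, qs C (fun n => u n * b n).
Proof.
move=> ru bM; have [C HC] := rap_qs 0 ru; exists (C * `|M|) => n.
rewrite normrM mulrAC; apply: ler_pM => //.
  by have := HC n; rewrite expr0 mul1r normr_id.
by apply: le_trans (bM n) _; exact: ler_norm.
Qed.

Lemma sums_single u m l : (forall n, n != m -> u n = 0) -> sums u l -> l = u m.
Proof.
move=> u0 su; apply: (sums_uniq su); exists (m.+1%:R * `|u m|) => N.
have [mN|Nm] := ltnP m N.
  rewrite (bigD1 (Ordinal mN))//= big1 ?addr0 ?subrr ?normr0 ?mulr_ge0 ?divr_ge0//.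
  by move=> i im; apply: u0; apply: contra_neq im => im; exact/val_inj.
rewrite big1 ?subr0; last first.
  by move=> i _; apply: u0; rewrite ltn_eqF// (leq_trans (ltn_ord i)).
by rewrite mulrAC ler_peMl// ler_pdivlMr// mul1r ler_nat.
Qed.

Lemma sums_ge0 u l : (forall n, 0 <= u n) -> sums u l -> 0 <= l.
Proof.
move=> u0 /sums_cvg h; rewrite -(cvg_lim _ h)//.
apply: limr_ge; first exact: (cvgP _ h).
by near=> n; apply: sumr_ge0 => i _; exact: u0.
Unshelve. all: by end_near.
Qed.

Definition cser u (t : R) := Ssum (fun n => u n * cos (n%:R * t)).
Definition cser' u (t : R) := - Ssum (fun n => n%:R * u n * sin (n%:R * t)).

Lemma cser_sums u t : rap u -> sums (fun n => u n * cos (n%:R * t)) (cser u t).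
Proof.
move=> ru.
have [C HC] := rap_bqs ru (fun n : nat => cos_max (n%:R * t)).
exact: qs_sums HC.
Qed.

Lemma cser'_sums u t : rap u ->
  sums (fun n => - (n%:R * u n * sin (n%:R * t))) (cser' u t).
Proof.
move=> ru.
have [C HC] := rap_bqs (rap_natmul ru) (fun n : nat => sin_max (n%:R * t)).
have := sums_Z (-1) (qs_sums HC); rewrite mulN1r.
by under eq_fun do rewrite mulN1r.
Qed.

Lemma cser_quad u : rap u -> exists B, forall x h,
  `|cser u (x + h) - cser u x - h * cser' u x| <= B * h ^+ 2.
Proof.
move=> ru; have [C HC] := rap_qs 2 ru; exists C => x h.
apply: (quad_series (f := fun n x => u n * cos (n%:R * x))
  (f' := fun n x => - (n%:R * u n * sin (n%:R * x)))).
- by move=> y; exact: cser_sums.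
- by move=> y; exact: cser'_sums.
move=> n.
have d1 := @der_cosn R n%:R.
have d2 := der_Z (- n%:R) (@der_sinn R n%:R).
have Q := @quad_der2 _ _ _ _ (n.+1%:R ^+ 2) x h d1 d2.
have -> : u n * cos (n%:R * (x + h)) - u n * cos (n%:R * x) -
   h * - (n%:R * u n * sin (n%:R * x)) =
   u n * (cos (n%:R * (x + h)) - cos (n%:R * x) - h * (- n%:R * sin (n%:R * x))).
  by ring.
rewrite normrM; apply: le_trans (ler_wpM2l _ (Q _)) _ => //.
  move=> y; rewrite !normrM normrN (ger0_norm (ler0n _ _)) expr2.
  apply: ler_pM => //.
    by rewrite ler_nat.
  rewrite -[X in _ <= X]mulr1; apply: ler_pM => //; first by rewrite ler_nat.
  exact: cos_max.
rewrite mulrA ler_wpM2r// ?sqr_ge0// mulrC.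
apply: le_trans (HC n); exact: ler_norm.
Qed.

Lemma der_cser u : rap u -> der (cser u) (cser' u).
Proof.
move=> ru; have [B HB] := cser_quad ru.
by apply: der_quad => x; exists B.
Qed.

Lemma icos n : Int (- pi) pi (fun s : R => cos (n%:R * s)) =
  if n == 0 then 2 * pi else 0.
Proof.
case: eqP => [->|/eqP n0].
  under Int_eq do rewrite mul0r cos0.
  by rewrite Int_cst ?pile//; ring.
have nn0 : n%:R != 0 :> R by rewrite pnatr_eq0.
have d := der_Z n%:R^-1 (@der_sinn R n%:R).
rewrite (@Int_FTC _ _ _ _ (fun s => n%:R^-1 * sin (n%:R * s))) ?pile//.
- by rewrite mulrN sinN sin_npi oppr0 mulr0 subrr.
- exact: der_cont (der_cosn _).
- by apply: der_ext d _ _ => // s; rewrite mulKf.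
Qed.

Lemma icoscos n m : Int (- pi) pi (fun s : R => cos (n%:R * s) * cos (m%:R * s)) =
  if n == m then (if n == 0 then 2 * pi else pi) else 0.
Proof.
wlog nm : n m / (m <= n)%N.
  move=> H; have [/H//|/ltnW/H] := leqP m n.
  rewrite [m == n]eq_sym; under Int_eq do rewrite mulrC.
  by move=> ->; case: eqP => // ->.
have -> : Int (- pi) pi (fun s : R => cos (n%:R * s) * cos (m%:R * s)) =
    2^-1 * (Int (- pi) pi (fun s : R => cos ((n - m)%N%:R * s)) +
    Int (- pi) pi (fun s : R => cos ((n + m)%N%:R * s))).
  rewrite -IntD; try exact: der_cont (der_cosn _).
  rewrite -IntZ; last by apply: der_cont (der_D (der_cosn _) (der_cosn _)).
  apply: Int_eq => s _; by rewrite natrB// natrD mulrBl mulrDl cosB cosD; field.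
rewrite !icos subn_eq0 addn_eq0 [in RHS]eqn_leq nm andbT.
case: (leqP n m) => nm'; last first.
  have -> : (n == 0) = false by apply/negbTE; rewrite -lt0n (leq_ltn_trans _ nm').
  by rewrite addr0 mulr0.
have -> : n = m by apply/eqP; rewrite eqn_leq nm nm'.
by rewrite andbb; case: eqP => _; field.
Qed.

(** cos (n x) is a Chebyshev polynomial in cos x. The recurrence has two terms, hence the induction
    on two consecutive indices. *)
Lemma cos_nat_eq n (x y : R) : cos x = cos y -> cos (n%:R * x) = cos (n%:R * y).
Proof.
move=> xy; have: cos (n%:R * x) = cos (n%:R * y) /\
    cos (n.+1%:R * x) = cos (n.+1%:R * y).
  elim: n => [|n [IH1 IH2]]; first by rewrite !mul0r !mul1r cos0.
  split=> //.
  have E z : cos (n.+2%:R * z) = 2 * cos z * cos (n.+1%:R * z) - cos (n%:R * z).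
    have -> : n.+2%:R * z = n.+1%:R * z + z by rewrite -[in LHS]natr1; ring.
    have -> : n%:R * z = n.+1%:R * z - z by rewrite -[in RHS]natr1; ring.
    by rewrite cosB cosD; ring.
  by rewrite !E IH1 IH2 xy.
by case.
Qed.

Lemma cos_lip (x y : R) : `|cos x - cos y| <= `|x - y|.
Proof.
have [c _ ->] := MVT_der y x (@der_cos R).
by rewrite normrM normrN ler_piMl// sin_max.
Qed.

Lemma cont_cst (k : R) : continuous (fun _ : R => k).
Proof. by move=> x; exact: cvg_cst. Qed.

Lemma contD (f g : R -> R) : continuous f -> continuous g ->
  continuous (fun x => f x + g x).
Proof. by move=> cf cg x; apply: cvgD; [exact: cf|exact: cg]. Qed.

Lemma contB (f g : R -> R) : continuous f -> continuous g ->
  continuous (fun x => f x - g x).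
Proof. by move=> cf cg x; apply: cvgB; [exact: cf|exact: cg]. Qed.

Lemma contX (f : R -> R) n : continuous f -> continuous (fun x => f x ^+ n).
Proof.
move=> cf; elim: n => [|n IH].
  by under eq_fun do rewrite expr0; exact: cont_cst.
by under eq_fun do rewrite exprS; exact: contM.
Qed.

Lemma contcomp (f g : R -> R) : continuous f -> continuous g ->
  continuous (fun x => f (g x)).
Proof. by move=> cf cg x; apply: (continuous_comp (cg x)); exact: cf. Qed.

Lemma cont_id : continuous (fun x : R => x).
Proof. by move=> x; exact: cvg_id. Qed.

(** The multipliers q for which D q is still orthogonal to every cos (m s) are stable under
    multiplication by cos s, by the product formula for cosines; so they contain all polynomials in
    cos s, in particular powers peaked at a point. *)
Lemma cosint_poly D (c0 e : R) N : continuous D ->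
  (forall m, Int 0 pi (fun s => D s * cos (m%:R * s)) = 0) ->
  Int 0 pi (fun s => D s * (e - (cos s - c0) ^+ 2 / 4) ^+ N) = 0.
Proof.
move=> cD HD.
pose P (q : R -> R) := continuous q /\
  forall m, Int 0 pi (fun s => D s * q s * cos (m%:R * s)) = 0.
have cm m : continuous (fun s : R => cos (m%:R * s)) by apply: der_cont (der_cosn _).
have cc : continuous (@cos R) := @continuous_cos R.
have PD q q' : P q -> P q' -> P (fun s => q s + q' s).
  move=> [cq Hq] [cq' Hq']; split; first exact: contD.
  move=> m; have -> : Int 0 pi (fun s => D s * (q s + q' s) * cos (m%:R * s)) =
    Int 0 pi (fun s => D s * q s * cos (m%:R * s)) +
    Int 0 pi (fun s => D s * q' s * cos (m%:R * s)); last by rewrite Hq Hq' addr0.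
  rewrite -IntD; try by do !apply: contM.
  by apply: Int_eq => s _; ring.
have PZ k q : P q -> P (fun s => k * q s).
  move=> [cq Hq]; split; first exact: contZ.
  move=> m; rewrite -[RHS](mulr0 k) -[X in _ * X](Hq m) -IntZ; try by do !apply: contM.
  by apply: Int_eq => s _; ring.
have Pc q : P q -> P (fun s => q s * cos s).
  move=> [cq Hq]; split; first exact: contM.
  case=> [|m].
    by rewrite -[RHS](Hq 1); apply: Int_eq => s _; rewrite mul0r cos0 mul1r mulr1 mulrA.
  have -> : Int 0 pi (fun s => D s * (q s * cos s) * cos (m.+1%:R * s)) =
    2^-1 * (Int 0 pi (fun s => D s * q s * cos (m.+2%:R * s)) +
    Int 0 pi (fun s => D s * q s * cos (m%:R * s))); last by rewrite !Hq addr0 mulr0.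
  rewrite -IntD; try by do !apply: contM.
  rewrite -IntZ; last by apply: contD; do !apply: contM.
  apply: Int_eq => s _.
  have -> : m.+2%:R * s = m.+1%:R * s + s by rewrite -[in LHS]natr1; ring.
  have -> : m%:R * s = m.+1%:R * s - s by rewrite -[in RHS]natr1; ring.
  by rewrite cosB cosD; field.
have Pq q : P q -> P (fun s => (e - (cos s - c0) ^+ 2 / 4) * q s).
  move=> Hq; have H1 := Pc _ Hq; have H2 := Pc _ H1.
  have := PD _ _ (PD _ _ (PZ (e - c0 ^+ 2 / 4) _ Hq) (PZ (c0 / 2) _ H1)) (PZ (- 4^-1) _ H2).
  by congr P; apply/funext => s; field.
have PN : P (fun s => (e - (cos s - c0) ^+ 2 / 4) ^+ N).
  elim: N => [|N IH].
    split; first by under eq_fun do rewrite expr0; exact: cont_cst.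
    by move=> m; rewrite -[RHS](HD m); apply: Int_eq => s _; rewrite expr0 mulr1.
  by have := Pq _ IH; congr P; apply/funext => s; rewrite [RHS]exprS.
have [_ /(_ 0) E] := PN; rewrite -[RHS]E; apply: Int_eq => s _.
by rewrite mul0r cos0 mulr1.
Qed.

Lemma min2_ex (x y : R) : 0 < x -> 0 < y -> exists d, [/\ 0 < d, d <= x & d <= y].
Proof.
by move=> x0 y0; exists (Num.min x y); rewrite lt_min x0 y0 !ge_min !lexx orbT.
Qed.

(** By orthogonality the integral of D q^N + M over [0, pi] is M pi for every N, whereas the
    contribution of [l, r] grows linearly in N and the rest is nonnegative. *)
Lemma peak_contra D (q : R -> R) (l r M c k : R) : 0 <= l -> l < r -> r <= pi ->
  0 < c -> 0 < k -> continuous D -> continuous q ->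
  (forall N s, 0 <= s <= pi -> 0 <= D s * q s ^+ N + M) ->
  (forall N s, l <= s <= r -> c * (1 + N%:R * k) <= D s * q s ^+ N + M) ->
  (forall N, Int 0 pi (fun s => D s * q s ^+ N) = 0) -> False.
Proof.
move=> l0 lr rp c0 k0 cD cq low high HD.
have main N : c * (1 + N%:R * k) * (r - l) <= M * pi.
  have cF : continuous (fun s => D s * q s ^+ N + M).
    by apply: contD; [apply: contM => //; exact: contX|exact: cont_cst].
  have <- : Int 0 pi (fun s => D s * q s ^+ N + M) = M * pi.
    rewrite IntD; [|by apply: contM; [|exact: contX]|exact: cont_cst].
    by rewrite HD Int_cst ?pi_ge0// add0r subr0.
  rewrite (@Int_split _ 0 l pi)//; [|lra].
  rewrite (@Int_split _ l r pi)//; [|lra].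
  have p1 : 0 <= Int 0 l (fun s => D s * q s ^+ N + M).
    by apply: Int_ge0 => s /andP[? ?]; apply: low; apply/andP; split; lra.
  have p2 : 0 <= Int r pi (fun s => D s * q s ^+ N + M).
    by apply: Int_ge0 => s /andP[? ?]; apply: low; apply/andP; split; lra.
  have p3 : c * (1 + N%:R * k) * (r - l) <= Int l r (fun s => D s * q s ^+ N + M).
    rewrite -Int_cst; last exact: ltW.
    by apply: Int_le => //; [exact: cont_cst|exact: high].
  lra.
have c1 : 0 < c * k * (r - l) by rewrite !mulr_gt0// subr_gt0.
have MM : 0 <= M * pi.
  apply: le_trans (main 0); rewrite mul0r addr0 mulr1 mulr_ge0 ?ltW// subr_gt0//.
have := archi_boundP (divr_ge0 MM (ltW c1)); rewrite ltr_pdivrMr//.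
move: (Num.Def.archi_bound _) => N hN; have := main N.
have h : 0 < c * (r - l) by rewrite mulr_gt0// subr_gt0.
have -> : c * (1 + N%:R * k) * (r - l) = c * (r - l) + N%:R * (c * k * (r - l)).
  by ring.
lra.
Qed.

(** If D were positive at t0, the powers of a polynomial in cos s exceeding 1 near t0, and lying in
    [0, 1] where D may be negative, would give a large positive integral. *)
Lemma cosint_nonpos D (t0 : R) : continuous D ->
  (forall m, Int 0 pi (fun s => D s * cos (m%:R * s)) = 0) ->
  0 < t0 < pi -> D t0 <= 0.
Proof.
move=> cD HD /andP[t00 t0p]; rewrite leNgt; apply/negP => Dt0.
have D2 : 0 < D t0 / 2 by rewrite divr_gt0.
have [d [d0 da db near]] : exists d, [/\ 0 < d, d <= t0, d <= pi - t0 &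
    forall x, `|x - t0| <= d -> D t0 / 2 <= D x].
  have : \forall x \near t0, D t0 / 2 < D x.
    by apply: (cvgr_gt (D t0) (cD t0)); lra.
  move=> /nbhs_ballP[e /= e0 He].
  have pt : 0 < pi - t0 by lra.
  have [d1 [d10 d1t d1p]] := min2_ex t00 pt.
  have e2 : 0 < e / 2 by rewrite divr_gt0.
  have [d [d0 dd1 de]] := min2_ex d10 e2.
  exists d; split => //; [exact: le_trans dd1 _|exact: le_trans dd1 _|].
  move=> x xd; apply/ltW/He; rewrite /ball /= distrC.
  by apply: le_lt_trans xd _; lra.
have cmono := @ltr_cos R.
have i0 : t0 \in `[0, pi]%R by rewrite in_itv /= !ltW.
have il : t0 - d \in `[0, pi]%R by rewrite in_itv /=; apply/andP; split; lra.
have ir : t0 + d \in `[0, pi]%R by rewrite in_itv /=; apply/andP; split; lra.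
(* By monotonicity of cos on [0, pi], a point farther than d from t0 has its cosine at least eta
   away from cos t0. *)
have [eta [eta0 eta1 eta2]] : exists eta, [/\ 0 < eta,
    eta <= cos (t0 - d) - cos t0 & eta <= cos t0 - cos (t0 + d)].
  by apply: min2_ex; rewrite subr_gt0 cmono// ?ltrBlDr ltrDl.
have far x : 0 <= x <= pi -> d < `|x - t0| -> eta <= `|cos x - cos t0|.
  move=> xp dx; have ix : x \in `[0, pi]%R by rewrite in_itv.
  have [xt|tx] := leP x t0.
    have : cos (t0 - d) < cos x.
      by rewrite cmono//; rewrite ler0_norm ?subr_le0// in dx; clear -dx; lra.
    by move=> hh; apply: le_trans (ler_norm _); clear -eta1 hh; lra.
  have : cos x < cos (t0 + d).
    by rewrite cmono//; rewrite gtr0_norm ?subr_gt0// in dx; clear -dx; lra.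
  by move=> hh; rewrite -normrN; apply: le_trans (ler_norm _); clear -eta2 hh; lra.
have [M HM] : exists M, forall x, 0 <= x <= pi -> `|D x| <= M.
  have /compact_bounded[M [_ HM]] : compact (D @` `[0, pi]).
    apply: continuous_compact; last exact: segment_compact.
    exact: continuous_subspaceT.
  exists (M + 1) => x xp; apply: HM; first by rewrite ltrDl.
  by exists x => //=; rewrite in_itv.
have eta2' : 0 < eta / 2 by rewrite divr_gt0.
have [d' [d'0 d'd d'e]] := min2_ex d0 eta2'.
have cosb (s : R) : `|cos s - cos t0| <= 2.
  apply: le_trans (ler_normB _ _) _.
  by have := cos_max s; have := cos_max t0; clear; lra.
have sqb (s b : R) : `|cos s - cos t0| <= b -> (cos s - cos t0) ^+ 2 <= b ^+ 2.
  move=> h; rewrite -[X in X <= _]ger0_norm ?sqr_ge0// normrX.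
  by apply: lerXn2r => //; rewrite nnegrE ?(le_trans _ h).
(* The graph crosses 1 where |cos s - cos t0| = eta; the division by 4 keeps q nonnegative, since
   that distance never exceeds 2. *)
pose q (s : R) := 1 + eta ^+ 2 / 4 - (cos s - cos t0) ^+ 2 / 4.
have q0 s : 0 <= q s.
  have := sqb s _ (cosb s); rewrite /q; have := sqr_ge0 eta; clear; lra.
have cq : continuous q.
  apply: contB; first exact: cont_cst.
  have h : continuous (fun x : R => cos x - cos t0).
    by apply: contB; [exact: continuous_cos|exact: cont_cst].
  have h2 := contX (n := 2%N) h.
  by apply: contM; [exact: h2|exact: cont_cst].
have low N s : 0 <= s <= pi -> 0 <= D s * q s ^+ N + M.
  move=> sp; have M0 : 0 <= M := le_trans (normr_ge0 _) (HM _ sp).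
  have [sd|sd] := leP `|s - t0| d.
    rewrite addr_ge0// mulr_ge0 ?exprn_ge0//.
    by apply: le_trans (near _ sd); exact: ltW.
  have q1 : q s <= 1.
    have h := far _ sp sd.
    have : eta ^+ 2 <= (cos s - cos t0) ^+ 2.
      rewrite -[X in _ <= X]ger0_norm ?sqr_ge0// normrX.
      by apply: lerXn2r => //; rewrite nnegrE ltW.
    rewrite /q; clear; lra.
  have : `|D s * q s ^+ N| <= M.
    rewrite normrM normrX (ger0_norm (q0 s)) -[M]mulr1.
    by apply: ler_pM; rewrite ?exprn_ge0 ?exprn_ile1 ?HM.
  by rewrite ler_norml => /andP[+ _]; clear; lra.
(* This is eta^2 / 4 - (eta / 2)^2 / 4, the excess of q over 1 within distance d' of t0. *)
pose k : R := eta ^+ 2 * 3 / 16.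
have k0 : 0 < k by rewrite /k !mulr_gt0// ?exprn_gt0// invr_gt0.
have high N s : t0 - d' <= s <= t0 + d' ->
    D t0 / 2 * (1 + N%:R * k) <= D s * q s ^+ N + M.
  move=> sd0; have sd : `|s - t0| <= d'.
    by move: sd0; rewrite ler_norml => /andP[h1 h2]; apply/andP; clear -h1 h2; split; lra.
  have sp : 0 <= s <= pi.
    move: sd0 => /andP[h1 h2]; apply/andP.
    by clear -h1 h2 da db d'd; split; lra.
  have M0 : 0 <= M := le_trans (normr_ge0 _) (HM _ sp).
  have ql : 1 + k <= q s.
    have : (cos s - cos t0) ^+ 2 <= (eta / 2) ^+ 2.
      by apply: sqb; apply: le_trans (cos_lip _ _) _; exact: le_trans sd _.
    rewrite /q /k exprMn; clear; lra.
  have Nk M' : 0 <= M'%:R * k by rewrite mulr_ge0// ltW.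
  have b : 1 + N%:R * k <= q s ^+ N.
    elim: N => [|N IH]; first by rewrite mul0r addr0 expr0.
    rewrite exprS; apply: le_trans (_ : (1 + k) * (1 + N%:R * k) <= _).
      have := mulr_ge0 (Nk N) (ltW k0); rewrite -[N.+1%:R]natr1; clear; lra.
    by apply: ler_pM => //; rewrite addr_ge0// ltW.
  have Dn : D t0 / 2 <= D s by apply: near; exact: le_trans sd _.
  apply: le_trans (_ : D s * q s ^+ N <= _); last by rewrite lerDl.
  by apply: ler_pM => //; [exact: ltW|rewrite addr_ge0].
apply: (@peak_contra D q (t0 - d') (t0 + d') M (D t0 / 2) k) => //.
- by clear -da d'd; lra.
- by clear -d'0; lra.
- by clear -db d'd; lra.
- by move=> N; exact: cosint_poly.
Qed.

End Rapid.

(** * Fourier inversion for the bump, and the properties of its self-convolution Uh *)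

Section FourierInversion.
Context (R : realType).
Implicit Types (D f : R -> R).

(** Nonpositivity is applied to D and to - D. An endpoint is reached by continuity: a positive value
    there persists at a point moved slightly towards the middle of [0, pi]. *)
Lemma cosint_zero D (t : R) : continuous D ->
  (forall m, Int 0 pi (fun s => D s * cos (m%:R * s)) = 0) ->
  0 <= t <= pi -> D t = 0.
Proof.
move=> cD HD.
have pos : forall F : R -> R, continuous F ->
    (forall m, Int 0 pi (fun s => F s * cos (m%:R * s)) = 0) ->
    forall x, 0 <= x <= pi -> F x <= 0.
  move=> F cF HF x /andP[x0 xp]; rewrite leNgt; apply/negP => Fx.
  have p0 := @pi_gt0 R.
  have : \forall y \near x, 0 < F y by exact: (cvgr_gt (F x) (cF x)).
  move=> /nbhs_ballP[e /= e0 He].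
  pose y := if x < pi / 2 then x + Num.min (e / 2) (pi / 4)
            else x - Num.min (e / 2) (pi / 4).
  have [m0 me mp] : [/\ 0 < Num.min (e / 2) (pi / 4), Num.min (e / 2) (pi / 4) <= e / 2
      & Num.min (e / 2) (pi / 4) <= pi / 4].
    by rewrite minEle; case: ifPn; rewrite -?ltNge; split; lra.
  have yF : 0 < F y.
    apply: He; rewrite /ball /= /y; case: ifPn => _.
      by rewrite opprD addNKr normrN gtr0_norm//; lra.
    by rewrite opprB addrC subrK gtr0_norm//; lra.
  have : F y <= 0.
    apply: cosint_nonpos => //; rewrite /y; case: ifPn; rewrite -?leNgt => h;
    by apply/andP; split; lra.
  lra.
move=> tp; apply/eqP; rewrite eq_le pos//= -oppr_le0.
have -> : - D t = (fun s => -1 * D s) t by rewrite /= mulN1r.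
apply: (pos (fun s => -1 * D s)) => //; first exact: contZ.
move=> m; rewrite -[RHS](mulr0 (-1)) -[X in _ = _ * X](HD m) -IntZ.
  by apply: Int_eq => s _; rewrite mulrA.
by apply: contM => //; exact: der_cont (der_cosn _).
Qed.

Lemma Int_even f : continuous f -> (forall s, f (- s) = f s) ->
  Int (- pi) pi f = 2 * Int 0 pi f.
Proof.
have p0 := @pi_gt0 R; move=> cf ef.
rewrite (@Int_split _ _ 0)//; [|lra..].
rewrite Int_oppr0//; last lra.
under Int_eq do rewrite ef.
ring.
Qed.

(** These are 2 pi times the coefficients of the cosine expansion of [hump]; for n > 0 the
    frequencies n and - n are folded together, hence the factor 2. *)
Definition humpc (n : nat) : R := (if n == 0 then 1 else 2) * coscoef (@hump R) n.

Lemma rap_coscoef f : cls f -> rap (coscoef f).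
Proof.
move=> cf k; have [C0 H0] := cls_decay 0 cf; have [C H] := cls_decay k cf.
exists (C0 + 2 ^+ k * C) => n.
have C00 : 0 <= C0.
  by have [h _] := H0 0; apply: le_trans h; rewrite mulr_ge0 ?exprn_ge0.
have CC : 0 <= C.
  by have [h _] := H 0; apply: le_trans h; rewrite mulr_ge0 ?exprn_ge0.
case: n => [|n].
  rewrite expr1n; have [h _] := H0 0; rewrite expr0 in h.
  by apply: le_trans h _; rewrite lerDl mulr_ge0 ?exprn_ge0.
have [h _] := H n.+1; apply: le_trans (_ : 2 ^+ k * C <= _); last by rewrite lerDr.
apply: le_trans (ler_wpM2l _ h); rewrite ?exprn_ge0// mulrA -exprMn.
rewrite ler_wpM2r//; apply: lerXn2r; rewrite ?nnegrE ?mulr_ge0//.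
by rewrite -natrM ler_nat; lia.
Qed.

Lemma rap_humpc : rap humpc.
Proof.
apply: (rap_le (M := 2) (rap_coscoef (@cls_hump R))) => n.
by rewrite /humpc normrM ler_wpM2r//; case: eqP => _; rewrite ger0_norm// ler1n.
Qed.

Lemma rap_bound (u : nat -> R) : rap u -> exists C, qs C u.
Proof.
move=> ru; have [C HC] := rap_qs 0 ru; exists C => n.
by have := HC n; rewrite expr0 mul1r normr_id.
Qed.

Lemma qs_M (u b : nat -> R) C : qs C u -> (forall n, `|b n| <= 1) ->
  qs C (fun n => u n * b n).
Proof.
move=> qu b1 n; rewrite normrM; apply: le_trans (qu n).
by rewrite ler_piMr// b1.
Qed.

(** The difference of the two sides is continuous, depends on t through cos t only, and has zero
    cosine coefficients by termwise integration and orthogonality. Uniqueness kills it on [0, pi],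
    and t may be replaced by acos (cos t). *)
Lemma humpc_inv (t : R) : hump t = (2 * pi)^-1 * cser humpc t.
Proof.
have rX := rap_humpc.
have cS : continuous (cser humpc) by apply: der_cont (der_cser rX).
have cX' := cls_cont (@cls_hump R).
pose D (s : R) := hump s - (2 * pi)^-1 * cser humpc s.
have cD : continuous D by apply: contB => //; exact: contZ.
have cosE (x y : R) : cos x = cos y -> D x = D y.
  move=> xy; rewrite /D /hump xy; congr (_ - _ * Ssum _); apply/funext => n.
  by rewrite (cos_nat_eq n xy).
have HD m : Int 0 pi (fun s => D s * cos (m%:R * s)) = 0.
  have cm := der_cont (@der_cosn R m%:R).
  have : Int (- pi) pi (fun s => D s * cos (m%:R * s)) =
      2 * Int 0 pi (fun s => D s * cos (m%:R * s)).
    apply: Int_even; first exact: contM.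
    by move=> s; rewrite mulrN cosN (cosE (- s) s) ?cosN.
  suff -> : Int (- pi) pi (fun s => D s * cos (m%:R * s)) = 0 by lra.
  have -> : Int (- pi) pi (fun s => D s * cos (m%:R * s)) =
      coscoef (@hump R) m - (2 * pi)^-1 * Int (- pi) pi (fun s => cser humpc s * cos (m%:R * s)).
    rewrite /coscoef -IntZ; last exact: contM.
    rewrite -IntB; [|exact: contM|by apply: contZ; exact: contM].
    by apply: Int_eq => s _; rewrite /D; ring.
  have [C HC] := rap_bound rX.
  have := @Int_sums R C (- pi) pi
    (fun n s => humpc n * cos (n%:R * s) * cos (m%:R * s))
    (fun s => cser humpc s * cos (m%:R * s)) (pile R).
  move=> /(_ _ _ _ _) H.
  have : sums (fun n => Int (- pi) pi (fun s => humpc n * cos (n%:R * s) * cos (m%:R * s)))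
     (Int (- pi) pi (fun s => cser humpc s * cos (m%:R * s))).
    apply: H.
    - move=> n; apply: contM => //; apply: contZ; exact: der_cont (der_cosn _).
    - exact: contM.
    - move=> x; have := sums_Z (cos (m%:R * x)) (cser_sums x rX).
      by congr sums; [apply/funext => n|]; rewrite mulrC.
    - move=> n x _; rewrite normrM.
      apply: le_trans (qs_M HC (fun n => cos_max (n%:R * x)) n).
      by rewrite ler_piMr// cos_max.
  have E n : Int (- pi) pi (fun s => humpc n * cos (n%:R * s) * cos (m%:R * s)) =
      humpc n * (if n == m then (if n == 0 then 2 * pi else pi) else 0).
    rewrite -icoscos -IntZ.
      by apply: Int_eq => s _; rewrite mulrA.
    by apply: contM; exact: der_cont (der_cosn _).
  move=> /(sums_single (m := m)) -> ; last first.
    by move=> n /negbTE nm; rewrite E nm mulr0.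
  rewrite E eqxx /humpc; have := @pi_gt0 R; case: (m == 0) => p0; field; lra.
have : D t = 0.
  have ct : -1 <= cos t <= 1 by rewrite cos_geN1 cos_le1.
  rewrite (cosE t (acos (cos t))); last by rewrite acosK// in_itv.
  by apply: (cosint_zero cD HD); rewrite acos_ge0// acos_lepi.
by rewrite /D => /eqP; rewrite subr_eq0 => /eqP.
Qed.

(* The Fourier cosine coefficients of (a multiple of) the convolution of [hump] with
   itself: they are nonnegative because they are squares. *)
Definition cU (n : nat) : R := (if n == 0 then 1 else 2) * coscoef (@hump R) n ^+ 2.

Definition Uh := cser cU.
Definition Uh' := cser' cU.

Lemma rap_cU : rap cU.
Proof.
have [C HC] := rap_bound (rap_coscoef (@cls_hump R)).
apply: (rap_le (M := 2 * C) (rap_coscoef (@cls_hump R))) => n.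
have h : `|coscoef (@hump R) n| <= C.
  apply: le_trans (HC n) _; rewrite ler_piMr ?(qs_ge0 HC)//.
  by rewrite invf_le1 ?ltr0n// (ler_nat _ 1).
rewrite /cU normrM normrX expr2 mulrA ler_wpM2r//.
apply: ler_pM => //; by case: eqP => _; rewrite ger0_norm// ler1n.
Qed.

(** Expand [hump] (t - s) by inversion, split cos (n (t - s)) by the addition formula and integrate
    termwise. With G = [hump] this represents [Uh], with G = [hump'] its derivative. *)
Lemma conv_humpc (G : R -> R) (t : R) : continuous G ->
  sums (fun n => humpc n * (cos (n%:R * t) * coscoef G n + sin (n%:R * t) * sincoef G n))
       (2 * pi * Int (- pi) pi (fun s => G s * hump (t - s))).
Proof.
move=> cG; have rX := rap_humpc; have [C HC] := rap_bound rX.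
have cS : continuous (cser humpc) by apply: der_cont (der_cser rX).
have cts (f : R -> R) : continuous f -> continuous (fun s => f (t - s)).
  by move=> cf; apply: contcomp cf _; apply: contB; [exact: cont_cst|exact: cont_id].
have ccos n := der_cont (@der_cosn R n%:R).
have csin n := der_cont (@der_sinn R n%:R).
have [M HM] : exists M, forall x, - pi <= x <= pi -> `|G x| <= M.
  have /compact_bounded[M [_ HM]] : compact (G @` `[- pi, pi]).
    apply: continuous_compact; last exact: segment_compact.
    exact: continuous_subspaceT.
  exists (M + 1) => x xp; apply: HM; first by rewrite ltrDl.
  by exists x => //=; rewrite in_itv.
have -> : 2 * pi * Int (- pi) pi (fun s => G s * hump (t - s)) =
    Int (- pi) pi (fun s => G s * cser humpc (t - s)).
  rewrite -IntZ; last by apply: contM => //; apply: cts; exact: cls_cont (@cls_hump R).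
  by apply: Int_eq => s _; rewrite humpc_inv; have := @pi_gt0 R; move=> p0; field; lra.
have E n : humpc n * (cos (n%:R * t) * coscoef G n + sin (n%:R * t) * sincoef G n) =
    Int (- pi) pi (fun s => G s * (humpc n * cos (n%:R * (t - s)))).
  rewrite /coscoef /sincoef -!IntZ; try exact: contM.
  rewrite -IntD; try by apply: contZ; exact: contM.
  rewrite -IntZ; last by apply: contD; apply: contZ; exact: contM.
  by apply: Int_eq => s _; rewrite mulrBr cosB; ring.
under eq_fun do rewrite E.
apply: (@Int_sums R (M * C)) => //; first exact: pile.
- move=> n; apply: contM => //; apply: contZ.
  exact: (cts (fun s => cos (n%:R * s))).
- by apply: contM => //; exact: cts.
- by move=> s; apply: sums_Z; exact: cser_sums.
- move=> n s sp; rewrite normrM -[X in _ <= X]mulrA; apply: ler_pM; rewrite ?HM//.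
  exact: (qs_M HC (fun n => cos_max (n%:R * (t - s)))).
Qed.

Lemma Uh_conv (t : R) : Uh t = 2 * pi * Int (- pi) pi (fun s => hump s * hump (t - s)).
Proof.
have := conv_humpc t (cls_cont (@cls_hump R)).
have := cser_sums t rap_cU; rewrite -/(Uh t).
have E n : cU n * cos (n%:R * t) =
   humpc n * (cos (n%:R * t) * coscoef (@hump R) n + sin (n%:R * t) * sincoef (@hump R) n).
  by rewrite sincoef_hump mulr0 addr0 /cU /humpc; ring.
by under eq_fun do rewrite E; exact: sums_uniq.
Qed.

Definition hump' (s : R) : R := - (2 * xi 3 (cos s)) * sin s.

Lemma der_hump' : der (@hump R) hump'.
Proof.
apply: der_ext (der_comp (@der_xi R 0) (@der_cos R)) _ _ => // s.
by rewrite /hump'; ring.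
Qed.

Lemma cont_hump' : continuous hump'.
Proof.
apply: contM; last exact: continuous_sin.
have h : continuous (fun s : R => xi 3 (cos s)).
  exact: der_cont (der_comp (@der_xi R 3) (@der_cos R)).
move=> s; apply: cvgN; exact: (contZ (k := 2) h).
Qed.

Lemma Uh'_conv (t : R) : Uh' t = 2 * pi * Int (- pi) pi (fun s => hump' s * hump (t - s)).
Proof.
have := conv_humpc t cont_hump'.
have := cser'_sums t rap_cU; rewrite -/(Uh' t).
have E n : - (n%:R * cU n * sin (n%:R * t)) =
   humpc n * (cos (n%:R * t) * coscoef hump' n + sin (n%:R * t) * sincoef hump' n).
  have h1 := coscoef_IBP n der_hump' cont_hump'.
  have h2 := sincoef_IBP n der_hump' cont_hump' (cls_per (@cls_hump R)).
  rewrite -h2 sincoef_hump -[sincoef hump' n]opprK -h1 /cU /humpc; ring.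
by under eq_fun do rewrite E; exact: sums_uniq.
Qed.

Lemma Uh_der : der Uh Uh'. Proof. exact: der_cser rap_cU. Qed.

(** Folding s onto - s, the convolution of [hump'] with [hump] becomes minus the integral over
    [0, pi] of - [hump'] (s) times [hump] (t - s) - [hump] (t + s). Both factors are nonnegative,
    since [hump] increases with the cosine and cos (t - s) >= cos (t + s). *)
Lemma Uh'_le0 (t : R) : 0 <= t <= pi -> Uh' t <= 0.
Proof.
move=> tp; rewrite Uh'_conv; have p0 := @pi_gt0 R.
rewrite pmulr_rle0; last by rewrite mulr_gt0.
have humpc := cls_cont (@cls_hump R).
have cXm : continuous (fun s => @hump R (t - s)).
  by apply: contcomp => //; apply: contB; [exact: cont_cst|exact: cont_id].
have cXp : continuous (fun s => @hump R (t + s)).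
  by apply: contcomp => //; apply: contD; [exact: cont_cst|exact: cont_id].
have cF : continuous (fun s => hump' s * hump (t - s)) by apply: contM => //; exact: cont_hump'.
rewrite (@Int_split _ _ 0)//; [|lra..].
rewrite Int_oppr0//; last lra.
have cF2 : continuous (fun s => -1 * (hump' s * hump (t + s))).
  by apply: contZ; apply: contM => //; exact: cont_hump'.
rewrite (@Int_eq _ _ _ _ (fun s => -1 * (hump' s * hump (t + s)))); last first.
  by move=> s _; rewrite /hump' cosN sinN opprK; ring.
rewrite -IntD// -oppr_ge0 -[X in 0 <= X]mulN1r -IntZ; last exact: contD.
apply: Int_ge0 => s sp; rewrite /hump'.
have s0 := sin_ge0_pi sp.
have h : hump (t + s) <= hump (t - s).
  apply: xi0_le; rewrite cosD cosB.
  by have := mulr_ge0 (sin_ge0_pi tp) s0; lra.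
have x3 : 0 <= xi 3 (cos s).
  by rewrite /xi; case: ifP => // c0; rewrite mulr_ge0 ?exprn_ge0 ?invr_ge0 ?expR_ge0// ltW.
have := mulr_ge0 (mulr_ge0 x3 s0) (_ : 0 <= hump (t - s) - hump (t + s)).
rewrite subr_ge0 => /(_ h); lra.
Qed.

Lemma cU_ge0 n : 0 <= cU n.
Proof. by rewrite /cU mulr_ge0 ?sqr_ge0//; case: eqP. Qed.

Lemma Uh_ge0 (t : R) : 0 <= Uh t.
Proof.
rewrite Uh_conv mulr_ge0 ?mulr_ge0 ?pi_ge0//.
by apply: Int_ge0 => s _; rewrite mulr_ge0 ?hump_ge0.
Qed.

(** At s = t / 2 both factors of the convolution have the argument t / 2, whose cosine is
    positive. *)
Lemma Uh_gt0 (t : R) : - pi < t < pi -> 0 < Uh t.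
Proof.
move=> /andP[tl tr]; rewrite Uh_conv; have p0 := @pi_gt0 R; rewrite pmulr_rgt0 ?mulr_gt0//.
have cF : continuous (fun s => @hump R s * hump (t - s)).
  apply: contM; first exact: cls_cont (@cls_hump R).
  apply: contcomp; first exact: (cls_cont (@cls_hump R)).
  by apply: contB; [exact: cont_cst|exact: cont_id].
apply: (@Int_gt0 _ _ _ _ (t / 2)) => //; last 1 first.
- have -> : t - t / 2 = t / 2 by field.
  have c0 : 0 < cos (t / 2) by apply: cos_gt0_pihalf; apply/andP; split; lra.
  by rewrite /hump /xi c0 !mul1r mulr_gt0 ?expR_gt0.
- by move=> s _; rewrite mulr_ge0 ?hump_ge0.
- by apply/andP; split; lra.
Qed.

(** The coefficients are nonnegative and every cosine is largest at 0. *)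
Lemma Uh_le (t : R) : Uh t <= Uh 0.
Proof.
rewrite -subr_ge0.
have := sums_B (cser_sums 0 rap_cU) (cser_sums t rap_cU).
apply: sums_ge0 => n; rewrite -mulrBr mulr_ge0 ?cU_ge0//.
by rewrite mulr0 cos0 subr_ge0 cos_le1.
Qed.

Lemma Uh_even (t : R) : Uh (- t) = Uh t.
Proof.
by congr Ssum; apply/funext => n; rewrite mulrN cosN.
Qed.

(** Let c = cos s and d = cos (t - s) be positive. Then 1 / c^2 + 1 / d^2 >= 2 / (c d), and c d <=
    (1 + cos t) / 2 because cos (2 s - t) <= 1; this gives the exponent 4 / (1 + cos t). The factor
    4 pi^2 is 2 pi times the length of [- pi, pi]. *)
Lemma Uh_flat (t : R) : Uh t <=
  4 * pi ^+ 2 * (if 0 < 1 + cos t then expR (- (4 / (1 + cos t))) else 0).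
Proof.
set E := (X in _ <= _ * X).
have cF : continuous (fun s => @hump R s * hump (t - s)).
  apply: contM; first exact: cls_cont (@cls_hump R).
  apply: contcomp; first exact: (cls_cont (@cls_hump R)).
  by apply: contB; [exact: cont_cst|exact: cont_id].
rewrite Uh_conv (_ : 4 * pi ^+ 2 * E = 2 * pi * (E * (pi - - pi))); last by ring.
rewrite ler_wpM2l ?mulr_ge0 ?pi_ge0//.
rewrite -Int_cst ?pile//; apply: Int_le => //; first exact: cont_cst.
move=> s _; rewrite /hump.
have E0 : 0 <= E by rewrite /E; case: ifP => // _; exact: expR_ge0.
have [c0|c0] := leP (cos s) 0; first by rewrite {1}/xi ltNge c0 mul0r.
have [d0|d0] := leP (cos (t - s)) 0; first by rewrite {2}/xi ltNge d0 mulr0.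
rewrite /xi c0 d0 !mul1r -expRD /E.
have cd : cos s * cos (t - s) <= (1 + cos t) / 2.
  have -> : cos t = cos s * cos (t - s) - sin s * sin (t - s).
    by rewrite -cosD addrC subrK.
  have : cos (s - (t - s)) <= 1 by exact: cos_le1.
  by rewrite cosB; lra.
have cd0 : 0 < cos s * cos (t - s) by exact: mulr_gt0.
have x0 : 0 < 1 + cos t by lra.
rewrite x0 ler_expR -opprD lerN2.
apply: le_trans (_ : 2 * (cos s)^-1 * (cos (t - s))^-1 <= _); last first.
  by have := sqr_ge0 ((cos s)^-1 - (cos (t - s))^-1); rewrite sqrrB -mulr_natl; lra.
rewrite -mulrA -invfM.
have -> : 4 / (1 + cos t) = 2 * ((1 + cos t) / 2)^-1 by field; lra.
by rewrite ler_wpM2l// lef_pV2// posrE; lra.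
Qed.

(** Glaeser's inequality: the quadratic Taylor majorant of a nonnegative function is nonnegative at
    its minimum h = - f' / (2 B), so f'^2 <= 4 B f. The derivative is therefore flat at pi with half
    the exponent of Uh. *)
Lemma Uh'_flat : exists2 B, 0 < B & forall t : R, `|Uh' t| ^+ 2 <= B * Uh t.
Proof.
have [B HB] := cser_quad rap_cU.
have B1 : 0 < `|B| + 1 by rewrite ltr_wpDl.
exists (4 * (`|B| + 1)); first by rewrite mulr_gt0.
move=> t; have := HB t (- Uh' t / (2 * (`|B| + 1))).
rewrite -/Uh -/Uh' ler_norml => /andP[_].
have := Uh_ge0 (t + - Uh' t / (2 * (`|B| + 1))).
move: (Uh (t + _)) => w w0.
have Bl : B <= `|B| + 1 by have := ler_norm B; lra.
move: (`|B| + 1) B1 Bl => b b0 Bb H.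
rewrite -normrX ger0_norm ?sqr_ge0//.
have : B * (- Uh' t / (2 * b)) ^+ 2 <= b * (- Uh' t / (2 * b)) ^+ 2.
  by rewrite ler_wpM2r// sqr_ge0.
have -> : b * (- Uh' t / (2 * b)) ^+ 2 = Uh' t ^+ 2 / (4 * b) by field; lra.
have e2 : - Uh' t / (2 * b) * Uh' t = - (2 * (Uh' t ^+ 2 / (4 * b))) by field; lra.
rewrite e2 in H => h.
have : Uh' t ^+ 2 / (4 * b) <= Uh t by lra.
by rewrite ler_pdivrMr ?mulr_gt0// mulrC.
Qed.

End FourierInversion.

Import ComplexField.Normc.

(** * Complex C^1 functions on the circle *)

Section ComplexC1.
Context (R : realType).
Implicit Types (F G : R -> R[i]) (K L e t : R).

Definition cder F F' := der (fun t => complex.Re (F t)) (fun t => complex.Re (F' t)) /\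
  der (fun t => complex.Im (F t)) (fun t => complex.Im (F' t)).

Lemma ReM (x y : R[i]) :
  complex.Re (x * y) = complex.Re x * complex.Re y - complex.Im x * complex.Im y.
Proof. by case: x; case: y. Qed.

Lemma ImM (x y : R[i]) :
  complex.Im (x * y) = complex.Re x * complex.Im y + complex.Im x * complex.Re y.
Proof. by case: x => a b; case: y => c d /=; rewrite addrC [b * c]mulrC [in RHS]addrC mulrC addrC. Qed.

Lemma ReD (x y : R[i]) : complex.Re (x + y) = complex.Re x + complex.Re y.
Proof. by case: x; case: y. Qed.

Lemma ImD (x y : R[i]) : complex.Im (x + y) = complex.Im x + complex.Im y.
Proof. by case: x; case: y. Qed.

Lemma cext (x y : R[i]) :
  complex.Re x = complex.Re y -> complex.Im x = complex.Im y -> x = y.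
Proof. by case: x => a b; case: y => c d /= -> ->. Qed.

Lemma rcM (x y : R) : ((x * y)%:C = x%:C * y%:C)%C.
Proof. by apply: cext; rewrite ?ReM ?ImM /=; ring. Qed.

Lemma rcD (x y : R) : ((x + y)%:C = x%:C + y%:C)%C.
Proof. by apply: cext; rewrite ?ReD ?ImD /=; ring. Qed.

Lemma rcN (x : R) : ((- x)%:C = - x%:C)%C.
Proof. by apply: cext => /=; rewrite ?oppr0. Qed.

Lemma rcB (x y : R) : ((x - y)%:C = x%:C - y%:C)%C.
Proof. by rewrite rcD rcN. Qed.

Lemma rcX (x : R) n : ((x ^+ n)%:C = x%:C ^+ n)%C.
Proof. by elim: n => [//|n IH]; rewrite !exprS rcM IH. Qed.

Lemma normcR (x : R) : normc (x%:C)%C = `|x|.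
Proof. by rewrite /normc /= expr0n /= addr0 sqrtr_sqr. Qed.

Lemma normcD (x y : R[i]) : normc (x + y) <= normc x + normc y.
Proof. exact: (@le_normcD R x y). Qed.

Lemma normc_ge0 (x : R[i]) : 0 <= normc x.
Proof. by case: x => a b; exact: sqrtr_ge0. Qed.

Lemma normc2 (x : R[i]) : normc x ^+ 2 = complex.Re x ^+ 2 + complex.Im x ^+ 2.
Proof. by case: x => a b /=; rewrite sqr_sqrtr// addr_ge0 ?sqr_ge0. Qed.

Lemma normcX (x : R[i]) n : normc (x ^+ n) = normc x ^+ n.
Proof. by elim: n => [|n IH]; rewrite ?expr0 ?normc1// !exprS normcM IH. Qed.

Lemma cder_ext F F' G G' : cder F F' -> F =1 G -> F' =1 G' -> cder G G'.
Proof. by move=> h /funext <- /funext <-. Qed.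

Lemma cder_D F F' G G' : cder F F' -> cder G G' ->
  cder (fun t => F t + G t) (fun t => F' t + G' t).
Proof.
move=> [f1 f2] [g1 g2]; split.
- by apply: der_ext (der_D f1 g1) _ _ => t; rewrite ReD.
- by apply: der_ext (der_D f2 g2) _ _ => t; rewrite ImD.
Qed.

Lemma cder_M F F' G G' : cder F F' -> cder G G' ->
  cder (fun t => F t * G t) (fun t => F' t * G t + F t * G' t).
Proof.
move=> [f1 f2] [g1 g2]; split.
- apply: der_ext (der_B (der_M f1 g1) (der_M f2 g2)) _ _ => t; rewrite ?ReD !ReM//; ring.
- apply: der_ext (der_D (der_M f1 g2) (der_M f2 g1)) _ _ => t; rewrite ?ImD !ImM//; ring.
Qed.

Lemma cder_cst (k : R[i]) : cder (fun=> k) (fun=> 0).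
Proof. by split; exact: der_cst. Qed.

Lemma cder_Z (k : R[i]) F F' : cder F F' -> cder (fun t => k * F t) (fun t => k * F' t).
Proof.
by move=> h; apply: cder_ext (cder_M (cder_cst k) h) _ _ => // t; rewrite mul0r add0r.
Qed.

Lemma cder_real (f f' : R -> R) : der f f' ->
  cder (fun t => (f t)%:C%C) (fun t => (f' t)%:C%C).
Proof. by move=> df; split => //=; exact: der_cst. Qed.

Lemma der_inv (f f' : R -> R) : der f f' -> (forall t, f t != 0) ->
  der (fun t => (f t)^-1) (fun t => - f' t / f t ^+ 2).
Proof.
move=> df f0 t; have := @is_deriveV _ f t _ _ (f0 t) (df t).
by move/is_derive_eq; apply; rewrite /GRing.scale /= mulrC mulNr mulrN.
Qed.

Lemma cder_inv F F' : cder F F' -> (forall t, F t != 0) ->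
  cder (fun t => (F t)^-1) (fun t => - F' t * (F t)^-1 ^+ 2).
Proof.
move=> [f1 f2] F0.
have n0 t : complex.Re (F t) ^+ 2 + complex.Im (F t) ^+ 2 != 0.
  apply: contra_neq (F0 t); rewrite -normc2 => /eqP; rewrite sqrf_eq0 => /eqP.
  exact: eq0_normc.
have dn := der_inv (der_D (der_X 2 f1) (der_X 2 f2)) n0.
have e1 t : complex.Re (F t)^-1 =
    complex.Re (F t) * (complex.Re (F t) ^+ 2 + complex.Im (F t) ^+ 2)^-1.
  by case: (F t).
have e2 t : complex.Im (F t)^-1 =
    -1 * (complex.Im (F t) * (complex.Re (F t) ^+ 2 + complex.Im (F t) ^+ 2)^-1).
  by case: (F t) => a b /=; rewrite mulN1r.
have ReN (x : R[i]) : complex.Re (- x) = - complex.Re x by case: x.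
have ImN (x : R[i]) : complex.Im (- x) = - complex.Im x by case: x.
split.
- apply: der_ext (der_M f1 dn) _ _ => t; first by rewrite e1.
  have := n0 t; rewrite expr2 !ReM ImM !ReN !ImN e1 e2 => h; field.
  exact: h.
- apply: der_ext (der_Z (-1) (der_M f2 dn)) _ _ => t; first by rewrite e2.
  have := n0 t; rewrite expr2 !ImM ReM !ReN !ImN e1 e2 => h; field.
  exact: h.
Qed.

Lemma cder_X F F' n : cder F F' ->
  cder (fun t => F t ^+ n) (fun t => n%:R * F t ^+ n.-1 * F' t).
Proof.
move=> h; elim: n => [|n IH].
  apply: cder_ext (cder_cst 1) _ _ => t; rewrite ?expr0 ?mul0r//.
apply: cder_ext (cder_M h IH) _ _ => t; rewrite ?exprS// -natr1.
by case: n {IH} => [|n] /=; rewrite ?exprS; ring.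
Qed.

Definition per F := F (- pi) = F pi.

(** The C^1 norm on the circle is at most K. Periodicity is recorded as equality at the two ends of
    [- pi, pi], the form in which integration by parts consumes it. *)
Definition C1b K F := exists F', [/\ cder F F', per F,
  forall t, normc (F t) <= K & forall t, normc (F' t) <= K].

Lemma C1b_le K L F : K <= L -> C1b K F -> C1b L F.
Proof.
move=> KL [F' [h1 h2 h3 h4]]; exists F'; split=> // t; exact: le_trans KL.
Qed.

Lemma C1b_ge0 K F : C1b K F -> 0 <= K.
Proof. by move=> [F' [_ _ h _]]; exact: le_trans (normc_ge0 _) (h 0). Qed.

Lemma C1b_ext K F G : C1b K F -> F =1 G -> C1b K G.
Proof. by move=> h /funext <-. Qed.

Lemma C1b_D K L F G : C1b K F -> C1b L G -> C1b (K + L) (fun t => F t + G t).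
Proof.
move=> [F' [f1 f2 f3 f4]] [G' [g1 g2 g3 g4]]; exists (fun t => F' t + G' t); split.
- exact: cder_D.
- by rewrite /per f2 g2.
- by move=> t; apply: le_trans (normcD _ _) _; exact: lerD.
- by move=> t; apply: le_trans (normcD _ _) _; exact: lerD.
Qed.

Lemma C1b_M K L F G : C1b K F -> C1b L G -> C1b (2 * K * L) (fun t => F t * G t).
Proof.
move=> [F' [f1 f2 f3 f4]] [G' [g1 g2 g3 g4]].
have K0 : 0 <= K := le_trans (normc_ge0 _) (f3 0).
have L0 : 0 <= L := le_trans (normc_ge0 _) (g3 0).
have KL0 := mulr_ge0 K0 L0.
exists (fun t => F' t * G t + F t * G' t); split.
- exact: cder_M.
- by rewrite /per f2 g2.
- move=> t; rewrite normcM; apply: le_trans (_ : K * L <= _).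
    by apply: ler_pM; rewrite ?normc_ge0.
  by rewrite -mulrA; lra.
- move=> t; apply: le_trans (normcD _ _) _; rewrite !normcM -mulrA mulr_natl mulr2n.
  by apply: lerD; apply: ler_pM; rewrite ?normc_ge0.
Qed.

Lemma C1b_Z K F (k : R[i]) : C1b K F -> C1b (normc k * K) (fun t => k * F t).
Proof.
move=> [F' [f1 f2 f3 f4]]; exists (fun t => k * F' t); split.
- exact: cder_Z.
- by rewrite /per f2.
- by move=> t; rewrite normcM ler_wpM2l// normc_ge0.
- by move=> t; rewrite normcM ler_wpM2l// normc_ge0.
Qed.

Definition z (t : R) : R[i] := (cos t +i* sin t)%C.
Definition zb (t : R) : R[i] := (cos t -i* sin t)%C.

Lemma z_zb t : z t * zb t = 1.
Proof.
apply: cext; rewrite ?ReM ?ImM /=; last by ring.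
by rewrite mulrN opprK -!expr2 cos2Dsin2.
Qed.

Lemma normc_z t : normc (z t) = 1.
Proof. by rewrite /z /normc cos2Dsin2 sqrtr1. Qed.

Lemma normc_zb t : normc (zb t) = 1.
Proof. by rewrite /zb /normc /= sqrrN cos2Dsin2 sqrtr1. Qed.

Lemma cder_z : cder z (fun t => 'i%C * z t).
Proof.
split.
- by apply: der_ext (@der_cos R) _ _ => // t; rewrite ReM /=; ring.
- by apply: der_ext (@der_sin R) _ _ => // t; rewrite ImM /=; ring.
Qed.

Lemma cder_zb : cder zb (fun t => - 'i%C * zb t).
Proof.
split.
- by apply: der_ext (@der_cos R) _ _ => // t; rewrite ReM /=; ring.
- by apply: der_ext (der_Z (-1) (@der_sin R)) _ _ => t; rewrite ?ImM /=; ring.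
Qed.

Lemma normci : normc ('i%C : R[i]) = 1.
Proof. by rewrite /normc /= expr0n /= add0r expr1n sqrtr1. Qed.

Lemma per_z : per z.
Proof. by rewrite /per /z cosN sinN sinpi oppr0. Qed.

Lemma per_zb : per zb.
Proof. by rewrite /per /zb cosN sinN sinpi !oppr0. Qed.

Lemma C1b_z : C1b 1 z.
Proof.
exists (fun t => 'i%C * z t); split; first exact: cder_z.
- exact: per_z.
- by move=> t; rewrite normc_z.
- by move=> t; rewrite normcM normc_z normci mulr1.
Qed.

Lemma C1b_zb : C1b 1 zb.
Proof.
exists (fun t => - 'i%C * zb t); split; first exact: cder_zb.
- exact: per_zb.
- by move=> t; rewrite normc_zb.
- by move=> t; rewrite normcM normc_zb normcN normci mulr1.
Qed.

Lemma C1b_zX n : C1b (n%:R + 1) (fun t => z t ^+ n).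
Proof.
exists (fun t => n%:R * z t ^+ n.-1 * ('i%C * z t)); split.
- exact: cder_X cder_z.
- by rewrite /per per_z.
- by move=> t; rewrite normcX normc_z expr1n lerDr.
- move=> t; rewrite !normcM normcX normc_z expr1n normci !mulr1.
  have -> : n%:R = (n%:R : R)%:C%C :> R[i] by rewrite rmorph_nat.
  by rewrite normcR ger0_norm// lerDl.
Qed.

End ComplexC1.

(** * The one-sided C^1 closure and division by 1 + r z *)

Section Closure.
Context (R : realType).
Implicit Types (F G : R -> R[i]) (K L e t : R).

(** The coefficients are real because they become those of a combination of real translates of g. *)
Definition comb (N : nat) (d : nat -> R) t : R[i] :=
  \sum_(k < N) (d k)%:C%C * (z t ^+ k * (Uh t)%:C%C).

(* The C^1 closure of the one-sided combinations of the z^k Uh, k >= 0. *)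
Definition Cl F := forall e, 0 < e -> exists N d, C1b e (fun t => F t - comb N d t).

Lemma Cl_ext F G : Cl F -> F =1 G -> Cl G.
Proof. by move=> h /funext <-. Qed.

Lemma C1b_0 : C1b 0 (fun _ : R => 0 : R[i]).
Proof.
by exists (fun=> 0); split => //; [exact: cder_cst|move=> t; rewrite normc0..].
Qed.

Lemma combE N M (d : nat -> R) t : (N <= M)%N ->
  comb N d t = comb M (fun k => if (k < N)%N then d k else 0) t.
Proof.
move=> NM; rewrite /comb (big_ord_widen M (fun k => (d k)%:C%C * (z t ^+ k * (Uh t)%:C%C)) NM).
rewrite big_mkcond; apply: eq_bigr => i _.
by case: ifP => // _; rewrite mul0r.
Qed.

Lemma combD N M (d d' : nat -> R) : exists2 d'' : nat -> R, True &
  forall t, comb N d t + comb M d' t = comb (maxn N M) d'' t.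
Proof.
exists (fun k => (if (k < N)%N then d k else 0) + (if (k < M)%N then d' k else 0)) => // t.
rewrite (combE _ _ (leq_maxl N M)) (combE _ _ (leq_maxr N M)) /comb -big_split /=.
by apply: eq_bigr => i _; rewrite -mulrDl rcD.
Qed.

Lemma Cl_D F G : Cl F -> Cl G -> Cl (fun t => F t + G t).
Proof.
move=> hF hG e e0; have e2 : 0 < e / 2 by rewrite divr_gt0.
have [N [d h]] := hF _ e2; have [M [d' h']] := hG _ e2.
have [d'' _ E] := combD N M d d'.
exists (maxn N M), d''; rewrite [e]splitr.
by apply: C1b_ext (C1b_D h h') _ => t; rewrite -E; ring.
Qed.

Lemma Cl_Z F (k : R) : Cl F -> Cl (fun t => k%:C%C * F t).
Proof.
move=> hF e e0; have k1 : 0 < `|k| + 1 by rewrite ltr_wpDl.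
have [N [d h]] := hF (e / (`|k| + 1)) (divr_gt0 e0 k1).
exists N, (fun n => k * d n).
have := C1b_Z (k%:C)%C h; rewrite normcR => h1.
apply: C1b_ext (C1b_le _ h1) _ => [|t].
  rewrite mulrA ler_pdivrMr// mulrC; apply: ler_wpM2l; [exact: ltW|by rewrite lerDl].
rewrite mulrBr /comb mulr_sumr; congr (_ - _); apply: eq_bigr => i _.
by rewrite rcM -[RHS]mulrA.
Qed.

Lemma Cl_z F : Cl F -> Cl (fun t => z t * F t).
Proof.
move=> hF e e0; have e2 : 0 < e / 2 by rewrite divr_gt0.
have [N [d h]] := hF _ e2.
exists N.+1, (fun n => if n is n'.+1 then d n' else 0).
have := C1b_M (@C1b_z R) h; rewrite mulr1 mulrCA divff ?mulr1// => h1.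
apply: C1b_ext h1 _ => t; rewrite mulrBr /comb big_ord_recl /= mul0r add0r.
rewrite mulr_sumr; congr (_ - _); apply: eq_bigr => i _.
by rewrite /bump /= add1n exprS; ring.
Qed.

Lemma Cl_lim F : (forall e, 0 < e -> exists2 G, Cl G & C1b e (fun t => F t - G t)) ->
  Cl F.
Proof.
move=> H e e0; have e2 : 0 < e / 2 by rewrite divr_gt0.
have [G cG h] := H _ e2; have [N [d h']] := cG _ e2.
exists N, d; rewrite [e]splitr; apply: C1b_ext (C1b_D h h') _ => t; ring.
Qed.

Lemma Cl_0 : Cl (fun=> 0).
Proof.
move=> e e0; exists 0%N, (fun=> 0); apply: C1b_ext (C1b_le (ltW e0) C1b_0) _ => t.
by rewrite /comb big_ord0 subr0.
Qed.

Lemma Cl_sum N (F : nat -> R -> R[i]) : (forall n, Cl (F n)) ->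
  Cl (fun t => \sum_(n < N) F n t).
Proof.
move=> h; elim: N => [|N IH].
  by apply: Cl_ext Cl_0 _ => t; rewrite big_ord0.
by apply: Cl_ext (Cl_D IH (h N)) _ => t; rewrite big_ord_recr.
Qed.

Lemma Cl_Uh : Cl (fun t => (Uh t)%:C%C).
Proof.
move=> e e0; exists 1%N, (fun=> 1); apply: C1b_ext (C1b_le (ltW e0) C1b_0) _ => t.
by rewrite /comb big_ord1 expr0 !mul1r subrr.
Qed.

(** Each of the n + 1 terms q^i, i <= n, is at least q^n, and the geometric sum is at most 1 / (1 -
    q). *)
Lemma nrn_bound (q : R) n : 0 <= q < 1 -> n.+1%:R * q ^+ n <= (1 - q)^-1.
Proof.
move=> /andP[q0 q1]; have q1' : 0 < 1 - q by rewrite subr_gt0.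
apply: le_trans (_ : \sum_(i < n.+1) q ^+ i <= _).
  rewrite mulr_natl -[X in _ *+ X]card_ord -sumr_const; apply: ler_sum => i _.
  by apply: ler_wiXn2l => //; [exact: ltW|rewrite -ltnS].
rewrite -div1r ler_pdivlMr// mulrC.
have -> : (1 - q) * (\sum_(i < n.+1) q ^+ i) = 1 - q ^+ n.+1.
  by rewrite -[RHS]opprB subrX1; ring.
by rewrite gerBl exprn_ge0.
Qed.

(** Write r^n as q^n q^n with q the square root of r: one factor absorbs n + 1, the other remains as
    a geometric rate. *)
Lemma geo_pow (r : R) n : 0 <= r < 1 ->
  n.+1%:R * r ^+ n <= (1 - Num.sqrt r)^-1 * Num.sqrt r ^+ n.
Proof.
move=> /andP[r0 r1]; set q := Num.sqrt r; have q0 : 0 <= q := sqrtr_ge0 _.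
have q1 : q < 1 by rewrite -sqrtr1 ltr_sqrt.
have -> : r ^+ n = q ^+ n * q ^+ n.
  by rewrite -{1}(sqr_sqrtr r0) -exprM mul2n -addnn exprD.
by rewrite mulrA ler_wpM2r ?exprn_ge0// nrn_bound ?q0.
Qed.

Lemma geo_pow_cvg (r : R) : 0 <= r < 1 ->
  (fun n => (1 - Num.sqrt r)^-1 * Num.sqrt r ^+ n) @ \oo --> (0 : R).
Proof.
move=> /andP[r0 r1]; rewrite -(mulr0 (1 - Num.sqrt r)^-1).
apply: cvgM; first exact: cvg_cst.
by apply: cvg_expr; rewrite ger0_norm ?sqrtr_ge0// -sqrtr1 ltr_sqrt.
Qed.

Lemma geo_small (r e : R) : 0 <= r < 1 -> 0 < e ->
  exists n : nat, r ^+ n * (n%:R + 1) < e.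
Proof.
move=> r01 e0; have /cvgrPdist_lt/(_ _ e0)[n _ /(_ n (leqnn n)) h] := geo_pow_cvg r01.
exists n; rewrite natr1 mulrC; apply: le_lt_trans (geo_pow n r01) _.
by rewrite /= sub0r normrN in h; apply: le_lt_trans (ler_norm _) h.
Qed.

Lemma one_rz_neq0 (r : R) t : 0 <= r < 1 -> 1 + r%:C%C * z t != 0.
Proof.
move=> /andP[r0 r1]; apply/negP => /eqP h.
have : normc (r%:C%C * z t) = 1.
  have -> : r%:C%C * z t = - 1 by apply/eqP; rewrite -subr_eq0 opprK addrC h.
  by rewrite normcN normc1.
by rewrite normcM normc_z normcR mulr1 ger0_norm// => r1'; rewrite r1' ltxx in r1.
Qed.

(** Multiplying (1 + r z) G by a partial sum of the geometric series of 1 / (1 + r z) leaves the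
    error (- r z)^n G, whose C^1 norm is of order (n + 1) r^n. *)
Lemma Cl_geo K (r : R) G : 0 <= r < 1 -> C1b K G ->
  Cl (fun t => (1 + r%:C%C * z t) * G t) -> Cl G.
Proof.
move=> r01 hG hF; apply: Cl_lim => e e0; have [r0 r1] := andP r01.
have K0 := C1b_ge0 hG.
have K2 : 0 < 2 * K + 1 by rewrite ltr_wpDl// mulr_ge0.
have [n hn] := geo_small r01 (divr_gt0 e0 K2).
have hz k : Cl (fun t => z t ^+ k * ((1 + r%:C%C * z t) * G t)).
  elim: k => [|k IH].
    by apply: Cl_ext hF _ => t; rewrite expr0 mul1r.
  by apply: Cl_ext (Cl_z IH) _ => t; rewrite exprS mulrA.
exists (fun t => \sum_(k < n) ((- r) ^+ k)%:C%C * (z t ^+ k * ((1 + r%:C%C * z t) * G t))).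
  by apply: (@Cl_sum n (fun k t => ((- r) ^+ k)%:C%C * (z t ^+ k * ((1 + r%:C%C * z t) * G t)))) => k; exact: Cl_Z.
have := C1b_Z (((- r) ^+ n)%:C)%C (C1b_M (@C1b_zX R n) hG).
rewrite normcR normrX normrN ger0_norm// => h.
apply: C1b_ext (C1b_le _ h) _ => [|t].
  move: hn; rewrite ltr_pdivlMr// => hn.
  apply: le_trans (ltW hn).
  have -> : r ^+ n * (2 * (n%:R + 1) * K) = r ^+ n * (n%:R + 1) * (2 * K) by ring.
  by rewrite ler_wpM2l ?mulr_ge0 ?exprn_ge0 ?addr_ge0// lerDl.
have -> : \sum_(k < n) ((- r) ^+ k)%:C%C * (z t ^+ k * ((1 + r%:C%C * z t) * G t)) =
  (1 - (- r%:C%C * z t) ^+ n) * G t.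
  have := subrX1 (- r%:C%C * z t) n.
  under eq_bigr => k _ do rewrite exprMn -rcN -rcX.
  move=> E.
  have E2 : 1 - (- r%:C%C * z t) ^+ n = (1 + r%:C%C * z t) *
     \sum_(i < n) ((- r) ^+ i)%:C%C * z t ^+ i.
    by rewrite -opprB E; ring.
  rewrite E2 mulrAC mulr_sumr; apply: eq_bigr => k _; ring.
by rewrite exprMn -rcN -rcX; ring.
Qed.

End Closure.

(** * Stability of the closure under z^-1 *)

Section BackwardShift.
Context (R : realType).
Implicit Types (F G : R -> R[i]) (K L e t : R).

(* As a function of z, [hh s r] is analytic in the unit disc with value 1 at z = 0. *)
Definition vr (r t : R) : R[i] := (1 + r%:C%C * z t)^-1.
Definition hh (s r t : R) : R[i] := (1 + s%:C%C * z t) * vr r t.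

Lemma vrK (r t : R) : 0 <= r < 1 -> (1 + r%:C%C * z t) * vr r t = 1.
Proof. by move=> r01; rewrite divff// one_rz_neq0. Qed.

Lemma normc_1z (r t : R) : normc (1 + r%:C%C * z t) ^+ 2 = 1 + 2 * r * cos t + r ^+ 2.
Proof.
rewrite normc2 ReD ImD ReM ImM /= !mul0r subr0 add0r addr0.
by rewrite [(r * sin t) ^+ 2]exprMn sin2cos2; ring.
Qed.

Lemma normc_1z_ge (r t : R) : 0 <= r < 1 -> 1 - r <= normc (1 + r%:C%C * z t).
Proof.
move=> /andP[r0 r1].
have : (1 - r) ^+ 2 <= normc (1 + r%:C%C * z t) ^+ 2.
  rewrite normc_1z; have := mulr_ge0 r0 (_ : 0 <= 1 + cos t).
  by have := cos_geN1 t => h; rewrite -lerBlDl sub0r => /(_ h); clear; lra.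
by rewrite ler_sqr ?nnegrE ?normc_ge0// subr_ge0 ltW.
Qed.

Lemma normc_vr (r t : R) : 0 <= r < 1 -> normc (vr r t) <= (1 - r)^-1.
Proof.
move=> r01; have [r0 r1] := andP r01.
rewrite normcV lef_pV2 ?posrE ?subr_gt0 ?normc_1z_ge//.
by apply: lt_le_trans (normc_1z_ge t r01); rewrite subr_gt0.
Qed.

Lemma cder_vr (r : R) : 0 <= r < 1 ->
  cder (vr r) (fun t => - (r%:C%C * ('i%C * z t)) * vr r t ^+ 2).
Proof.
move=> r01.
have h := cder_D (cder_cst 1) (cder_Z r%:C%C (@cder_z R)).
by apply: cder_ext (cder_inv h (fun t => one_rz_neq0 t r01)) _ _ => // t; rewrite add0r.
Qed.

Lemma per_vr (r : R) : per (vr r).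
Proof. by rewrite /per /vr per_z. Qed.

Lemma C1b_vr (r : R) : 0 <= r < 1 -> C1b ((1 - r)^-1 ^+ 2) (vr r).
Proof.
move=> r01; have [r0 r1] := andP r01.
have q1 : 1 <= (1 - r)^-1 by rewrite invf_ge1 ?subr_gt0//; clear -r0; lra.
exists (fun t => - (r%:C%C * ('i%C * z t)) * vr r t ^+ 2); split.
- exact: cder_vr.
- exact: per_vr.
- move=> t; apply: le_trans (normc_vr t r01) _.
  by rewrite expr2 ler_peMl// (le_trans _ q1).
- move=> t; rewrite normcM normcN normcX !normcM normc_z normci normcR !mulr1.
  rewrite ger0_norm// -[X in _ <= X]mul1r; apply: ler_pM => //.
  + by rewrite exprn_ge0 ?normc_ge0.
  + exact: ltW.
  + by apply: lerXn2r; rewrite ?nnegrE ?normc_ge0 ?normc_vr// invr_ge0 subr_ge0 ltW.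
Qed.

(** The closure together with some C^1 bound: [Cl_geo] asks for such a bound on the quotient. *)
Definition ClB F := Cl F /\ exists K, C1b K F.

Lemma ClB_z F : ClB F -> ClB (fun t => z t * F t).
Proof.
move=> [h [K hK]]; split; first exact: Cl_z.
by exists (2 * 1 * K); exact: C1b_M (@C1b_z R) hK.
Qed.

Lemma ClB_Z F (k : R) : ClB F -> ClB (fun t => k%:C%C * F t).
Proof.
move=> [h [K hK]]; split; first exact: Cl_Z.
by eexists; exact: C1b_Z hK.
Qed.

Lemma ClB_D F G : ClB F -> ClB G -> ClB (fun t => F t + G t).
Proof.
move=> [h [K hK]] [h' [K' hK']]; split; first exact: Cl_D.
by exists (K + K'); exact: C1b_D.
Qed.

Lemma ClB_vr (r : R) F : 0 <= r < 1 -> ClB F -> ClB (fun t => vr r t * F t).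
Proof.
move=> r01 [h [K hK]]; have hv := C1b_M (C1b_vr r01) hK.
split; last by eexists; exact: hv.
apply: (Cl_geo r01 hv); apply: Cl_ext h _ => t.
by rewrite mulrA vrK// mul1r.
Qed.

Lemma C1b_Uh : exists K, C1b K (fun t : R => (Uh t)%:C%C).
Proof.
have [B B0 HB] := Uh'_flat R.
exists (Uh 0 + (1 + B * Uh 0)), (fun t => (Uh' t)%:C%C).
have U0 := Uh_ge0 (0 : R); have B1 := mulr_ge0 (ltW B0) U0.
split.
- exact: cder_real (@Uh_der R).
- by rewrite /per Uh_even.
- move=> t; rewrite normcR ger0_norm ?Uh_ge0//.
  by apply: le_trans (Uh_le t) _; rewrite lerDl addr_ge0.
- move=> t; rewrite normcR.
  apply: le_trans (_ : 1 + B * Uh 0 <= _); last by rewrite lerDr.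
  have h : `|Uh' t| ^+ 2 <= B * Uh 0.
    by apply: le_trans (HB t) _; rewrite ler_wpM2l ?Uh_le// ltW.
  have := sqr_ge0 (`|Uh' t| - 1); move: (`|Uh' t|) h => w.
  by clear; rewrite sqrrB expr1n mulr1 -mulr_natl => h1 h2; nra.
Qed.

Lemma ClB_hh (s r : R) F : 0 <= r < 1 -> ClB F -> ClB (fun t => hh s r t * F t).
Proof.
move=> r01 h.
have := ClB_vr r01 (ClB_D h (ClB_Z s (ClB_z h))).
congr ClB; apply/funext => t; rewrite /hh; ring.
Qed.

Lemma ClB_hhX (s r : R) n : 0 <= r < 1 -> ClB (fun t => hh s r t ^+ n * (Uh t)%:C%C).
Proof.
move=> r01; elim: n => [|n IH].
  have h : ClB (fun t : R => (Uh t)%:C%C) by split; [exact: Cl_Uh|exact: C1b_Uh].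
  by move: h; congr ClB; apply/funext => t; rewrite expr0 mul1r.
by move: (ClB_hh s r01 IH); congr ClB; apply/funext => t; rewrite exprS mulrA.
Qed.

(** 1 - hh^n is (1 - hh) times the sum of the hh^i, and 1 - hh = (r - s) z / (1 + r z) carries the
    factor z that cancels z^-1. *)
Lemma Cl_zb_hh (s r : R) n : 0 <= r < 1 ->
  Cl (fun t => zb t * (1 - hh s r t ^+ n) * (Uh t)%:C%C).
Proof.
move=> r01.
have h j := (ClB_Z (r - s) (ClB_vr r01 (ClB_hhX s j r01))).1.
apply: Cl_ext (Cl_sum n h) _ => t /=.
have E : 1 - hh s r t = (r - s)%:C%C * z t * vr r t.
  by rewrite /hh -{1}(vrK t r01) rcB; ring.
have E2 : 1 - hh s r t ^+ n = (1 - hh s r t) * \sum_(i < n) hh s r t ^+ i.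
  by rewrite -opprB subrX1; ring.
rewrite E2 E !mulr_sumr mulr_suml; apply: eq_bigr => i _.
have -> : zb t * ((r - s)%:C%C * z t * vr r t * hh s r t ^+ i) * (Uh t)%:C%C =
  (z t * zb t) * ((r - s)%:C%C * (vr r t * (hh s r t ^+ i * (Uh t)%:C%C))) by ring.
by rewrite z_zb mul1r.
Qed.

(* The base is 1 - eta (2 (1 + c) - 3 eta) / D, with D the denominator; since n eta^2 is
   at most 1 / 4, its n-th power exceeds 1 by at most a factor exp (O (1 / (1 + c))),
   which the last factor absorbs. *)
Lemma hh_est (m n : nat) (c eta : R) : eta = (2 * m%:R)^-1 ->
  (0 < m)%N -> (n <= m ^ 2)%N -> (m ^ 2 <= n.+1)%N ->
  -1 < c <= 1 ->
  ((1 + 2 * (1 - 2 * eta) * c + (1 - 2 * eta) ^+ 2) /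
   (1 + 2 * (1 - eta) * c + (1 - eta) ^+ 2)) ^+ n * expR (- (4 / (1 + c))) <=
  expR (1 - m%:R / 6).
Proof.
move=> etaE m0 nm mn /andP[c1 c2].
have M0 : 0 < m%:R :> R by rewrite ltr0n.
have M1 : 1 <= m%:R :> R by rewrite ler1n.
have e0 : 0 < eta by rewrite etaE invr_gt0 mulr_gt0.
have em : eta * m%:R = 2^-1 by rewrite etaE invfM -mulrA mulVf ?mulr1 ?lt0r_neq0.
have e1 : eta <= 2^-1 by rewrite -em ler_peMr// ltW.
have -> : c = (1 + c) - 1 by ring.
have x0 : 0 < 1 + c by clear -c1; lra.
move: (1 + c) x0 => x x0; rewrite [1 + (x - 1)]addrC subrK.
have -> : 1 + 2 * (1 - eta) * (x - 1) + (1 - eta) ^+ 2 = eta ^+ 2 + 2 * (1 - eta) * x by ring.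
have -> : 1 + 2 * (1 - 2 * eta) * (x - 1) + (1 - 2 * eta) ^+ 2 =
  4 * eta ^+ 2 + 2 * (1 - 2 * eta) * x by ring.
have ex : 0 <= (2^-1 - eta) * x by rewrite mulr_ge0 ?subr_ge0// ltW.
have ee : eta ^+ 2 <= eta * 2^-1 by rewrite expr2 ler_wpM2l// ltW.
have e2 : 0 < eta ^+ 2 by rewrite exprn_gt0.
have D0 : 0 < eta ^+ 2 + 2 * (1 - eta) * x by clear -ex e2 x0; nra.
have num0 : 0 <= 4 * eta ^+ 2 + 2 * (1 - 2 * eta) * x by clear -ex e2; nra.
have q0 := divr_ge0 num0 (ltW D0).
have [xe|xe] := leP (3 * eta) x.
(* Away from z = -1: x >= 3 eta makes 2 x - 3 eta at least a third of the denominator, so the base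
   is at most 1 - eta / 3. As n >= m^2 - 1, the product n eta is at least m / 2 - eta. *)
- have h : (4 * eta ^+ 2 + 2 * (1 - 2 * eta) * x) / (eta ^+ 2 + 2 * (1 - eta) * x)
      <= expR (- (eta / 3)).
    apply: le_trans (expR_ge1Dx _); rewrite ler_pdivrMr//.
    have : 0 <= eta * (x - 3 * eta) by rewrite mulr_ge0 ?subr_ge0// ltW.
    have : 0 <= eta * (eta * x) by rewrite !mulr_ge0// ltW.
    have : 0 <= eta * (eta * 2^-1 - eta ^+ 2) by rewrite mulr_ge0 ?subr_ge0// ltW.
    clear -e2; rewrite expr2; nra.
  apply: le_trans (_ : expR (- (eta / 3)) ^+ n * 1 <= _).
    apply: ler_pM; rewrite ?exprn_ge0 ?expR_ge0//.
      by apply: lerXn2r; rewrite ?nnegrE ?expR_ge0.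
    by rewrite expR_le1 oppr_le0 divr_ge0// ltW.
  rewrite mulr1 -expRM_natl ler_expR.
  have : (m ^ 2)%N%:R <= n.+1%:R :> R by rewrite ler_nat.
  rewrite natrX -natr1 => mn'.
  have h1 : eta * m%:R ^+ 2 <= eta * (n%:R + 1) by rewrite ler_wpM2l// ltW.
  rewrite expr2 mulrA em in h1; clear -h1 e1; nra.
(* Near z = -1 the base may exceed 1, but its n-th power is at most exp (1 / x). The flat factor exp
   (- 4 / x) leaves exp (- 3 / x), and x < 3 eta gives 3 / x > 1 / eta = 2 m. *)
- have h : (4 * eta ^+ 2 + 2 * (1 - 2 * eta) * x) / (eta ^+ 2 + 2 * (1 - eta) * x)
      <= expR (3 * eta ^+ 2 / x).
    apply: le_trans (expR_ge1Dx _); rewrite ler_pdivrMr//.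
    have h1 : 3 * eta ^+ 2 <= 3 * eta ^+ 2 / x * (eta ^+ 2 + 2 * (1 - eta) * x).
      rewrite -[X in X <= _]mulr1 -[X in _ <= X]mulrA.
      apply: ler_wpM2l; first by rewrite mulr_ge0// ltW.
      rewrite mulrC ler_pdivlMr// mul1r; clear -ex e2; nra.
    have : 0 <= eta * x by rewrite mulr_ge0// ltW.
    clear -h1; nra.
  apply: le_trans (_ : expR (3 * eta ^+ 2 / x) ^+ n * expR (- (4 / x)) <= _).
    by rewrite ler_wpM2r ?expR_ge0//; apply: lerXn2r; rewrite ?nnegrE ?expR_ge0.
  rewrite -expRM_natl -expRD ler_expR.
  have hn : n%:R * eta ^+ 2 <= 4^-1.
    have : n%:R <= (m ^ 2)%N%:R :> R by rewrite ler_nat.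
    rewrite natrX => h2; apply: le_trans (_ : m%:R ^+ 2 * eta ^+ 2 <= _).
      by rewrite ler_wpM2r// ltW.
    by rewrite -exprMn [m%:R * _]mulrC em; clear; lra.
  have y0 : 0 < x^-1 by rewrite invr_gt0.
  have h3 : n%:R * (3 * eta ^+ 2 / x) <= 1 / x.
    by rewrite !mulrA ler_wpM2r ?ltW//; clear -hn; nra.
  have h4 : 2 * m%:R <= 3 / x.
    rewrite ler_pdivlMr//; apply: le_trans (_ : 2 * m%:R * (3 * eta) <= _).
      by rewrite ler_wpM2l ?ltW// mulr_gt0.
    by clear -em; nra.
  clear -h3 h4 M0; lra.
Qed.

(** The square root of the flat majorant in [Uh_flat]. Up to a constant, [Uh] is bounded by its
    square and, by [Uh'_flat], [Uh'] by its first power. *)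
Definition Ef t : R := if 0 < 1 + cos t then expR (- (2 / (1 + cos t))) else 0.

Lemma Ef_ge0 t : 0 <= Ef t.
Proof. by rewrite /Ef; case: ifP => // _; exact: expR_ge0. Qed.

Lemma Ef_le1 t : Ef t <= 1.
Proof.
rewrite /Ef; case: ifPn => [c0|_]; last exact: ler01.
by rewrite expR_le1 oppr_le0 divr_ge0// ltW.
Qed.

Lemma Uh_Ef : exists2 A, 0 < A & forall t,
  `|Uh t| <= A * Ef t ^+ 2 /\ `|Uh' t| <= A * Ef t.
Proof.
have [B B0 HB] := Uh'_flat R.
have p0 : 0 < 4 * pi ^+ 2 :> R by rewrite mulr_gt0// exprn_gt0// pi_gt0.
have flat t : Uh t <= 4 * pi ^+ 2 * Ef t ^+ 2.
  apply: le_trans (Uh_flat t) _; apply: ler_wpM2l; first exact: ltW.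
  rewrite /Ef; case: ifP => _; last by rewrite expr0n.
  by rewrite -expRM_natl ler_expR le_eqVlt; apply/orP; left; apply/eqP; ring.
exists (4 * pi ^+ 2 + B); first exact: addr_gt0.
move=> t; split.
  rewrite ger0_norm ?Uh_ge0//; apply: le_trans (flat t) _.
  by rewrite ler_wpM2r ?sqr_ge0// lerDl ltW.
have A0 : 0 <= (4 * pi ^+ 2 + B) * Ef t by rewrite mulr_ge0 ?Ef_ge0 ?addr_ge0// ltW.
rewrite -ler_sqr ?nnegrE//; apply: le_trans (HB t) _.
apply: le_trans (ler_wpM2l (ltW B0) (flat t)) _.
rewrite exprMn mulrA ler_wpM2r ?sqr_ge0//.
have := mulr_ge0 (ltW B0) (ltW p0); move: (4 * pi ^+ 2) => w h.
have := sqr_ge0 w; have := sqr_ge0 B; clear -h; rewrite sqrrD; lra.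
Qed.

Lemma hh_Ef (m n : nat) (eta : R) t : eta = (2 * m%:R)^-1 ->
  (0 < m)%N -> (n <= m ^ 2)%N -> (m ^ 2 <= n.+1)%N ->
  normc (hh (1 - 2 * eta) (1 - eta) t) ^+ n * Ef t <= expR ((1 - m%:R / 6) / 2).
Proof.
move=> etaE m0 nm mn; rewrite {1}/Ef; case: ifPn => c0; last first.
  by rewrite mulr0 expR_ge0.
rewrite -ler_sqr ?nnegrE ?expR_ge0 ?mulr_ge0 ?exprn_ge0 ?normc_ge0 ?expR_ge0//.
have -> : expR ((1 - m%:R / 6) / 2) ^+ 2 = expR (1 - m%:R / 6) :> R.
  by rewrite -expRM_natl; congr expR; field.
rewrite exprMn -exprM mulnC exprM /hh /vr normcM normcV [(normc _ / _) ^+ 2]exprMn exprVn !normc_1z.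
have -> : expR (- (2 / (1 + cos t))) ^+ 2 = expR (- (4 / (1 + cos t))).
  by rewrite -expRM_natl; congr expR; ring.
apply: hh_est => //.
by rewrite cos_le1 andbT; clear -c0; lra.
Qed.

Lemma cder_hh (s r : R) : 0 <= r < 1 ->
  cder (hh s r) (fun t => (s - r)%:C%C * ('i%C * z t) * vr r t ^+ 2).
Proof.
move=> r01.
have h := cder_D (cder_cst 1) (cder_Z s%:C%C (@cder_z R)).
apply: cder_ext (cder_M h (cder_vr r01)) _ _ => // t.
have e := vrK t r01.
rewrite add0r rcB; move: e; move: (vr r t) (z t) (r%:C)%C (s%:C)%C ('i%C) => v w a b i e.
have -> : b * (i * w) * v = b * (i * w) * v * ((1 + a * w) * v) by rewrite e mulr1.
ring.
Qed.

(** The parameters are r = 1 - eta, s = 1 - 2 eta, eta = 1 / (2 m) and n = m^2. Differentiating hh^n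
    costs a factor of at most 2 m^3 and lowers the exponent to m^2 - 1, which is why [hh_est] admits
    both exponents; the gain exp (- m / 12) outweighs this loss. *)
Lemma hh_small e : 0 < e -> exists s r n, 0 <= r < 1 /\
  C1b e (fun t => zb t * (hh s r t ^+ n * (Uh t)%:C%C)).
Proof.
move=> e0; have [A A0 HA] := Uh_Ef.
have [m m0 Hm] : exists2 m, (0 < m)%N &
    2 * (A * expR ((1 - m%:R / 6) / 2) * (2 * m%:R ^+ 3 + 1)) < e.
  (* The term of degree 4 of exp (m / 12) is used against m^3; 24 * 12^4 comes from 4! and the
     division by 12. *)
  pose c := A * expR 2^-1 * (24 * 12 ^+ 4).
  have c0 : 0 < c by rewrite !mulr_gt0 ?expR_gt0 ?exprn_gt0.
  pose m := (Num.Def.archi_bound (6 * c / e)).+1.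
  have m0 : 0 < m%:R :> R by rewrite ltr0n.
  exists m => //.
  have hm : 6 * c / e < m%:R.
    apply: lt_le_trans (archi_boundP _) _; first by rewrite divr_ge0 ?mulr_ge0 ?ltW.
    by rewrite ler_nat leqnSn.
  rewrite ltr_pdivrMr// in hm.
  have E := @expR_ge1Dxn R (m%:R / 12) 3 (divr_ge0 (ltW m0) (ler0n _ _)).
  have F : (4`!)%:R = 24 :> R by [].
  rewrite F in E.
  have -> : expR ((1 - m%:R / 6) / 2) = expR 2^-1 / expR (m%:R / 12) :> R.
    by rewrite -expRB; congr expR; field.
  have m1 : 1 <= m%:R ^+ 3 :> R by rewrite exprn_ege1// ler1n.
  have E0 := expR_gt0 (m%:R / 12 : R).
  have h1 : (m%:R / 12) ^+ 4 / 24 <= expR (m%:R / 12) :> R by clear -E; lra.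
  have h2 : (expR (m%:R / 12))^-1 <= 24 * 12 ^+ 4 / m%:R ^+ 4 :> R.
    rewrite invf_ple ?posrE ?divr_gt0 ?mulr_gt0 ?exprn_gt0//.
    apply: le_trans h1; rewrite invfM invrK expr_div_n invfM.
    by rewrite le_eqVlt; apply/orP; left; apply/eqP; ring.
  apply: le_lt_trans (_ : 2 * (c / m%:R ^+ 4 * (3 * m%:R ^+ 3)) < e).
    rewrite ler_wpM2l//; apply: ler_pM.
    - by rewrite !mulr_ge0 ?invr_ge0 ?expR_ge0 ?ltW.
    - by rewrite addr_ge0 ?mulr_ge0 ?exprn_ge0.
    - have -> : c / m%:R ^+ 4 = A * (expR 2^-1 * (24 * 12 ^+ 4 / m%:R ^+ 4)).
        by rewrite /c; ring.
      apply: ler_wpM2l; first exact: ltW.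
      by apply: ler_wpM2l; first exact: expR_ge0.
    - by clear -m1; lra.
  have -> : 2 * (c / m%:R ^+ 4 * (3 * m%:R ^+ 3)) = 6 * c / m%:R.
    by field; exact: lt0r_neq0.
  by rewrite ltr_pdivrMr// [e * _]mulrC.
pose eta : R := (2 * m%:R)^-1.
have M0 : 0 < m%:R :> R by rewrite ltr0n.
have eta0 : 0 < eta by rewrite invr_gt0 mulr_gt0.
have etam : eta^-1 = 2 * m%:R by rewrite invrK.
have eta1 : eta <= 2^-1.
  by rewrite /eta lef_pV2 ?posrE ?mulr_gt0// ler_peMr// ler1n.
have r01 : 0 <= 1 - eta < 1 by apply/andP; clear -eta0 eta1; split; lra.
pose q : R := expR ((1 - m%:R / 6) / 2).
have q0 : 0 <= q := expR_ge0 _.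
have hE n t : (n <= m ^ 2)%N -> (m ^ 2 <= n.+1)%N ->
    normc (hh (1 - 2 * eta) (1 - eta) t) ^+ n * Ef t <= q.
  exact: hh_Ef.
have mm : (0 < m ^ 2)%N by rewrite expn_gt0 m0.
exists (1 - 2 * eta), (1 - eta), (m ^ 2)%N; split => //.
have K : C1b (A * q * (2 * m%:R ^+ 3 + 1))
    (fun t => hh (1 - 2 * eta) (1 - eta) t ^+ (m ^ 2) * (Uh t)%:C%C).
  exists (fun t => (m ^ 2)%N%:R * hh (1 - 2 * eta) (1 - eta) t ^+ (m ^ 2).-1 *
    ((1 - 2 * eta - (1 - eta))%:C%C * ('i%C * z t) * vr (1 - eta) t ^+ 2) * (Uh t)%:C%C +
    hh (1 - 2 * eta) (1 - eta) t ^+ (m ^ 2) * (Uh' t)%:C%C); split.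
  - exact: cder_M (cder_X _ (cder_hh _ r01)) (cder_real (@Uh_der R)).
  - by rewrite /per /hh /vr per_z Uh_even.
  - move=> t; rewrite normcM normcX normcR.
    have [h _] := HA t; apply: le_trans (_ : A * q * 1 <= _).
      rewrite mulr1; apply: le_trans (ler_wpM2l (exprn_ge0 _ (normc_ge0 _)) h) _.
      rewrite [X in _ * (_ * X)]expr2 mulrCA; apply: ler_wpM2l; first exact: ltW.
      rewrite mulrA.
      rewrite -[q]mulr1; apply: ler_pM; rewrite ?mulr_ge0 ?exprn_ge0 ?normc_ge0 ?Ef_ge0 ?Ef_le1//.
      by apply: hE.
    rewrite ler_wpM2l ?mulr_ge0 ?(ltW A0)// lerDr mulr_ge0 ?exprn_ge0//.
  - move=> t; have [hU hU'] := HA t.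
    apply: le_trans (normcD _ _) _; rewrite mulrDr mulr1; apply: lerD; last first.
      rewrite normcM normcX normcR.
      apply: le_trans (ler_wpM2l (exprn_ge0 _ (normc_ge0 _)) hU') _.
      by rewrite mulrCA; apply: ler_wpM2l; [exact: ltW|exact: hE].
    have -> : ((m ^ 2)%N%:R : R[i]) = ((m%:R ^+ 2)%:C)%C by rewrite -natrX rmorph_nat.
    rewrite !normcM -expr2 !normcX !normcR normci normc_z !mul1r mulr1.
    have -> : 1 - 2 * eta - (1 - eta) = - eta by ring.
    rewrite normrN (ger0_norm (ltW eta0)) (ger0_norm (exprn_ge0 2 (ltW M0))).
    have hv : eta * normc (vr (1 - eta) t) ^+ 2 <= 2 * m%:R.
      rewrite -etam; apply: le_trans (_ : eta * eta^-1 ^+ 2 <= _).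
        apply: ler_wpM2l; first exact: ltW.
        apply: lerXn2r; rewrite ?nnegrE ?normc_ge0 ?invr_ge0 ?(ltW eta0)//.
        by apply: le_trans (normc_vr t r01) _; rewrite opprB addrC subrK.
      by rewrite expr2 mulrA divff ?mul1r// lt0r_neq0.
    have hq : normc (hh (1 - 2 * eta) (1 - eta) t) ^+ (m ^ 2).-1 * `|Uh t| <= A * q.
      apply: le_trans (ler_wpM2l (exprn_ge0 _ (normc_ge0 _)) hU) _.
      rewrite [X in _ * (_ * X)]expr2 mulrCA; apply: ler_wpM2l; first exact: ltW.
      rewrite mulrA.
      rewrite -[q]mulr1; apply: ler_pM; rewrite ?mulr_ge0 ?exprn_ge0 ?normc_ge0 ?Ef_ge0 ?Ef_le1//.
      by apply: hE; [exact: leq_pred|rewrite prednK].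
    have -> : forall a b c d f : R, a * b * (c * d) * f = a * (c * d) * (b * f) by move=> *; ring.
    have -> : A * q * (2 * m%:R ^+ 3) = m%:R ^+ 2 * (2 * m%:R) * (A * q) by ring.
    apply: ler_pM => //.
    + by rewrite !mulr_ge0 ?exprn_ge0 ?normc_ge0 ?(ltW eta0).
    + by rewrite mulr_ge0 ?exprn_ge0 ?normc_ge0.
    + by rewrite ler_wpM2l ?exprn_ge0.
have := C1b_M (@C1b_zb R) K; rewrite mulr1 => h.
exact: C1b_le (ltW Hm) h.
Qed.

(* As hh - 1 vanishes at z = 0, z^-1 (1 - hh^n) Uh is a one-sided combination, while the
   flatness of Uh at z = -1 makes the remaining hh^n Uh negligible. *)
Lemma Cl_zb_Uh : Cl (fun t : R => zb t * (Uh t)%:C%C).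
Proof.
apply: Cl_lim => e e0; have [s [r [n [r01 h]]]] := hh_small e0.
exists (fun t => zb t * (1 - hh s r t ^+ n) * (Uh t)%:C%C); first exact: Cl_zb_hh.
apply: C1b_ext h _ => t; ring.
Qed.

(** Multiplication by z^-1 is bounded in C^1, so combinations suffice; there only the term z^-1 Uh
    is not evidently one-sided. *)
Lemma Cl_zb F : Cl F -> Cl (fun t => zb t * F t).
Proof.
move=> hF; apply: Cl_lim => e e0; have e2 : 0 < e / 2 by rewrite divr_gt0.
have [N [d h]] := hF _ e2.
exists (fun t => zb t * comb N d t).
  have hk k : Cl (fun t => (d k)%:C%C * (zb t * (z t ^+ k * (Uh t)%:C%C))).
    apply: Cl_Z; case: k => [|k].
      by apply: Cl_ext Cl_zb_Uh _ => t; rewrite expr0 mul1r.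
    have : Cl (fun t => z t ^+ k * (Uh t)%:C%C).
      elim: k => [|k IH]; first by apply: Cl_ext (@Cl_Uh R) _ => t; rewrite expr0 mul1r.
      by apply: Cl_ext (Cl_z IH) _ => t; rewrite exprS mulrA.
    move=> h1; apply: Cl_ext h1 _ => t; rewrite exprS.
    by rewrite -[LHS]mul1r -(z_zb t); ring.
  apply: Cl_ext (Cl_sum N hk) _ => t /=; rewrite /comb mulr_sumr.
  by apply: eq_bigr => i _; ring.
have := C1b_M (@C1b_zb R) h; rewrite mulr1 mulrCA divff ?mulr1// => h1.
by apply: C1b_ext h1 _ => t; ring.
Qed.

End BackwardShift.

(** * Fourier coefficients of C^1 functions on the circle *)

Section Coefficients.
Context (R : realType).
Implicit Types (F G : R -> R[i]) (K L e t : R) (m : int).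

Definition cc F := continuous (fun t => complex.Re (F t)) /\
  continuous (fun t => complex.Im (F t)).

Definition C1c F := exists2 F', cder F F' & cc F'.

Lemma cc_ext F G : cc F -> F =1 G -> cc G.
Proof. by move=> h /funext <-. Qed.

Lemma cc_D F G : cc F -> cc G -> cc (fun t => F t + G t).
Proof.
move=> [f1 f2] [g1 g2]; split.
  by under eq_fun do rewrite ReD; exact: contD.
by under eq_fun do rewrite ImD; exact: contD.
Qed.

Lemma cc_M F G : cc F -> cc G -> cc (fun t => F t * G t).
Proof.
move=> [f1 f2] [g1 g2]; split.
  by under eq_fun do rewrite ReM; apply: contB; exact: contM.
by under eq_fun do rewrite ImM; apply: contD; exact: contM.
Qed.

Lemma cc_cst (k : R[i]) : cc (fun=> k).
Proof. by split; exact: cont_cst. Qed.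

Lemma cc_cder F F' : cder F F' -> cc F.
Proof. by move=> [h1 h2]; split; [exact: der_cont h1|exact: der_cont h2]. Qed.

Lemma C1c_cc F : C1c F -> cc F.
Proof. by case=> F' /cc_cder. Qed.

Lemma C1c_D F G : C1c F -> C1c G -> C1c (fun t => F t + G t).
Proof.
move=> [F' f1 f2] [G' g1 g2]; exists (fun t => F' t + G' t); first exact: cder_D.
exact: cc_D.
Qed.

Lemma C1c_M F G : C1c F -> C1c G -> C1c (fun t => F t * G t).
Proof.
move=> [F' f1 f2] [G' g1 g2]; exists (fun t => F' t * G t + F t * G' t).
  exact: cder_M.
by apply: cc_D; apply: cc_M => //; [exact: cc_cder g1|exact: cc_cder f1].
Qed.

Lemma C1c_cst (k : R[i]) : C1c (fun=> k).
Proof. by exists (fun=> 0); [exact: cder_cst|exact: cc_cst]. Qed.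

Lemma C1c_ext F G : C1c F -> F =1 G -> C1c G.
Proof. by move=> h /funext <-. Qed.

Lemma C1c_X F n : C1c F -> C1c (fun t => F t ^+ n).
Proof.
move=> h; elim: n => [|n IH]; first exact: C1c_cst.
by apply: C1c_ext (C1c_M h IH) _ => t; rewrite exprS.
Qed.

Lemma C1c_sum n (F : nat -> R -> R[i]) : (forall k, C1c (F k)) ->
  C1c (fun t => \sum_(k < n) F k t).
Proof.
move=> h; elim: n => [|n IH].
  by apply: C1c_ext (C1c_cst 0) _ => t; rewrite big_ord0.
by apply: C1c_ext (C1c_D IH (h n)) _ => t; rewrite big_ord_recr.
Qed.

Lemma C1c_z : C1c (@z R).
Proof.
exists (fun t => 'i%C * z t); first exact: cder_z.
by apply: cc_M; [exact: cc_cst|exact: cc_cder (@cder_z R)].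
Qed.

Lemma lip_cont (f : R -> R) C : (forall x y, `|f x - f y| <= C * `|x - y|) ->
  continuous f.
Proof.
move=> h x; apply/cvgrPdist_lt => e e0.
have C1 : 0 < `|C| + 1 by rewrite ltr_wpDl.
have d0 : 0 < e / (`|C| + 1) by rewrite divr_gt0.
near=> y; apply: le_lt_trans (h x y) _.
have : `|x - y| < e / (`|C| + 1) by near: y; exact: cvgr_dist_lt.
rewrite ltr_pdivlMr// mulrC; apply: le_lt_trans.
by apply: ler_wpM2r => //; rewrite (le_trans (ler_norm C))// lerDl.
Unshelve. all: by end_near. Qed.

Lemma sin_lip (x y : R) : `|sin x - sin y| <= `|x - y|.
Proof.
have [c _ ->] := MVT_der y x (@der_sin R).
by rewrite normrM ler_piMl// ler_norml cos_geN1 cos_le1.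
Qed.

Lemma cont_cser' (u : nat -> R) : rap u -> continuous (cser' u).
Proof.
move=> ru; have [C HC] := rap_qs 2 ru; apply: (@lip_cont _ C) => x y.
have := sums_B (cser'_sums x ru) (cser'_sums y ru).
apply: sums_bound => n.
have -> : - (n%:R * u n * sin (n%:R * x)) - - (n%:R * u n * sin (n%:R * y)) =
  - (n%:R * u n * (sin (n%:R * x) - sin (n%:R * y))) by ring.
rewrite normrN normrM.
apply: le_trans (_ : `|n%:R * u n| * (n%:R * `|x - y|) <= _).
  apply: ler_wpM2l => //; apply: le_trans (sin_lip _ _) _.
  by rewrite -mulrBr normrM ger0_norm.
rewrite [leRHS]mulrAC; rewrite mulrA; apply: ler_wpM2r => //.
apply: le_trans (HC n); rewrite [leRHS]ger0_norm ?mulr_ge0 ?exprn_ge0//.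
rewrite normrM ger0_norm// mulrAC -expr2; apply: ler_wpM2r => //.
by apply: lerXn2r; rewrite ?nnegrE ?ler0n// ler_nat.
Qed.

Lemma C1c_Uh : C1c (fun t : R => (Uh t)%:C%C).
Proof.
exists (fun t => (Uh' t)%:C%C); first exact: cder_real (@Uh_der R).
by split; [exact: cont_cser' (@rap_cU R)|exact: cont_cst].
Qed.

(** The real part of the mean of F z^-m over the circle. It is linear over R, and for the functions
    met here, with even real and odd imaginary part, it is the whole Fourier coefficient. *)
Definition cf F m : R := (2 * pi)^-1 * Int (- pi) pi (fun t =>
  complex.Re (F t) * cos (m%:~R * t) + complex.Im (F t) * sin (m%:~R * t)).

Lemma cont_cosk (k : R) : continuous (fun t => cos (k * t)).
Proof. exact: der_cont (der_cosn k). Qed.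

Lemma cont_sink (k : R) : continuous (fun t => sin (k * t)).
Proof. exact: der_cont (der_sinn k). Qed.

Lemma cf_cont F m : cc F -> continuous (fun t =>
  complex.Re (F t) * cos (m%:~R * t) + complex.Im (F t) * sin (m%:~R * t)).
Proof.
move=> [h1 h2]; apply: contD; apply: contM => //.
  exact: cont_cosk.
exact: cont_sink.
Qed.

Lemma cf_ext F G m : F =1 G -> cf F m = cf G m.
Proof. by move=> /funext ->. Qed.

Lemma cf_D F G m : cc F -> cc G -> cf (fun t => F t + G t) m = cf F m + cf G m.
Proof.
move=> hF hG; rewrite /cf -mulrDr -IntD; [|exact: cf_cont|exact: cf_cont].
by congr (_ * _); apply: Int_eq => t _; rewrite ReD ImD; ring.
Qed.

Lemma cf_Z (k : R) F m : cc F -> cf (fun t => k%:C%C * F t) m = k * cf F m.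
Proof.
move=> hF; have cF := @cf_cont F m hF; rewrite /cf mulrCA -(@IntZ _ _ _ k _ cF).
by congr (_ * _); apply: Int_eq => t _; rewrite ReM ImM /=; ring.
Qed.

Lemma cf_sum n (d : nat -> R) (F : nat -> R -> R[i]) m : (forall k, cc (F k)) ->
  cf (fun t => \sum_(k < n) (d k)%:C%C * F k t) m = \sum_(k < n) d k * cf (F k) m.
Proof.
move=> h; elim: n => [|n IH].
  rewrite big_ord0 (@cf_ext _ (fun=> 0%:C%C * 0)); last first.
    by move=> t; rewrite big_ord0 mulr0.
  by rewrite cf_Z ?mul0r//; exact: cc_cst.
rewrite big_ord_recr/= -IH -cf_Z// -cf_D.
- by apply: cf_ext => t; rewrite big_ord_recr.
- elim: n {IH} => [|n IH].
    by apply: cc_ext (cc_cst 0) _ => t; rewrite big_ord0.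
  apply: cc_ext (cc_D IH (cc_M (cc_cst (d n)%:C%C) (h n))) _ => t.
  by rewrite big_ord_recr.
- by apply: cc_M => //; exact: cc_cst.
Qed.

Lemma Re_le_normc (x : R[i]) : `|complex.Re x| <= normc x.
Proof.
rewrite -[leRHS]ger0_norm ?normc_ge0// -ler_sqr ?nnegrE// !real_normK ?num_real//.
by rewrite normc2 lerDl sqr_ge0.
Qed.

Lemma Im_le_normc (x : R[i]) : `|complex.Im x| <= normc x.
Proof.
rewrite -[leRHS]ger0_norm ?normc_ge0// -ler_sqr ?nnegrE// !real_normK ?num_real//.
by rewrite normc2 lerDr sqr_ge0.
Qed.

Lemma sin_pi_int m : sin (m%:~R * pi) = 0 :> R.
Proof.
case: m => n; first by rewrite -pmulrn sin_npi.
by rewrite NegzE mulrNz mulNr sinN -pmulrn sin_npi oppr0.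
Qed.

Lemma bound_trig (K c s x y : R) : `|x| <= K -> `|y| <= K -> `|c| <= 1 -> `|s| <= 1 ->
  `|x * c + y * s| <= 2 * K.
Proof.
move=> hx hy hc hs; apply: le_trans (ler_normD _ _) _.
rewrite mulr_natl mulr2n; apply: lerD; rewrite normrM -[K]mulr1; exact: ler_pM.
Qed.

Lemma cos_norm1 (x : R) : `|cos x| <= 1.
Proof. by rewrite ler_norml cos_geN1 cos_le1. Qed.

Lemma sin_norm1 (x : R) : `|sin x| <= 1.
Proof. by rewrite ler_norml sin_geN1 sin_le1. Qed.

Lemma cf_bound K F m : cc F -> (forall t, normc (F t) <= K) -> `|cf F m| <= 2 * K.
Proof.
move=> cF hF; rewrite /cf normrM.
have p0 : 0 < 2 * pi :> R by rewrite mulr_gt0// pi_gt0.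
have E : pi - - pi = 2 * pi :> R by ring.
rewrite gtr0_norm ?invr_gt0// mulrC ler_pdivrMr// -E.
apply: Int_norm; [exact: pile|exact: cf_cont|move=> t _].
apply: bound_trig; [| |exact: cos_norm1|exact: sin_norm1].
- exact: le_trans (Re_le_normc _) (hF t).
- exact: le_trans (Im_le_normc _) (hF t).
Qed.

Lemma der_uniq (f f1 f2 : R -> R) : der f f1 -> der f f2 -> f1 =1 f2.
Proof.
move=> h1 h2 x.
by rewrite -(@derive_val _ _ _ _ _ _ _ (h1 x)) (@derive_val _ _ _ _ _ _ _ (h2 x)).
Qed.

(** Integration by parts. The derivative bounded by [C1b] and the continuous one supplied by [C1c]
    coincide by uniqueness of derivatives. *)
Lemma cf_bound1 K F m : C1c F -> C1b K F -> `|m%:~R * cf F m| <= 2 * K.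
Proof.
move=> [G [dG1 dG2] cG] [F' [[d1 d2] pF _ hF']].
have eq1 : (fun t => complex.Re (F' t)) =1 (fun t => complex.Re (G t)).
  exact: der_uniq d1 dG1.
have eq2 : (fun t => complex.Im (F' t)) =1 (fun t => complex.Im (G t)).
  exact: der_uniq d2 dG2.
have hG t : normc (G t) <= K.
  by have -> : G t = F' t by apply: cext; [rewrite -[LHS]eq1|rewrite -[LHS]eq2].
set k : R := m%:~R.
have cF : cc F by split; [exact: der_cont d1|exact: der_cont d2].
have dA := der_B (der_M dG1 (der_sinn k)) (der_M dG2 (der_cosn k)).
have cont1 := @cf_cont F m cF; rewrite -/k in cont1.
have cont2 : continuous (fun t => complex.Re (G t) * sin (k * t) -
    complex.Im (G t) * cos (k * t)).
  by case: cG => g1 g2; apply: contB; apply: contM => //; [exact: cont_sink|exact: cont_cosk].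
have dA' : der (fun t => complex.Re (F t) * sin (k * t) - complex.Im (F t) * cos (k * t))
  (fun t => (complex.Re (G t) * sin (k * t) - complex.Im (G t) * cos (k * t)) +
    k * (complex.Re (F t) * cos (k * t) + complex.Im (F t) * sin (k * t))).
  by apply: der_ext dA _ _ => t //=; ring.
have cont3 := @contZ _ k _ cont1.
have := Int_FTC (@pile R) (contD cont2 cont3) dA'.
rewrite IntD// IntZ//.
rewrite mulrN sinN cosN [k * pi]/(k * pi) sin_pi_int pF.
have -> : forall x y c : R, x * 0 - y * c - (x * - 0 - y * c) = 0 by move=> *; ring.
move/eqP; rewrite addrC addr_eq0 => /eqP E.
have p0 : 0 < 2 * pi :> R by rewrite mulr_gt0// pi_gt0.
rewrite /cf mulrCA -/k E normrM gtr0_norm ?invr_gt0// mulrC ler_pdivrMr//.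
have -> : 2 * pi = pi - - pi :> R by ring.
rewrite normrN; apply: Int_norm => //; first exact: pile.
move=> t _; rewrite -mulrN.
apply: bound_trig; [| |exact: sin_norm1|by rewrite normrN; exact: cos_norm1].
- exact: le_trans (Re_le_normc _) (hG t).
- exact: le_trans (Im_le_normc _) (hG t).
Qed.

End Coefficients.

(** * Powers of W = 1 - Uh / max Uh and the approximation of the unit coefficient sequence *)

Section FourierApprox.
Context (R : realType).
Implicit Types (F G : R -> R[i]) (K L e t : R) (m : int).

Lemma zD (x y : R) : z (x + y) = z x * z y.
Proof. by apply: cext; rewrite ?ReM ?ImM /= ?cosD ?sinD//; ring. Qed.

Lemma zbE (x : R) : zb x = z (- x).
Proof. by apply: cext; rewrite /= ?cosN ?sinN. Qed.

Lemma zX (x : R) n : z x ^+ n = z (n%:R * x).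
Proof.
elim: n => [|n IH]; last by rewrite exprS IH -zD -natr1 mulrDl mul1r addrC.
by rewrite expr0 mul0r; apply: cext; rewrite /= ?cos0 ?sin0.
Qed.

Lemma cosnE (n : nat) t : (cos (n%:R * t))%:C%C = (2^-1)%:C%C * (z t ^+ n + zb t ^+ n).
Proof.
rewrite zbE !zX mulrN; apply: cext.
  rewrite ReM !ReD ImD /= cosN.
  by field.
by rewrite ImM ReD ImD /= sinN; ring.
Qed.

Lemma Uh_tail e : 0 < e -> exists N, C1b e (fun t =>
  (Uh t)%:C%C - \sum_(n < N) (cU R n)%:C%C * (cos (n%:R * t))%:C%C).
Proof.
move=> e0; have [C1 H1] := rap_bound (@rap_cU R).
have [C2 H2] := rap_bound (rap_natmul (@rap_cU R)).
have C1p := qs_ge0 H1; have C2p := qs_ge0 H2.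
have := archi_boundP (divr_ge0 (addr_ge0 C1p C2p) (ltW e0)).
set N := Num.bound _ => hN; exists N.
have hN' : (C1 + C2) / N.+1%:R <= e.
  rewrite ler_pdivrMr ?ltr0n// mulrC -ler_pdivrMr//; apply: le_trans (ltW hN) _.
  by rewrite ler_nat.
pose P (N : nat) t := \sum_(n < N) cU R n * cos (n%:R * t).
pose P' (N : nat) t := \sum_(n < N) - (n%:R * cU R n * sin (n%:R * t)).
have dP : der (P N) (P' N).
  elim: (N) => [|n IH].
    by apply: der_ext (der_cst 0) _ _ => t; rewrite /P/P' big_ord0.
  apply: der_ext (der_D IH (der_Z (cU R n) (der_cosn n%:R))) _ _ => t.
    by rewrite /P big_ord_recr.
  by rewrite /P' big_ord_recr/=; congr (_ + _); ring.
have PE t : (Uh t)%:C%C - \sum_(n < N) (cU R n)%:C%C * (cos (n%:R * t))%:C%C =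
    (Uh t - P N t)%:C%C.
  rewrite rcB; congr (_ - _); rewrite /P; elim: (N) => [|n IH]; first by rewrite !big_ord0.
  by rewrite !big_ord_recr /= rcD rcM IH.
exists (fun t => (Uh' t - P' N t)%:C%C); split.
- apply: cder_ext (cder_real (der_B (@Uh_der R) dP)) _ _ => // t; exact/esym/PE.
- rewrite /per !PE Uh_even; congr ((_ - _)%:C%C); rewrite /P.
  by apply: eq_bigr => i _; rewrite mulrN cosN.
- move=> t; rewrite PE normcR.
  apply: le_trans (sums_tail N (qs_M H1 _) (cser_sums t (@rap_cU R))) _.
    by move=> n; exact: cos_norm1.
  by apply: le_trans hN'; rewrite ler_wpM2r ?invr_ge0// lerDl.
- move=> t; rewrite normcR.
  have q2 : qs C2 (fun n => - (n%:R * cU R n * sin (n%:R * t))).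
    by move=> n; rewrite normrN; apply: (qs_M H2 (b := fun n => sin (n%:R * t))) => k;
      exact: sin_norm1.
  apply: le_trans (sums_tail N q2 (cser'_sums t (@rap_cU R))) _.
  by apply: le_trans hN'; rewrite ler_wpM2r ?invr_ge0// lerDr.
Qed.

Lemma Cl_zX F n : Cl F -> Cl (fun t => z t ^+ n * F t).
Proof.
move=> h; elim: n => [|n IH]; first by apply: Cl_ext h _ => t; rewrite mul1r.
by apply: Cl_ext (Cl_z IH) _ => t; rewrite exprS mulrA.
Qed.

Lemma Cl_zbX F n : Cl F -> Cl (fun t => zb t ^+ n * F t).
Proof.
move=> h; elim: n => [|n IH]; first by apply: Cl_ext h _ => t; rewrite mul1r.
by apply: Cl_ext (Cl_zb IH) _ => t; rewrite exprS mulrA.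
Qed.

(** The closure is stable under z and z^-1, hence under the cosine partial sums of Uh, which
    converge to Uh in C^1. *)
Lemma ClB_Uh F : ClB F -> ClB (fun t => (Uh t)%:C%C * F t).
Proof.
move=> [hF [K hK]]; have [L hL] := @C1b_Uh R; split; last first.
  by exists (2 * L * K); exact: C1b_M.
apply: Cl_lim => e e0; have K0 := C1b_ge0 hK.
have k0 : 0 < 2 * K + 1 by rewrite ltr_wpDl// mulr_ge0.
have [N hN] := Uh_tail (divr_gt0 e0 k0).
exists (fun t => (\sum_(n < N) (cU R n)%:C%C * (cos (n%:R * t))%:C%C) * F t).
  have hc n : Cl (fun t => (cU R n)%:C%C *
      ((2^-1)%:C%C * (z t ^+ n * F t + zb t ^+ n * F t))).
    by apply/Cl_Z/Cl_Z/Cl_D; [exact: Cl_zX|exact: Cl_zbX].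
  apply: Cl_ext (Cl_sum N hc) _ => t /=; rewrite mulr_suml; apply: eq_bigr => i _.
  by rewrite cosnE; ring.
apply: C1b_le (C1b_ext (C1b_M hN hK) _); last by move=> t /=; rewrite mulrBl.
have -> : 2 * (e / (2 * K + 1)) * K = e * ((2 * K) / (2 * K + 1)) by ring.
by rewrite ler_piMr ?(ltW e0)// ler_pdivrMr// mul1r lerDl.
Qed.

Definition Wh t : R := 1 - Uh t / Uh 0.

Lemma Uh00 : 0 < Uh 0 :> R.
Proof. by apply: Uh_gt0; rewrite oppr_lt0 pi_gt0. Qed.

Lemma Wh_ge0 t : 0 <= Wh t.
Proof. by rewrite subr_ge0 ler_pdivrMr ?Uh00// mul1r Uh_le. Qed.

Lemma Wh_le1 t : Wh t <= 1.
Proof. by rewrite gerBl divr_ge0 ?Uh_ge0. Qed.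

Lemma Wh_lt1 t : - pi < t < pi -> Wh t < 1.
Proof. by move=> h; rewrite gtrBl divr_gt0 ?Uh00//; exact: Uh_gt0. Qed.

Lemma Wh_even t : Wh (- t) = Wh t.
Proof. by rewrite /Wh Uh_even. Qed.

Lemma Wh_der : der Wh (fun t => - (Uh 0)^-1 * Uh' t).
Proof.
by apply: der_ext (der_B (der_cst 1) (der_Z (Uh 0)^-1 (@Uh_der R))) _ _ => t;
  rewrite /Wh; ring.
Qed.

Lemma cont_Wh : continuous Wh. Proof. exact: der_cont Wh_der. Qed.

Lemma Wh_mono s t : 0 <= s -> s <= t -> t <= pi -> Wh s <= Wh t.
Proof.
move=> s0 st tpi.
have cU' := @cont_cser' R _ (@rap_cU R).
have := Int_FTC st cU' (@Uh_der R).
have : 0 <= Int s t (fun x => - Uh' x).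
  apply: Int_ge0 => x /andP[sx xt]; rewrite oppr_ge0 Uh'_le0//.
  by rewrite (le_trans s0 sx) (le_trans xt tpi).
under [X in Int _ _ X]eq_fun do rewrite -mulN1r.
rewrite (@IntZ _ _ _ (-1) _ cU') mulN1r oppr_ge0 => h E; rewrite E subr_le0 in h.
by rewrite /Wh lerD2l lerN2 ler_wpM2r// invr_ge0 ltW// Uh00.
Qed.

Lemma ClB_WX j : ClB (fun t => (Wh t ^+ j)%:C%C * (Uh t)%:C%C).
Proof.
elim: j => [|j IH].
  split; first by apply: Cl_ext (@Cl_Uh R) _ => t; rewrite expr0 mul1r.
  have [K hK] := @C1b_Uh R.
  by exists K; apply: C1b_ext hK _ => t; rewrite expr0 mul1r.
have [h1 [K hK]] := ClB_D IH (ClB_Z (- (Uh 0)^-1) (ClB_Uh IH)).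
have E t : (Wh t ^+ j)%:C%C * (Uh t)%:C%C +
   (- (Uh 0)^-1)%:C%C * ((Uh t)%:C%C * ((Wh t ^+ j)%:C%C * (Uh t)%:C%C)) =
   (Wh t ^+ j.+1)%:C%C * (Uh t)%:C%C.
  by rewrite -!rcM -rcD; congr (_%:C%C); rewrite exprS {3}/Wh; ring.
by split; [exact: Cl_ext h1 E|exists K; exact: C1b_ext hK E].
Qed.

(** Telescoping: passing from r to r + 1 adds W^r Uh / Uh 0, which is in the closure by [ClB_WX]. *)
Lemma Cl_1W r : Cl (fun t => 1 - (Wh t ^+ r)%:C%C).
Proof.
elim: r => [|r IH]; first by apply: Cl_ext (@Cl_0 R) _ => t; rewrite expr0 subrr.
have [h _] := ClB_WX r.
apply: Cl_ext (Cl_D IH (Cl_Z (Uh 0)^-1 h)) _ => t.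
have -> : (1 : R[i]) = 1%:C%C by [].
by rewrite -rcM -rcM -!rcB -rcD; congr (_%:C%C); rewrite exprS {3}/Wh; ring.
Qed.

Lemma cos_absz m t : cos (m%:~R * t) = cos (`|m|%N%:R * t).
Proof.
case: m => n; first by rewrite -pmulrn absz_nat.
by rewrite NegzE mulrNz mulNr cosN -pmulrn abszN absz_nat.
Qed.

Lemma cf_real (f : R -> R) m :
  cf (fun t => (f t)%:C%C) m = (2 * pi)^-1 * coscoef f `|m|%N.
Proof.
by rewrite /cf /coscoef; congr (_ * _); apply: Int_eq => t _ /=; rewrite mul0r addr0 cos_absz.
Qed.

(* Wh^r is monotone on [0, pi] with values in [0, 1], so its variation, which controls
   m times its m-th coefficient, is bounded independently of r. *)
Lemma cf_W_bound r m : `|m%:~R * cf (fun t => (Wh t ^+ r)%:C%C) m| <= 2.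
Proof.
have dW := der_X r Wh_der; set f' := (X in der _ X) in dW.
have cU' := @cont_cser' R _ (@rap_cU R).
have cf' : continuous f'.
  apply: contM; last exact: contZ.
  by apply: contM; [exact: cont_cst|exact: contX cont_Wh].
have odd' t : f' (- t) = - f' t.
  have h : der (fun t => Uh (- t)) (fun t => - Uh' (- t)).
    have := der_comp (@Uh_der R) (der_Z (-1) (@der_id R)).
    by move=> h; apply: der_ext h _ _ => s; rewrite ?mulN1r ?mulr1 ?mulN1r.
  have := der_uniq (der_ext h (@Uh_even R) (fun=> erefl)) (@Uh_der R) t.
  rewrite /f' Wh_even => <-; ring.
have p0 : 0 < 2 * pi :> R by rewrite mulr_gt0// pi_gt0.
rewrite cf_real mulrCA normrM gtr0_norm ?invr_gt0// mulrC ler_pdivrMr//.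
have -> : `|m%:~R * coscoef (fun t : R => Wh t ^+ r) `|m|%N| =
    `| `|m|%N%:R * coscoef (fun t : R => Wh t ^+ r) `|m|%N|.
  by rewrite !normrM natr_absz intr_norm normr_id.
rewrite (coscoef_IBP _ dW cf') normrN /sincoef Int_even; last first.
- by move=> s; rewrite mulrN sinN odd' mulrNN.
- apply: contM => //; exact: cont_sink.
have pi0 := ltW (pi_gt0 R).
rewrite normrM ger0_norm// ler_wpM2l//.
apply: le_trans (Int_abs_le _ cf' _) _.
- by apply: contM => //; exact: cont_sink.
- move=> s hs; rewrite normrM.
  have f0 : 0 <= f' s.
    apply: mulr_ge0; first by rewrite mulr_ge0 ?ler0n ?exprn_ge0 ?Wh_ge0.
    by rewrite mulNr -mulrN mulr_ge0 ?invr_ge0 ?Uh_ge0// oppr_ge0 Uh'_le0.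
  by rewrite ger0_norm// ler_piMr// sin_norm1.
rewrite (Int_FTC pi0 cf' dW).
have h1 : Wh pi ^+ r <= 1 by rewrite exprn_ile1// ?Wh_ge0 ?Wh_le1.
have h0 : 0 <= Wh 0 ^+ r by rewrite exprn_ge0// Wh_ge0.
have := @pi_ge2 R; clear -h1 h0; lra.
Qed.

(** W is monotone on [0, pi] and less than 1 before pi, so W^r tends to 0 uniformly on [0, pi - h],
    while the rest contributes at most h. Cosines are bounded by 1, so r does not depend on m. *)
Lemma cf_W_small e : 0 < e -> exists r, forall m,
  `|cf (fun t => (Wh t ^+ r)%:C%C) m| <= e.
Proof.
move=> e0; have p0 := pi_gt0 R.
have [h [h0 he hp]] := min2_ex (divr_gt0 e0 (ltr0n _ 2)) (divr_gt0 p0 (ltr0n _ 2)).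
set c := pi - h.
have cp : - pi < c < pi by rewrite /c; clear -h0 hp p0; apply/andP; split; lra.
have c0 : 0 <= c by rewrite /c; clear -h0 hp p0; lra.
have [r hr] := @geo_small R (Wh c) _ (introT andP (conj (Wh_ge0 c) (Wh_lt1 cp)))
  (divr_gt0 e0 (ltr0n _ 2)).
exists r => m; rewrite cf_real.
have cW : continuous (fun t => Wh t ^+ r) by exact: contX cont_Wh.
have W0 t : 0 <= Wh t ^+ r by rewrite exprn_ge0// Wh_ge0.
have p20 : 0 < 2 * pi :> R by rewrite mulr_gt0// pi_gt0.
rewrite normrM gtr0_norm ?invr_gt0// mulrC ler_pdivrMr//.
apply: le_trans (Int_abs_le _ cW _) _.
- by apply: contM => //; exact: cont_cosk.
- by move=> s _; rewrite normrM ger0_norm// ler_piMr// cos_norm1.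
rewrite Int_even//; last by move=> s; rewrite Wh_even.
have cpi : c <= pi by case/andP: cp => _ /ltW.
rewrite (Int_split c0 cpi cW).
have A1 : Int 0 c (fun t => Wh t ^+ r) <= Wh c ^+ r * c.
  have := Int_cst (Wh c ^+ r) c0; rewrite subr0 => <-; apply: Int_le => //; first exact: cont_cst.
  move=> x /andP[x0 xc]; apply: lerXn2r; rewrite ?nnegrE ?Wh_ge0//.
  exact: Wh_mono.
have A2 : Int c pi (fun t => Wh t ^+ r) <= h.
  have -> : h = 1 * (pi - c) by rewrite /c; ring.
  rewrite -Int_cst//; apply: Int_le => //; first exact: cont_cst.
  by move=> x _; rewrite exprn_ile1// ?Wh_ge0 ?Wh_le1.
have A3 : Wh c ^+ r * c <= e / 2 * pi.
  apply: ler_pM => //; apply: le_trans (ltW hr).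
  by rewrite ler_peMr// lerDr.
have A4 : e / 2 <= e / 2 * pi.
  by rewrite ler_peMr ?divr_ge0 ?ltW// (lt_le_trans _ (@pi_ge2 R))// ltr1n.
clear -A1 A2 A3 A4 he; lra.
Qed.

(** The two-sided Fourier coefficients of [Uh], where [cU] folds n and - n together. *)
Definition Uc (n : nat) : R := coscoef (@hump R) n ^+ 2.

Lemma coscoef_Uh n : coscoef (@Uh R) n = 2 * pi * Uc n.
Proof.
have [C HC] := rap_bound (@rap_cU R).
have h : sums (fun k => Int (- pi) pi (fun t => cU R k * cos (k%:R * t) * cos (n%:R * t)))
    (coscoef (@Uh R) n).
  apply: (@Int_sums R C); first exact: pile.
  - move=> k; apply: contM; last exact: cont_cosk.
    by apply: contZ; exact: cont_cosk.
  - by apply: contM; [exact: der_cont (@Uh_der R)|exact: cont_cosk].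
  - move=> x; have := sums_Z (cos (n%:R * x)) (cser_sums x (@rap_cU R)).
    rewrite [_ * cser _ _]mulrC; congr (sums _ _).
    by apply: funext => k; rewrite mulrC.
  - move=> k x _; rewrite -mulrA; apply: (@qs_M R _ (fun k => cos (k%:R * x) * cos (n%:R * x)) _ HC) => j.
    by rewrite normrM -[1]mulr1; apply: ler_pM => //; exact: cos_norm1.
have E k : Int (- pi) pi (fun t => cU R k * cos (k%:R * t) * cos (n%:R * t)) =
    cU R k * (if k == n then (if k == 0 then 2 * pi else pi) else 0).
  rewrite -icoscos -IntZ; first by apply: Int_eq => t _; rewrite mulrA.
  by apply: contM; exact: cont_cosk.
rewrite (@sums_single R _ n _ _ h); last first.
  by move=> k kn; rewrite E (negbTE kn) mulr0.
by rewrite E eqxx /cU /Uc; case: eqP => _; ring.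
Qed.

Lemma cf_zU k m : cf (fun t => z t ^+ k * (Uh t)%:C%C) m = Uc `|m - k%:Z|%N.
Proof.
have p20 : 2 * pi != 0 :> R by rewrite mulf_neq0// gt_eqF// pi_gt0.
apply: (mulfI p20); rewrite -coscoef_Uh /cf mulrA divff// mul1r /coscoef.
apply: Int_eq => t _; rewrite -cos_absz rmorphB/= -pmulrn mulrBl cosB zX ReM ImM /=.
ring.
Qed.

Lemma cf_1 m : cf (fun _ : R => 1) m = (m == 0)%:R.
Proof.
have -> : cf (fun _ : R => 1) m = cf (fun t : R => (1 : R)%:C%C) m by [].
have p20 : 2 * pi != 0 :> R by rewrite mulf_neq0// gt_eqF// pi_gt0.
rewrite cf_real /coscoef; under [X in Int _ _ X]eq_fun do rewrite mul1r.
rewrite icos absz_eq0; case: eqP => _; last by rewrite mulr0.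
by rewrite mulVf.
Qed.

(* These are the Fourier coefficients of 1 - z^N (\sum_k d k z^k) Uh, which is close in C^1
   to Wh^r. *)
Lemma coef_approx N e : 0 < e -> exists M (d : nat -> R), forall m,
  `|(m == 0)%:R - \sum_(k < M) d k * Uc `|m - (N + k)%N%:Z|%N| <= e /\
  `|m%:~R * ((m == 0)%:R - \sum_(k < M) d k * Uc `|m - (N + k)%N%:Z|%N)| <= 3.
Proof.
move=> e0; have [e1 [e10 e1e e11]] := min2_ex e0 ltr01.
have [r hr] := cf_W_small (divr_gt0 e0 (ltr0n _ 2)).
(* Multiplying the error by z^N costs the factor 2 (N + 1) of [C1b_M]; this choice leaves e1 / 4 for
   H. *)
have N0 : 0 < 8 * (N%:R + 1) :> R by rewrite mulr_gt0// ltr_wpDl.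
have [M [d hd]] := Cl_zbX N (Cl_1W r) (divr_gt0 e10 N0).
exists M, d => m.
pose H t := z t ^+ N * (zb t ^+ N * (1 - (Wh t ^+ r)%:C%C) - comb M d t).
have hH : C1b (e1 / 4) H.
  apply: C1b_le (C1b_M (C1b_zX R N) hd); rewrite le_eqVlt; apply/orP; left.
  apply/eqP; field; rewrite gt_eqF//.
have cW : C1c (fun t => (Wh t ^+ r)%:C%C).
  have cW0 : C1c (fun t => (Wh t)%:C%C).
    exists (fun t => (- (Uh 0)^-1 * Uh' t)%:C%C); first exact: cder_real Wh_der.
    split; last exact: cont_cst.
    by apply: contZ; exact: cont_cser' (@rap_cU R).
  by apply: C1c_ext (C1c_X r cW0) _ => t; rewrite rcX.
have czU k : C1c (fun t => z t ^+ k * (Uh t)%:C%C).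
  by apply: C1c_M; [exact: C1c_X (@C1c_z R)|exact: C1c_Uh].
have cs : C1c (fun t => \sum_(k < M) (- d k)%:C%C * (z t ^+ (N + k) * (Uh t)%:C%C)).
  apply: (@C1c_sum R M (fun k t => (- d k)%:C%C * (z t ^+ (N + k) * (Uh t)%:C%C))) => k.
  by apply: C1c_M => //; exact: C1c_cst.
have E t : 1 + \sum_(k < M) (- d k)%:C%C * (z t ^+ (N + k) * (Uh t)%:C%C) =
    (Wh t ^+ r)%:C%C + H t.
  rewrite /H /comb mulrBr mulrA -exprMn z_zb expr1n mul1r addrA [_ + (1 - _)]addrC subrK.
  congr (_ + _); rewrite mulr_sumr -sumrN; apply: eq_bigr => k _.
  by rewrite rcN exprD; ring.
have cH : C1c H.
  have h := C1c_D (C1c_D (C1c_cst 1) cs) (C1c_M (C1c_cst (-1)) cW).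
  by apply: C1c_ext h _ => t; rewrite E; ring.
have Ecf : (m == 0)%:R - \sum_(k < M) d k * Uc `|m - (N + k)%N%:Z|%N =
    cf (fun t => (Wh t ^+ r)%:C%C) m + cf H m.
  rewrite -cf_D; [|exact: C1c_cc|exact: C1c_cc].
  rewrite -(cf_ext _ E) cf_D; [|exact: cc_cst|exact: C1c_cc].
  rewrite cf_1; congr (_ + _).
  rewrite (@cf_sum R M (fun k => - d k) (fun k t => z t ^+ (N + k) * (Uh t)%:C%C)); last first.
    by move=> k; exact: C1c_cc.
  by rewrite -sumrN; apply: eq_bigr => k _; rewrite cf_zU mulNr.
have b1 : `|cf H m| <= 2 * (e1 / 4).
  by apply: cf_bound; [exact: C1c_cc|case: hH => F' []].
have b2 := cf_bound1 m cH hH.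
have b3 := cf_W_bound r m; have b4 := hr m.
rewrite Ecf; split.
  by apply: le_trans (ler_normD _ _) _; clear -b1 b4 e1e; lra.
rewrite mulrDr; apply: le_trans (ler_normD _ _) _; clear -b2 b3 e11; lra.
Qed.

End FourierApprox.

(** * Series over the integers and their invariance under shifts *)

Section TwoSided.
Context (R : realType).
Implicit Types (u v : int -> R) (C l : R) (m : int).

(* The index i of the one-sided series carries the integers i and - i - 1. *)
Definition zs u (i : nat) := u (Posz i) + u (Negz i).
Definition zsums u l := sums (zs u) l.
Definition zq C u := forall m, `|u m| <= C * wt R `|m|%N.

Lemma wt_le1 n : wt R n.+1 <= wt R n.
Proof. by rewrite /wt lef_pV2 ?posrE ?ltr0n ?muln_gt0// ler_nat leq_mul. Qed.

Lemma wt_inv n : wt R n <= n.+1%:R^-1.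
Proof. by rewrite /wt lef_pV2 ?posrE ?ltr0n ?muln_gt0// ler_nat leq_pmulr. Qed.

Lemma zq_ge0 C u : zq C u -> 0 <= C.
Proof.
move=> /(_ 0) h; have := le_trans (normr_ge0 _) h.
by rewrite pmulr_lge0// wt_gt0.
Qed.

Lemma zq_qs C u : zq C u -> qs (2 * C) (zs u).
Proof.
move=> h i; have C0 := zq_ge0 h.
apply: le_trans (ler_normD _ _) _; rewrite -mulrA mulr_natl mulr2n.
apply: lerD; first by have := h (Posz i).
apply: le_trans (h (Negz i)) _; apply: ler_wpM2l => //.
by rewrite NegzE abszN; exact: wt_le1.
Qed.

Lemma zq_zsums C u : zq C u -> zsums u (Ssum (zs u)).
Proof. by move=> /zq_qs /qs_sums. Qed.

Lemma zsums_D u v l l' : zsums u l -> zsums v l' -> zsums (fun m => u m + v m) (l + l').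
Proof.
move=> h h'; have := sums_D h h'; rewrite /zsums; congr (sums _ _).
by apply: funext => i; rewrite /zs addrACA.
Qed.

Lemma zsums_Z u l (k : R) : zsums u l -> zsums (fun m => k * u m) (k * l).
Proof.
move=> h; have := sums_Z k h; rewrite /zsums; congr (sums _ _).
by apply: funext => i; rewrite /zs mulrDr.
Qed.

Lemma zsums_B u v l l' : zsums u l -> zsums v l' -> zsums (fun m => u m - v m) (l - l').
Proof.
move=> h h'; have := zsums_D h (zsums_Z (-1) h'); rewrite mulN1r.
by congr (zsums _ _); apply: funext => m; rewrite mulN1r.
Qed.

Lemma zsums_ext u v l : zsums u l -> u =1 v -> zsums v l.
Proof. by move=> h /funext <-. Qed.

Lemma zsums0 : zsums (fun=> 0) 0.
Proof.
exists 0 => N; rewrite big1 ?subrr ?normr0 ?mul0r//.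
by move=> i _; rewrite /zs addr0.
Qed.

Lemma zsums_lin M (d : nat -> R) (u : nat -> int -> R) (l : nat -> R) :
  (forall k, zsums (u k) (l k)) ->
  zsums (fun m => \sum_(k < M) d k * u k m) (\sum_(k < M) d k * l k).
Proof.
move=> h; elim: M => [|M IH].
  by rewrite big_ord0; apply: zsums_ext zsums0 _ => m; rewrite big_ord0.
rewrite big_ord_recr/=; apply: zsums_ext (zsums_D IH (zsums_Z (d M) (h M))) _ => m.
by rewrite big_ord_recr.
Qed.

Lemma zsums_le u v l l' : zsums u l -> zsums v l' -> (forall m, `|u m| <= v m) ->
  `|l| <= l'.
Proof.
move=> h h' uv; rewrite ler_norml; apply/andP; split.
  rewrite -subr_ge0 opprK; apply: sums_ge0 (zsums_D h h') => n.
  have uv' m : 0 <= v m + u m by have := uv m; rewrite ler_norml -subr_ge0 opprK addrC => /andP[].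
  by apply: addr_ge0; rewrite addrC.
rewrite -subr_ge0; apply: sums_ge0 (zsums_B h' h) => n.
by apply: addr_ge0; rewrite subr_ge0; exact: le_trans (ler_norm _) (uv _).
Qed.

Lemma zsums_bound C u l : zq C u -> zsums u l -> `|l| <= 2 * C.
Proof. by move=> /zq_qs h; exact: sums_bound. Qed.

Lemma zsums_single u l : (forall m, m != 0 -> u m = 0) -> zsums u l -> l = u 0.
Proof.
move=> h hl; have := sums_single _ hl => /(_ 0%N) ->.
  by rewrite /zs (h (Negz 0))// addr0.
by case=> // n _; rewrite /zs !h// addr0.
Qed.

Lemma zsums_delta C u : zq C u -> zsums (fun m => (m == 0)%:R * u m) (u 0).
Proof.
move=> h; have C0 := zq_ge0 h.
have hq : zq C (fun m => (m == 0)%:R * u m).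
  move=> m; rewrite normrM normr_nat; case: (m == 0); first by rewrite mul1r.
  by rewrite mul0r mulr_ge0// ltW// wt_gt0.
have hs := zq_zsums hq.
have E := zsums_single _ hs.
rewrite -[u 0]mul1r -[1]/((0 == 0 :> int)%:R) -E//.
by move=> m /negbTE ->; rewrite mul0r.
Qed.

Lemma wt_step (p q : nat) : (q <= p.+1)%N -> wt R p <= 3 * wt R q.
Proof.
move=> h; rewrite /wt ler_pdivlMr ?ltr0n ?muln_gt0// mulrC ler_pdivrMr ?ltr0n ?muln_gt0// -natrM ler_nat.
have h1 : (q.+1 * q.+2 <= p.+2 * p.+3)%N by rewrite leq_mul.
apply: leq_trans h1 _; nia.
Qed.

Lemma zq_pred C u : zq C u -> zq (3 * C) (fun m => u (m - 1)).
Proof.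
move=> h m; have C0 := zq_ge0 h; apply: le_trans (h _) _.
rewrite [3 * C]mulrC -mulrA; apply: ler_wpM2l => //; apply: wt_step; lia.
Qed.

Lemma zq_succ C u : zq C u -> zq (3 * C) (fun m => u (m + 1)).
Proof.
move=> h m; have C0 := zq_ge0 h; apply: le_trans (h _) _.
rewrite [3 * C]mulrC -mulrA; apply: ler_wpM2l => //; apply: wt_step; lia.
Qed.

(** A partial sum runs over the integers from - n to n - 1, so a shift by one changes it by two
    boundary terms, each of order 1 / n. *)
Lemma zsums_pred C u l : zq C u -> zsums u l -> zsums (fun m => u (m - 1)) l.
Proof.
move=> hq [C' h]; have C0 := zq_ge0 hq; exists (C' + 2 * C) => n.
have -> : \sum_(i < n) zs (fun m => u (m - 1)) i =
    \sum_(i < n) zs u i + (u (Negz n) - u (n%:Z - 1)).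
  elim: n => [|n IH]; first by rewrite !big_ord0 add0r subrr.
  rewrite !big_ord_recr/= IH /zs.
  have -> : Negz n - 1 = Negz n.+1 by lia.
  have -> : n.+1%:Z - 1 = n by lia.
  ring.
rewrite opprD addrA; apply: le_trans (ler_normD _ _) _; rewrite mulrDl.
apply: lerD => //; rewrite normrN; apply: le_trans (ler_normB _ _) _.
rewrite mulr_natl mulr2n mulrDl; apply: lerD.
  apply: le_trans (hq _) _; apply: ler_wpM2l => //; rewrite NegzE abszN.
  exact: le_trans (wt_le1 _) (wt_inv _).
apply: le_trans (hq _) _; apply: ler_wpM2l => //.
case: n => [|n]; first by rewrite /wt/= lef_pV2 ?posrE// ler_nat.
have -> : `|n.+1%:Z - 1|%N = n by lia.
by rewrite /wt lef_pV2 ?posrE ?ltr0n ?muln_gt0// ler_nat leq_pmull.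
Qed.

Lemma zsums_succ C u l : zq C u -> zsums u l -> zsums (fun m => u (m + 1)) l.
Proof.
move=> hq [C' h]; have C0 := zq_ge0 hq; exists (C' + 2 * C) => n.
have -> : \sum_(i < n) zs (fun m => u (m + 1)) i =
    \sum_(i < n) zs u i + (u n%:Z - u (- n%:Z)).
  elim: n => [|n IH]; first by rewrite !big_ord0 add0r oppr0 subrr.
  rewrite !big_ord_recr/= IH /zs.
  have -> : n%:Z + 1 = n.+1 by lia.
  have -> : Negz n + 1 = - n%:Z by lia.
  by rewrite NegzE; ring.
rewrite opprD addrA; apply: le_trans (ler_normD _ _) _; rewrite mulrDl.
apply: lerD => //; rewrite normrN; apply: le_trans (ler_normB _ _) _.
rewrite mulr_natl mulr2n mulrDl; apply: lerD.
  by apply: le_trans (hq _) _; apply: ler_wpM2l => //; exact: wt_inv.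
by apply: le_trans (hq _) _; apply: ler_wpM2l => //; rewrite abszN; exact: wt_inv.
Qed.

Lemma zsums_shift u l (k : int) : (exists C, zq C u) -> zsums u l ->
  zsums (fun m => u (m - k)) l.
Proof.
move=> hq hl; suff [] : (exists C, zq C (fun m => u (m - k))) /\
  zsums (fun m => u (m - k)) l by [].
case: k => k.
  elim: k => [|k [[C h] s]].
    by split; [case: hq => C h; exists C => m; rewrite subr0|apply: zsums_ext hl _ => m; rewrite subr0].
  have E m : u (m - 1 - k%:Z) = u (m - k.+1%:Z) by congr u; lia.
  split; first by exists (3 * C) => m; rewrite -E; exact: (zq_pred h).
  by apply: zsums_ext (zsums_pred h s) _ => m; rewrite E.
elim: k => [|k [[C h] s]].
  case: hq => C h; split; first by exists (3 * C); exact: zq_succ h.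
  exact: zsums_succ h hl.
have E m : u (m + 1 - Negz k) = u (m - Negz k.+1) by congr u; lia.
split; first by exists (3 * C) => m; rewrite -E; exact: (zq_succ h).
by apply: zsums_ext (zsums_succ h s) _ => m; rewrite E.
Qed.

(** * Sums of a decaying function over a lattice *)

Section Lattice.
Variables (a : R) (a0 : 0 < a).

Definition lk : R := (2 + a^-1) ^+ 2.

(** Follows from |m| a <= |x| + |x - m a|; it converts decay of a function into decay in m of its
    values at the points x - m a. *)
Lemma lattice_le (x : R) m : (`|m|%N.+2)%:R <=
  (2 + a^-1) * (1 + `|x|) * (1 + `|x - m%:~R * a|).
Proof.
set y := x - _; have h : `|m|%N%:R * a <= `|x| + `|y|.
  rewrite natr_absz intr_norm -[X in _ * X]gtr0_norm// -normrM.
  have -> : m%:~R * a = x - y by rewrite /y; ring.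
  exact: ler_normB.
have h1 : `|m|%N%:R <= (`|x| + `|y|) / a by rewrite ler_pdivlMr.
rewrite -addn2 natrD.
apply: le_trans (_ : (2 + a^-1) * (1 + (`|x| + `|y|)) <= _).
  have : 0 <= a^-1 by rewrite invr_ge0 ltW.
  have := normr_ge0 x; have := normr_ge0 y.
  clear -h1; nra.
rewrite -mulrA ler_wpM2l//; first by rewrite addr_ge0 ?invr_ge0 ?ltW.
by have := mulr_ge0 (normr_ge0 x) (normr_ge0 y); clear; lra.
Qed.

Lemma lattice_zq (w : R -> R) (B x : R) : (forall y, (1 + `|y|) ^+ 2 * `|w y| <= B) ->
  zq (lk * (1 + `|x|) ^+ 2 * B) (fun m => w (x - m%:~R * a)).
Proof.
move=> h m; set y := x - _; rewrite /wt -[_ * _^-1]/(_ / _) ler_pdivlMr ?ltr0n ?muln_gt0//.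
have H := lattice_le x m; rewrite -/y in H.
apply: le_trans (_ : `|w y| * (`|m|%N.+2)%:R ^+ 2 <= _).
  by rewrite ler_wpM2l// -natrX ler_nat leq_mul.
apply: le_trans (_ : `|w y| * ((2 + a^-1) * (1 + `|x|) * (1 + `|y|)) ^+ 2 <= _).
  rewrite ler_wpM2l//; apply: lerXn2r => //; rewrite nnegrE//.
  exact: le_trans H.
have -> : `|w y| * ((2 + a^-1) * (1 + `|x|) * (1 + `|y|)) ^+ 2 =
  lk * (1 + `|x|) ^+ 2 * ((1 + `|y|) ^+ 2 * `|w y|) by rewrite /lk; ring.
by rewrite ler_wpM2l// mulr_ge0// ?sqr_ge0.
Qed.

(** The sum is periodic in x with period a, so x may be taken in [0, a]; this makes the bound
    uniform in x. *)
Lemma lattice_bound (w : R -> R) (B x l : R) :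
  (forall y, (1 + `|y|) ^+ 2 * `|w y| <= B) ->
  zsums (fun m => w (x - m%:~R * a)) l -> `|l| <= 2 * (lk * (1 + a) ^+ 2 * B).
Proof.
move=> h hl; have B0 : 0 <= B.
  by apply: le_trans (h 0); rewrite mulr_ge0// sqr_ge0.
pose k := Num.floor (x / a).
have /andP[k1 k2] := floor_itv (x / a).
rewrite -/k in k1 k2.
pose y := x - k%:~R * a.
have y0 : 0 <= y by rewrite subr_ge0 -ler_pdivlMr.
have y1 : y <= a.
  by move: k2; rewrite ltr_pdivrMr// intrD mulrDl mul1r /y => /ltW; lra.
have hs : zsums (fun m => w (y - m%:~R * a)) l.
  have := zsums_shift (- k) (ex_intro (fun C => zq C _) _ (lattice_zq x h)) hl.
  move/zsums_ext; apply => m; congr w; rewrite opprK intrD /y; ring.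
apply: le_trans (zsums_bound (lattice_zq y h) hs) _.
apply: ler_wpM2l => //; apply: ler_wpM2r => //; apply: ler_wpM2l; first exact: sqr_ge0.
rewrite (ger0_norm y0); have a1 := ltW a0.
by apply: lerXn2r; rewrite ?lerD2l// nnegrE addr_ge0.
Qed.

End Lattice.
End TwoSided.

(** * The function g, and the approximation of the Gaussian by its lattice translates *)

Section Generator.
Context (R : realType).
Variables (a : R) (a0 : 0 < a).
Implicit Types (x y h : R) (m : int).

(** Derivatives of the Gaussian stay in the span of these functions. At j = 0 the index [j.-1] in
    their derivatives is harmless, its coefficient being 0. *)
Definition hg (j : nat) y : R := y ^+ j * expR (- y ^+ 2).

Lemma der_hg j : der (hg j) (fun y => j%:R * hg j.-1 y - 2 * hg j.+1 y).
Proof.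
have h1 := der_X j (@der_id R).
have h2 := der_comp (@der_exp R) (der_Z (-1) (der_X 2 (@der_id R))).
have E y : expR (-1 * y ^+ 2) = expR (- y ^+ 2) by rewrite mulN1r.
apply: der_ext (der_M h1 h2) _ _ => y; rewrite /hg E//.
set w := expR _; have -> : y ^+ 2.-1 = y by [].
by rewrite [y ^+ j.+1]exprS; ring.
Qed.

Lemma one_plus_pow (t : R) n : 0 <= t -> (1 + t) ^+ n <= 2 ^+ n * (1 + t ^+ n).
Proof.
move=> t0; have [t1|t1] := leP t 1.
  apply: le_trans (_ : 2 ^+ n * 1 <= _).
    by rewrite mulr1; apply: lerXn2r; rewrite ?nnegrE ?addr_ge0//; clear -t1; lra.
  by rewrite ler_wpM2l ?exprn_ge0// lerDl exprn_ge0.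
apply: le_trans (_ : 2 ^+ n * t ^+ n <= _); last by rewrite ler_wpM2l ?exprn_ge0// lerDr.
by rewrite -exprMn; apply: lerXn2r; rewrite ?nnegrE ?addr_ge0 ?mulr_ge0//; clear -t1; lra.
Qed.

Lemma hg_bound j k : exists B, forall y, (1 + `|y|) ^+ k * `|hg j y| <= B.
Proof.
exists (2 ^+ (j + k) * (1 + (1 + ((j + k).+1)`!%:R))) => y.
have e0 := expR_gt0 (- y ^+ 2).
rewrite /hg normrM (gtr0_norm e0) normrX mulrA.
apply: le_trans (_ : (1 + `|y|) ^+ (j + k) * expR (- y ^+ 2) <= _).
  rewrite ler_wpM2r ?(ltW e0)// addnC exprD ler_wpM2l ?exprn_ge0 ?addr_ge0//.
  by apply: lerXn2r; rewrite ?nnegrE ?addr_ge0// lerDr.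
apply: le_trans (_ : 2 ^+ (j + k) * (1 + `|y| ^+ (j + k)) * expR (- y ^+ 2) <= _).
  by rewrite ler_wpM2r ?(ltW e0)// one_plus_pow.
rewrite -mulrA ler_wpM2l ?exprn_ge0// mulrDl mul1r; apply: lerD.
  by rewrite -expR0 ler_expR oppr_le0 sqr_ge0.
exact: exp_poly_bound.
Qed.

Lemma hg_bounded j : exists B, forall y, `|hg j y| <= B.
Proof.
by have [B h] := hg_bound j 0; exists B => y; have := h y; rewrite expr0 mul1r.
Qed.

Lemma hg_quad j : exists B, forall y h,
  `|hg j (y + h) - hg j y - h * (j%:R * hg j.-1 y - 2 * hg j.+1 y)| <= B * h ^+ 2.
Proof.
have d2 := der_B (der_Z j%:R (der_hg j.-1)) (der_Z 2 (der_hg j.+1)).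
have [B1 h1] := hg_bounded j.-1.-1; have [B2 h2] := hg_bounded j.-1.+1.
have [B3 h3] := hg_bounded j; have [B4 h4] := hg_bounded j.+2.
exists (j%:R * (j.-1%:R * B1 + 2 * B2) + 2 * (j.+1%:R * B3 + 2 * B4)) => y h.
apply: quad_der2 (der_hg j) d2 _ => t.
apply: le_trans (ler_normB _ _) _; apply: lerD; rewrite normrM normr_nat ler_wpM2l//.
  by apply: le_trans (ler_normB _ _) _; apply: lerD; rewrite normrM normr_nat ler_wpM2l.
by apply: le_trans (ler_normB _ _) _; apply: lerD; rewrite normrM normr_nat ler_wpM2l.
Qed.

Lemma rap_Uc : rap (@Uc R).
Proof.
apply: (@rap_le _ _ _ 1 (@rap_cU R)) => n.
rewrite mul1r /cU /Uc [leRHS]normrM ler_peMl//.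
by case: (n == 0); rewrite ger0_norm// ler1n.
Qed.

Lemma Uc_ge0 n : 0 <= @Uc R n. Proof. exact: sqr_ge0. Qed.

Lemma Uc_zq (C B : R) (w : int -> R) : qs C (@Uc R) -> (forall m, `|w m| <= B) ->
  zq (C * B) (fun m => @Uc R `|m|%N * w m).
Proof.
by move=> hC hB m; rewrite normrM mulrAC; apply: ler_pM.
Qed.

(** [gen 0] is the function g of the theorem; the other [gen j] express its derivatives. *)
Definition gen (j : nat) x : R :=
  Ssum (zs (fun m => @Uc R `|m|%N * hg j (x - m%:~R * a))).

Lemma gen_sums j x : zsums (fun m => @Uc R `|m|%N * hg j (x - m%:~R * a)) (gen j x).
Proof.
have [C hC] := rap_bound rap_Uc; have [B hB] := hg_bounded j.
exact: zq_zsums (Uc_zq hC (fun m => hB _)).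
Qed.

Lemma der_gen j : der (gen j) (fun x => j%:R * gen j.-1 x - 2 * gen j.+1 x).
Proof.
have [C hC] := rap_bound rap_Uc; have [B hB] := hg_quad j.
apply: der_quad => x; exists (2 * (C * B)) => h.
have s := zsums_B (zsums_B (gen_sums j (x + h)) (gen_sums j x))
  (zsums_Z h (zsums_B (zsums_Z j%:R (gen_sums j.-1 x)) (zsums_Z 2 (gen_sums j.+1 x)))).
have -> : 2 * (C * B) * h ^+ 2 = 2 * (C * (B * h ^+ 2)) by ring.
apply: zsums_bound s => m; apply: le_trans (Uc_zq (w := fun m => hg j (x - m%:~R * a + h) - hg j (x - m%:~R * a)
  - h * (j%:R * hg j.-1 (x - m%:~R * a) - 2 * hg j.+1 (x - m%:~R * a))) hC _ m);
  last by move=> k; exact: hB.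
rewrite le_eqVlt; apply/orP; left; apply/eqP; congr `|_|.
rewrite -[x + h - _]addrAC; ring.
Qed.

Lemma prod3_le (p q r : R) : 0 <= p -> 0 <= q -> 0 <= r ->
  p + r * q <= (1 + p) * (1 + q) * (r + 1).
Proof.
move=> p0 q0 r0; have := mulr_ge0 p0 q0; have := mulr_ge0 p0 r0; have := mulr_ge0 q0 r0.
by have := mulr_ge0 (mulr_ge0 p0 q0) r0; clear -p0 q0 r0; lra.
Qed.

(** With y = x - m a, |x| is at most (1 + |y|) (1 + a) (|m| + 1): a power of x is shared between the
    Gaussian at y and the rapid decay of U_|m|. *)
Lemma gen_decay j k : exists M, forall x, `|x ^+ k * gen j x| <= M.
Proof.
have [C hC] := rap_qs k rap_Uc; have [B hB] := hg_bound j k.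
exists (2 * (C * ((1 + a) ^+ k * B))) => x.
apply: zsums_bound (zsums_Z (x ^+ k) (gen_sums j x)) => m.
set y := x - _; have B0 : 0 <= B.
  by apply: le_trans (hB y); rewrite mulr_ge0// exprn_ge0// addr_ge0.
have xy : `|x| <= (1 + `|y|) * (1 + a) * (`|m|%N.+1)%:R.
  have -> : x = y + m%:~R * a by rewrite /y; ring.
  apply: le_trans (ler_normD _ _) _; rewrite normrM (gtr0_norm a0).
  rewrite -intr_norm -natr_absz -natr1.
  exact: prod3_le (normr_ge0 y) (ltW a0) (ler0n _ _).
rewrite normrM normrX [`|Uc _ _ * _|]normrM.
apply: le_trans (_ : ((1 + `|y|) * (1 + a) * (`|m|%N.+1)%:R) ^+ k *
    (`|@Uc R `|m|%N| * `|hg j y|) <= _).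
  by rewrite ler_wpM2r ?mulr_ge0//; apply: lerXn2r; rewrite ?nnegrE// (le_trans _ xy).
have -> : ((1 + `|y|) * (1 + a) * (`|m|%N.+1)%:R) ^+ k * (`|@Uc R `|m|%N| * `|hg j y|) =
  ((`|m|%N.+1)%:R ^+ k * `|@Uc R `|m|%N|) * ((1 + a) ^+ k * ((1 + `|y|) ^+ k * `|hg j y|)).
  by rewrite !exprMn; ring.
rewrite [leRHS]mulrAC; apply: ler_pM.
- by rewrite mulr_ge0// exprn_ge0.
- by rewrite !mulr_ge0// exprn_ge0// addr_ge0// ltW.
- by apply: le_trans (hC _); exact: ler_norm.
- by rewrite ler_wpM2l// exprn_ge0// addr_ge0// ltW.
Qed.

Inductive gcls : (R -> R) -> Prop :=
| gcls_b j : gcls (gen j)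
| gcls_D f g : gcls f -> gcls g -> gcls (fun x => f x + g x)
| gcls_Z k f : gcls f -> gcls (fun x => k * f x).

Lemma gcls_der f : gcls f -> exists2 f', gcls f' & der f f'.
Proof.
elim=> [j|{}f g _ [f' c1 d1] _ [g' c2 d2]|k {}f _ [f' c1 d1]].
- exists (fun x => j%:R * gen j.-1 x + (- 2) * gen j.+1 x).
    by apply: gcls_D; apply: gcls_Z; exact: gcls_b.
  by apply: der_ext (der_gen j) _ _ => // x; rewrite mulNr.
- by exists (fun x => f' x + g' x); [exact: gcls_D|exact: der_D].
- by exists (fun x => k * f' x); [exact: gcls_Z|exact: der_Z].
Qed.

Lemma gcls_decay k f : gcls f -> exists M, forall x, `|x ^+ k * f x| <= M.
Proof.
elim=> [j|{}f g _ [M1 h1] _ [M2 h2]|c {}f _ [M h]]; first exact: gen_decay.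
- exists (M1 + M2) => x; rewrite mulrDr; apply: le_trans (ler_normD _ _) _.
  exact: lerD.
- by exists (`|c| * M) => x; rewrite mulrCA normrM ler_wpM2l.
Qed.

Lemma gcls_derive1n k f : gcls f -> gcls (derive1n k f).
Proof.
move=> hf; elim: k => [|k IH]; first exact: hf.
have [f' c d] := gcls_der IH.
suff -> : derive1n k.+1 f = f' by [].
by apply/funext => x; rewrite derive1nS derive1E (@derive_val _ _ _ _ _ _ _ (d x)).
Qed.

Lemma schwartz_gen : schwartz (gen 0).
Proof.
split=> [k x|m k]; last exact: gcls_decay (gcls_derive1n k (gcls_b 0)).
by have [f' _ d] := gcls_der (gcls_derive1n k (gcls_b 0)); exact: (@ex_derive _ _ _ _ _ _ _ (d x)).
Qed.

Lemma gen0_ge0 x : 0 <= gen 0 x.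
Proof.
apply: sums_ge0 (gen_sums 0 x) => n.
by rewrite addr_ge0// mulr_ge0 ?Uc_ge0// /hg mul1r expR_ge0.
Qed.

Definition gauss (x : R) : R := expR (- x ^+ 2).

Lemma hg0 x : hg 0 x = gauss x. Proof. by rewrite /hg mul1r. Qed.

(** Translating g by k a shifts its coefficient sequence by k, the counterpart of multiplying Uh by
    z^k. *)
Lemma gen_translate (k : nat) x :
  zsums (fun m => @Uc R `|m - k%:Z|%N * gauss (x - m%:~R * a)) (gen 0 (x - k%:R * a)).
Proof.
have [C hC] := rap_bound rap_Uc; have [B hB] := hg_bounded 0.
have q := Uc_zq hC (fun m => hB (x - k%:R * a - m%:~R * a)).
have := zsums_shift k%:Z (ex_intro (fun C => zq C _) _ q) (gen_sums 0 (x - k%:R * a)).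
move/zsums_ext; apply => m; rewrite hg0; congr (_ * gauss _).
by rewrite rmorphB/= -pmulrn; ring.
Qed.

(* As C does not depend on N and e, this is convergence in L^p for every p > 1 (not p = 1). *)
Lemma gauss_approx : exists C, forall (N : nat) e, 0 < e ->
  exists M (d : nat -> R), forall x,
    `|gauss x - \sum_(k < M) d k * gen 0 (x - (N + k)%:R * a)| <= e /\
    (1 + `|x|) * `|gauss x - \sum_(k < M) d k * gen 0 (x - (N + k)%:R * a)| <= C.
Proof.
(* The factor 1 + |x| is at most (1 + |y|) (1 + |m| a) with y = x - m a. The first part is absorbed
   in [ph]; the second meets |beta m| <= 1 and |m beta m| <= 3, whence the constant 1 + 3 a. *)
pose ph y := (1 + `|y|) * gauss y.
have ph0 y : 0 <= ph y by rewrite mulr_ge0 ?expR_ge0// addr_ge0.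
have [B1 hB1] := hg_bound 0 2; have [B2 hB2] := hg_bound 0 3.
have gB y : (1 + `|y|) ^+ 2 * `|gauss y| <= B1 by rewrite -hg0.
have pB y : (1 + `|y|) ^+ 2 * `|ph y| <= B2.
  rewrite /ph normrM ger0_norm ?addr_ge0// mulrA -exprSr -hg0; exact: hB2.
pose S1 := 2 * (lk a * (1 + a) ^+ 2 * B1); pose S2 := 2 * (lk a * (1 + a) ^+ 2 * B2).
have S1b x := lattice_bound a0 gB (zq_zsums (lattice_zq a0 x gB)).
have S2b x := lattice_bound a0 pB (zq_zsums (lattice_zq a0 x pB)).
have S10 : 0 <= S1 := le_trans (normr_ge0 _) (S1b 0).
have S20 : 0 <= S2 := le_trans (normr_ge0 _) (S2b 0).
exists ((1 + 3 * a) * S2) => N e e0.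
have S11 : 0 < S1 + 1 by rewrite ltr_wpDl.
have [e1 [e10 e1e e11]] := min2_ex (divr_gt0 e0 S11) (@ltr01 R).
have [M [d hd]] := @coef_approx R N e1 e10.
exists M, d => x.
pose beta m : R := (m == 0)%:R - \sum_(k < M) d k * Uc R `|m - (N + k)%N%:Z|%N.
have hbeta m : `|beta m| <= e1 /\ `|m%:~R * beta m| <= 3 := hd m.
have hs : zsums (fun m => beta m * gauss (x - m%:~R * a))
    (gauss x - \sum_(k < M) d k * gen 0 (x - (N + k)%:R * a)).
  have s1 := zsums_delta (lattice_zq a0 x gB).
  have s2 := zsums_lin M d (fun k => gen_translate (N + k) x).
  rewrite mul0r subr0 in s1.
  apply: zsums_ext (zsums_B s1 s2) _ => m; rewrite /beta mulrBl; congr (_ - _).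
  by rewrite mulr_suml; apply: eq_bigr => k _; rewrite mulrA.
split.
  apply: le_trans (zsums_le hs (zsums_Z e1 (zq_zsums (lattice_zq a0 x gB))) _) _.
    move=> m; rewrite normrM [`|gauss _|]ger0_norm ?expR_ge0// ler_wpM2r ?expR_ge0//.
    by case: (hbeta m).
  apply: le_trans (ler_wpM2l (ltW e10) (le_trans (ler_norm _) (S1b x))) _.
  apply: le_trans (ler_wpM2r S10 e1e) _.
  by rewrite mulrAC ler_pdivrMr// ler_wpM2l ?(ltW e0)// lerDl.
have -> : (1 + `|x|) * `|gauss x - \sum_(k < M) d k * gen 0 (x - (N + k)%:R * a)| =
  `|(1 + `|x|) * (gauss x - \sum_(k < M) d k * gen 0 (x - (N + k)%:R * a))|.
  by rewrite normrM [`|1 + _|]ger0_norm// addr_ge0.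
have k0 : 0 <= 1 + 3 * a by rewrite addr_ge0// mulr_ge0// ltW.
apply: le_trans (zsums_le (zsums_Z (1 + `|x|) hs)
  (zsums_Z (1 + 3 * a) (zq_zsums (lattice_zq a0 x pB))) _) _; last first.
  by rewrite ler_wpM2l//; exact: le_trans (ler_norm _) (S2b x).
move=> m; rewrite normrM [`|1 + _|]ger0_norm ?addr_ge0//.
set y := x - _; have xy : 1 + `|x| <= (1 + `|y|) * (1 + `|m%:~R : R| * a).
  have -> : x = y + m%:~R * a by rewrite /y; ring.
  have := ler_normD y (m%:~R * a); rewrite [`|m%:~R * a|]normrM (gtr0_norm a0).
  have := mulr_ge0 (normr_ge0 y) (mulr_ge0 (normr_ge0 (m%:~R : R)) (ltW a0)).
  by clear; set q := `|m%:~R|; set p := `|y|; lra.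
rewrite normrM [`|gauss y|]ger0_norm ?expR_ge0// /ph mulrA.
apply: le_trans (_ : (1 + `|y|) * (1 + `|m%:~R : R| * a) * `|beta m| * gauss y <= _).
  by rewrite ler_wpM2r ?expR_ge0// ler_wpM2r.
rewrite [leRHS]mulrA ler_wpM2r ?expR_ge0//.
rewrite -mulrA [leRHS]mulrC ler_wpM2l ?addr_ge0//.
have [b1 b2] := hbeta m; rewrite normrM in b2.
rewrite mulrDl mul1r; apply: lerD; first exact: le_trans e11.
by rewrite mulrAC ler_wpM2r// ltW.
Qed.

End Generator.

(** * Kronecker's theorem and the construction of the sequence *)

Section Kronecker.
Context (R : realType).
Implicit Types (x y e mu : R) (m : int).

Definition fpart x : R := x - (Num.floor x)%:~R.

Lemma fpart_itv x : 0 <= fpart x < 1.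
Proof.
have /andP[h1 h2] := floor_itv x.
by rewrite subr_ge0 h1/= ltrBlDl -intrD1.
Qed.

Lemma bin_lt (K : nat) x : (0 < K)%N -> (`|Num.floor (K%:R * fpart x)|%N < K)%N.
Proof.
move=> K0; have /andP[h1 h2] := fpart_itv x.
have p : 0 <= K%:R * fpart x by rewrite mulr_ge0.
have f0 : 0 <= Num.floor (K%:R * fpart x) by rewrite floor_ge0.
suff : Num.floor (K%:R * fpart x) < K%:Z by lia.
rewrite -(ltr_int R); apply: le_lt_trans (Num.Theory.floor_le _) _.
by rewrite -pmulrn gtr_pMr// ltr0n.
Qed.

Lemma pigeon (K : nat) (t : R) : (0 < K)%N ->
  exists (i j : nat), (i < j)%N /\ `|fpart (j%:R * t) - fpart (i%:R * t)| < K%:R^-1.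
Proof.
move=> K0; pose f (i : 'I_K.+1) : 'I_K := Ordinal (bin_lt (i%:R * t) K0).
have : ~ injective f.
  by move=> /leq_card; rewrite !card_ord ltnn.
move=> ninj; have [i [j [ij fij]]] : exists i j : 'I_K.+1, (i < j)%N /\ f i = f j.
  apply: contra_notP ninj => h i j fij; apply: contra_notP h => /eqP ij.
  have : (i != j :> nat) by [].
  by rewrite neq_ltn => /orP[ij'|ij']; [exists i, j|exists j, i].
exists i, j; split => //; move: fij => /(congr1 val)/=.
set x := fpart (i%:R * t); set y := fpart (j%:R * t).
have /andP[x0 _] := fpart_itv (i%:R * t); have /andP[y0 _] := fpart_itv (j%:R * t).
have Kp : 0 < K%:R :> R by rewrite ltr0n.
have px : 0 <= K%:R * x by rewrite mulr_ge0// ltW.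
have py : 0 <= K%:R * y by rewrite mulr_ge0// ltW.
have fx : 0 <= Num.floor (K%:R * x) by rewrite floor_ge0.
have fy : 0 <= Num.floor (K%:R * y) by rewrite floor_ge0.
move=> E; have {}E : Num.floor (K%:R * x) = Num.floor (K%:R * y) by lia.
have /andP[h1 h2] := floor_itv (K%:R * x).
have /andP[h3 h4] := floor_itv (K%:R * y).
rewrite E in h1 h2; rewrite intrD1 in h2; rewrite intrD1 in h4.
rewrite -(ltr_pM2l Kp) divff ?gt_eqF// -[X in X * _]gtr0_norm// -normrM mulrBr.
by rewrite ltr_norml; apply/andP; clear -h1 h2 h3 h4; split; lra.
Qed.

Variables (a b : R) (a0 : 0 < a) (b0 : 0 < b) (ab : rat_lin_indep2 a b).

(** Dirichlet's pigeonhole on the fractional parts of the multiples of b / a; rational independence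
    keeps the combination nonzero. *)
Lemma small_comb e : 0 < e -> exists (n : nat) m,
  let d := n%:R * b - m%:~R * a in d != 0 /\ `|d| < e.
Proof.
move=> e0; have ae : 0 <= a / e by rewrite divr_ge0// ltW.
have := archi_boundP ae; set K := Num.bound _ => hK.
have K0 : (0 < K)%N by rewrite -(ltr0n R); exact: le_lt_trans hK.
have [i [j [ij h]]] := pigeon (b / a) K0.
exists (j - i)%N, (Num.floor (j%:R * (b / a)) - Num.floor (i%:R * (b / a))).
move=> d; split.
  apply/eqP => d0.
  have := ab (q := (- (Num.floor (j%:R * (b / a)) - Num.floor (i%:R * (b / a))))%:~R)
    (r := (j - i)%:R).
  rewrite ratr_int ratr_nat mulrNz mulNr addrC => /(_ d0) [_ /eqP].
  by rewrite pnatr_eq0 subn_eq0 leqNgt ij.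
have -> : d = a * (fpart (j%:R * (b / a)) - fpart (i%:R * (b / a))).
  rewrite /d /fpart natrB ?(ltnW ij)// rmorphB/=.
  by field; exact: lt0r_neq0.
rewrite normrM gtr0_norm//.
apply: lt_trans (_ : a * K%:R^-1 < e); first by rewrite ltr_pM2l.
by rewrite ltr_pdivrMr ?ltr0n// mulrC -ltr_pdivrMr.
Qed.

(** Start at q0 b - s L a, where s is the sign of d and L is so large that mu lies on the side to
    which d points; repeated addition of d then passes within |d| of mu. Each addition raises the
    coefficient of b, so it stays at least q0. *)
Lemma kronecker mu e (q0 : nat) : 0 < e -> exists (q : nat) m,
  (q0 <= q)%N /\ `|m%:~R * a + q%:R * b - mu| < e.
Proof.
move=> e0; have [n [m [dn0 de]]] := small_comb e0.
set d := _ - _ in dn0 de.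
have := archi_boundP (normr_ge0 ((mu - q0%:R * b) / a)).
set L := Num.bound _ => hL.
have hL' : `|mu - q0%:R * b| < L%:R * a.
  by move: hL; rewrite normrM normfV (gtr0_norm a0) ltr_pdivrMr.
pose s : int := if 0 < d then 1 else -1.
have sd : s%:~R * d = `|d|.
  rewrite /s; case: ltP => h; first by rewrite mul1r gtr0_norm.
  by rewrite ler0_norm// mulN1r.
pose T := s%:~R * (mu - q0%:R * b) + L%:R * a.
have s1 : `|s%:~R : R| = 1 by rewrite /s; case: ifP => _; rewrite ?normrN normr1.
have T0 : 0 <= T.
  have : `|s%:~R * (mu - q0%:R * b)| < L%:R * a by rewrite normrM s1 mul1r.
  by rewrite ltr_norml /T => /andP[h _]; clear -h; lra.
have dp : 0 < `|d| by rewrite normr_gt0.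
pose j := `|Num.floor (T / `|d|)|%N.
have jf : Num.floor (T / `|d|) = j%:Z.
  by rewrite /j gez0_abs// floor_ge0 divr_ge0.
have /andP[h1 h2] := floor_itv (T / `|d|).
rewrite jf intrD1 -pmulrn in h1 h2.
rewrite ler_pdivlMr// in h1; rewrite ltr_pdivrMr// in h2.
exists (q0 + j * n)%N, (- (j%:Z * m) - s * L%:Z); split; first exact: leq_addr.
have ss : (s%:~R * s%:~R : R) = 1 by rewrite /s; case: ifP => _; rewrite ?mulr1 ?mulrNN ?mulr1.
have -> : (- (j%:Z * m) - s * L%:Z)%:~R * a + (q0 + j * n)%N%:R * b - mu =
    s%:~R * (j%:R * `|d| - T).
  rewrite -sd /T /d rmorphB rmorphN !rmorphM/= -!pmulrn natrD natrM.
  set S := s%:~R in ss *.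
  have -> : S * (j%:R * (S * (n%:R * b - m%:~R * a)) - (S * (mu - q0%:R * b) + L%:R * a)) =
   (S * S) * (j%:R * (n%:R * b - m%:~R * a) - (mu - q0%:R * b)) - S * L%:R * a by ring.
  by rewrite ss; ring.
rewrite normrM s1 mul1r; apply: le_lt_trans de.
rewrite ler_norml; apply/andP; rewrite mulrDl mul1r in h2; clear -h1 h2 dp; split; lra.
Qed.

(** The point reached from 0 by a word of steps, [true] standing for b. *)
Fixpoint pos (s : seq bool) : R :=
  if s is c :: s' then (if c then b else a) + pos s' else 0.

Lemma pos_cat s t : pos (s ++ t) = pos s + pos t.
Proof. by elim: s => [|c s IH]; rewrite ?add0r//= IH addrA. Qed.

Lemma pos_nseq n c : pos (nseq n c) = n%:R * (if c then b else a).
Proof. by elim: n => [|n IH]; rewrite ?mul0r//= IH -natr1; ring. Qed.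

Lemma pos_lattice s : exists p q : nat, pos s = p%:R * a + q%:R * b.
Proof.
elim: s => [|[] s [p [q IH]]]; first by exists 0, 0; rewrite !mul0r addr0.
  by exists p, q.+1; rewrite /= IH -natr1; ring.
by exists p.+1, q; rewrite /= IH -natr1; ring.
Qed.

(** A word can always be prolonged so as to meet the next requirement, and a requirement on a prefix
    is not disturbed by later letters; the union of the stages meets them all. *)
Lemma seq_extend (P : nat -> seq bool -> Prop) :
  (forall k s, exists t, P k (s ++ t)) ->
  exists f : nat -> bool, forall k, exists n, P k (mkseq f n).
Proof.
move=> h; have [F hF] := choice (fun ks : nat * seq bool => h ks.1 ks.2).
(* The additional letter makes stage k at least k long, so every letter of f is eventually
   determined; P k holds of the prefix that precedes it. *)
pose S := fix S k := if k is k'.+1 then rcons (S k' ++ F (k', S k')) true else [::].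
have Ssz k : (k <= size (S k))%N.
  elim: k => //= k IH; rewrite size_rcons size_cat ltnS.
  exact: leq_trans IH (leq_addr _ _).
have Spre j k : exists t, S (j + k)%N = S j ++ t.
  elim: k => [|k [t IH]]; first by exists [::]; rewrite addn0 cats0.
  by rewrite addnS/= IH; eexists; rewrite -cats1 -!catA; reflexivity.
pose f n := nth true (S n.+1) n.
have fS k n : (n < size (S k))%N -> f n = nth true (S k) n.
  move=> hn; rewrite /f; case: (leqP k n.+1) => [kn|kn].
    have [t] := Spre k (n.+1 - k)%N; rewrite subnKC// => ->.
    by rewrite nth_cat hn.
  have [t] := Spre n.+1 (k - n.+1)%N; rewrite subnKC; last exact: ltnW.
  by move=> ->; rewrite nth_cat Ssz.
exists f => k; exists (size (S k ++ F (k, S k))).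
suff -> : mkseq f (size (S k ++ F (k, S k))) = S k ++ F (k, S k) by exact: (hF (k, S k)).
apply: (@eq_from_nth _ true); rewrite size_mkseq// => i hi.
rewrite nth_mkseq// (fS k.+1); last by rewrite /= size_rcons ltnS ltnW.
by rewrite /= nth_rcons hi.
Qed.

(** Uniform smallness is paired with an envelope that does not shrink with e; dominated convergence
    turns the pair into smallness in L^p, for all p > 1 at once. *)
Definition gauss_approximable (C e : R) (nu : R) (N : nat) (l : nat -> R) :=
  exists c : nat -> R, forall x,
    `|gauss (x - nu) - \sum_(k < N) c k * gen a 0 (x - l k)| <= e /\
    (1 + `|x - nu|) * `|gauss (x - nu) - \sum_(k < N) c k * gen a 0 (x - l k)| <= C.

(* Steps b until m a + q b is close to mu for some integer m, then steps a through all the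
   points that [gauss_approx] needs. *)
Lemma extend_approx : exists C, forall (s : seq bool) mu e, 0 < e -> exists t nu,
  `|nu - mu| < e /\ gauss_approximable C e nu (size (s ++ t)).+1 (fun i => pos (take i (s ++ t))).
Proof.
have [C hC] := gauss_approx a0; exists C => s mu e e0.
have [p [q0 hpq]] := pos_lattice s.
have [q [m [qq0 hm]]] := kronecker mu q0 e0.
(* The integer m may be negative or below the number p of a-steps already made; shifting by N leaves
   a nonnegative number A of a-steps still to do. *)
have [N hN] : exists N : nat, p%:Z <= m + N%:Z.
  by exists (`|p%:Z - m|%N); lia.
have [M [d hd]] := hC N e e0.
pose A := `|(m + N%:Z - p%:Z)%R|%N.
have hA : A%:Z = m + N%:Z - p%:Z by rewrite /A gez0_abs// subr_ge0.
pose t := nseq (q - q0) true ++ nseq (A + M) false.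
exists t, (m%:~R * a + q%:R * b); split => //.
pose i0 := (size s + (q - q0) + A)%N.
have szt : size (s ++ t) = (i0 + M)%N by rewrite !size_cat !size_nseq /i0; lia.
have hpos k : (k <= M)%N ->
    pos (take (i0 + k) (s ++ t)) = m%:~R * a + q%:R * b + (N + k)%N%:R * a.
  move=> kM; have -> : s ++ t = (s ++ nseq (q - q0) true ++ nseq (A + k) false) ++ nseq (M - k) false.
    by rewrite /t -!catA; congr (_ ++ (_ ++ _)); rewrite -nseqD; congr (nseq _ _); lia.
  rewrite take_size_cat; last by rewrite !size_cat !size_nseq /i0; lia.
  rewrite !pos_cat !pos_nseq hpq natrB// !natrD.
  have -> : A%:R = m%:~R + N%:R - p%:R :> R.
    by rewrite [A%:R]pmulrn hA rmorphB rmorphD/= -!pmulrn.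
  ring.
(* Points before index i0, and the endpoint of the word, get the coefficient 0. *)
pose c i := if (i0 <= i)%N && (i < i0 + M)%N then d (i - i0)%N else 0.
exists c => x; set y := x - _.
have -> : \sum_(k < (size (s ++ t)).+1) c k * gen a 0 (x - pos (take k (s ++ t))) =
    \sum_(k < M) d k * gen a 0 (y - (N + k)%:R * a).
  rewrite szt -(big_mkord xpredT (fun k => c k * gen a 0 (x - pos (take k (s ++ t))))).
  rewrite (@big_cat_nat _ _ _ i0)//=; last by rewrite -addnS leq_addr.
  rewrite big_nat_cond big1 ?add0r; last first.
    by move=> i /andP[/andP[_ hi] _]; rewrite /c leqNgt hi mul0r.
  rewrite -{1}[i0]add0n big_addn -addnS [(i0 + _)%N]addnC addnK big_mkord big_ord_recr/=.
  rewrite {2}/c addnC ltnn andbF mul0r addr0; apply: eq_bigr => k _.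
  rewrite /c [(k + _)%N]addnC leq_addr ltn_add2l ltn_ord/= addnC addnK addnC hpos; last exact: ltnW.
  by congr (_ * gen a 0 _); rewrite /y; ring.
exact: hd.
Qed.

(** Allows the point nu actually visited to be replaced by a prescribed one nearby, at a cost
    compatible with both bounds of [gauss_approximable]. *)
Lemma gauss_shift : exists2 B, 0 <= B & forall y h : R, `|h| <= 1 ->
  (1 + `|y|) * `|gauss (y + h) - gauss y| <= B * `|h|.
Proof.
have [B hB] := @hg_bound R 1 1; have B0 : 0 <= B.
  by apply: le_trans (hB 0); rewrite mulr_ge0// expr1 addr_ge0.
exists (4 * B) => [|y h h1]; first by rewrite mulr_ge0.
have dg : der (@gauss R) (fun y => - 2 * hg 1 y).
  by apply: der_ext (@der_hg R 0) _ _ => x; [exact: hg0|rewrite mul0r; ring].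
have [c hc ->] := MVT_der y (y + h) dg.
have E : y + h - y = h by ring.
rewrite E in hc *; rewrite normrM mulrA ler_wpM2r//.
have yc : 1 + `|y| <= 2 * (1 + `|c|).
  have := ler_normD c (y - c); rewrite [c + _]addrC subrK [`|y - c|]distrC.
  by have := normr_ge0 c; clear -hc h1; lra.
apply: le_trans (ler_wpM2r (normr_ge0 _) yc) _.
have -> : `|-2 * hg 1 c| = 2 * `|hg 1 c| by rewrite normrM normrN normr_nat.
have := hB c; rewrite expr1.
have -> : 2 * (1 + `|c|) * (2 * `|hg 1 c|) = 4 * ((1 + `|c|) * `|hg 1 c|) by ring.
by move=> h2; rewrite ler_wpM2l.
Qed.

(** The requirements are pairs of a rational centre and a precision 1 / (j + 1), enumerated through
    their codes. An arbitrary centre is then reached by continuity of translation, which turns C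
    into 2 C + B. *)
Lemma visiting_sequence : exists lam : nat -> R,
  (forall n, lam n.+1 - lam n = a \/ lam n.+1 - lam n = b) /\
  exists C, forall mu e, 0 < e -> exists N, gauss_approximable C e mu N lam.
Proof.
have [C hC] := extend_approx.
(* A number coding no pair repeats the requirement with centre 0 and precision 1. *)
pose rq k : rat * nat := odflt (0, 0%N) (unpickle k).
pose ek j : R := j.+1%:R^-1.
pose P k s := exists nu, `|nu - ratr (rq k).1| < ek (rq k).2 /\
  gauss_approximable C (ek (rq k).2) nu (size s).+1 (fun i => pos (take i s)).
have hP k s : exists t, P k (s ++ t).
  have ekp : 0 < ek (rq k).2 by rewrite invr_gt0.
  by have [t [nu h]] := hC s (ratr (rq k).1) _ ekp; exists t, nu.
have [f hf] := seq_extend hP.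
exists (fun n => pos (mkseq f n)); split.
  move=> n; rewrite mkseqS -cats1 pos_cat/= addr0 addrC addKr.
  by case: (f n); [right|left].
have [B B0 hB] := gauss_shift.
exists (2 * C + B) => mu e e0.
have [j [j1 j2 j3]] : exists j, [/\ 2 * ek j <= 1, ek j + B * (2 * ek j) <= e & B * (2 * ek j) <= B].
  have k0 : 0 < e / (1 + 2 * B) by rewrite divr_gt0// ltr_wpDr// mulr_ge0.
  have := archi_boundP (ltW (divr_gt0 (@ltr01 R) k0)); set K := Num.bound _ => hK.
  exists (K + 1)%N.
  have ek1 : 2 * ek (K + 1)%N <= 1.
    by rewrite /ek ler_pdivrMr ?ltr0n// mul1r ler_nat; lia.
  split => //; last by rewrite ler_piMr.
  have ek2 : ek (K + 1)%N <= e / (1 + 2 * B).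
    rewrite /ek invf_ple ?posrE ?ltr0n//; apply: le_trans (_ : K%:R <= _).
      by rewrite -div1r; exact: ltW.
    by rewrite ler_nat; lia.
  have k1 : 0 < 1 + 2 * B by rewrite ltr_wpDr// mulr_ge0.
  by move: ek2; rewrite ler_pdivlMr//; clear; lra.
have [r hr] : exists r : rat, `|ratr r - mu| < ek j.
  have ejp : 0 < ek j by rewrite invr_gt0.
  have : mu - ek j < mu + ek j by clear -ejp; lra.
  move=> /rat_in_itvoo[r]; rewrite in_itv/= => /andP[h1 h2]; exists r.
  by rewrite ltr_norml; apply/andP; clear -h1 h2; split; lra.
have [n [nu []]] := hf (pickle (r, j)).
rewrite /rq pickleK/= => hnu [c hc].
exists (size (mkseq f n)).+1, c => x.
have -> : \sum_(k < (size (mkseq f n)).+1) c k * gen a 0 (x - pos (mkseq f k)) =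
  \sum_(k < (size (mkseq f n)).+1) c k * gen a 0 (x - pos (take k (mkseq f n))).
  apply: eq_bigr => k _; congr (_ * gen a 0 (_ - pos _)).
  move: (nat_of_ord k) (ltn_ord k) => i; rewrite size_mkseq ltnS => kn.
  by rewrite /mkseq -map_take take_iota (minn_idPl kn).
have [h1 h2] := hc x; set S := \sum_(k < _) _ in h1 h2 *.
have munu : `|mu - nu| <= 2 * ek j.
  have -> : mu - nu = - (nu - ratr r) - (ratr r - mu) by ring.
  apply: le_trans (ler_normB _ _) _; rewrite normrN.
  by clear -hr hnu; lra.
have munu1 : `|mu - nu| <= 1 by exact: le_trans j1.
have := hB (x - mu) _ munu1; have -> : x - mu + (mu - nu) = x - nu by ring.
move=> h3; have {}h3 : (1 + `|x - mu|) * `|gauss (x - nu) - gauss (x - mu)| <= B * (2 * ek j).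
  by apply: le_trans h3 _; rewrite ler_wpM2l.
have tri : `|gauss (x - mu) - S| <= `|gauss (x - nu) - S| + `|gauss (x - nu) - gauss (x - mu)|.
  have -> : gauss (x - mu) - S = (gauss (x - nu) - S) - (gauss (x - nu) - gauss (x - mu)) by ring.
  exact: ler_normB.
have xx : 1 + `|x - mu| <= 2 * (1 + `|x - nu|).
  have := ler_normD (x - nu) (nu - mu); rewrite addrA subrK distrC in munu1 *.
  by have := normr_ge0 (x - nu); clear -munu1; lra.
split.
  apply: le_trans tri _; apply: le_trans j2; apply: lerD => //.
  by apply: le_trans h3; rewrite ler_peMl// lerDl.
apply: le_trans (ler_wpM2l _ tri) _; first by rewrite addr_ge0.
rewrite mulrDr; apply: lerD; last exact: le_trans h3 _.
apply: le_trans (ler_wpM2r (normr_ge0 _) xx) _.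
by rewrite -mulrA ler_wpM2l.
Qed.

End Kronecker.

(** * Integrals of p-th powers and the envelope 1 / (1 + |x|) *)

Section Weight.
Context (R : realType).
Implicit Types (f h u v H : R -> R) (p C e x : R).
Local Notation mu := (@lebesgue_measure R).

(** The p-th power of the L^p norm; it is subadditive up to the factor 2^p, which is enough to work
    with closures. *)
Definition pint p f : \bar R := (\int[mu]_x (`|f x| `^ p)%:E)%E.

Lemma mpow p f : measurable_fun setT f ->
  measurable_fun setT (fun x => (`|f x| `^ p)%:E).
Proof.
move=> mf; apply/measurable_EFinP.
apply: (measurableT_comp (measurable_powR p)); exact: measurableT_comp.
Qed.

Lemma pint_ge0 p f : (0 <= pint p f)%E.
Proof. by apply: integral_ge0 => x _; rewrite lee_fin powR_ge0. Qed.

Lemma pint_le p f h : 0 <= p -> measurable_fun setT f -> measurable_fun setT h ->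
  (forall x, `|f x| <= `|h x|) -> (pint p f <= pint p h)%E.
Proof.
move=> p0 mf mh le; apply: ge0_le_integral => //.
- exact: mpow.
- exact: mpow.
- by move=> x _; rewrite lee_fin ge0_ler_powR ?nnegrE.
Qed.

Lemma pint_ext p f h : f =1 h -> pint p f = pint p h.
Proof. by move=> /funext ->. Qed.

Lemma pintZ p (k : R) f : measurable_fun setT f ->
  pint p (fun x => k * f x) = ((`|k| `^ p)%:E * pint p f)%E.
Proof.
move=> mf; rewrite /pint -ge0_integralZl_EFin//; first last.
- exact: mpow.
by apply: eq_integral => x _; rewrite normrM powRM// EFinM.
Qed.

Lemma powD_le p (s t : R) : 0 <= p -> 0 <= s -> 0 <= t ->
  (s + t) `^ p <= 2 `^ p * (s `^ p + t `^ p).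
Proof.
move=> p0; wlog st : s t / s <= t.
  move=> h s0 t0; have [st|/ltW ts] := leP s t; first exact: h.
  by rewrite addrC [_ `^ _ + _]addrC; exact: h.
move=> s0 t0; apply: le_trans (_ : (2 * t) `^ p <= _).
  by apply: ge0_ler_powR; rewrite ?nnegrE ?addr_ge0 ?mulr_ge0//; lra.
by rewrite powRM// ler_wpM2l ?powR_ge0// lerDr powR_ge0.
Qed.

Lemma pintD p f h : 0 <= p -> measurable_fun setT f -> measurable_fun setT h ->
  (pint p (fun x => f x + h x)%R <= (2 `^ p)%:E * (pint p f + pint p h))%E.
Proof.
move=> p0 mf mh.
rewrite /pint -ge0_integralD//; first last.
- exact: mpow.
- exact: mpow.
rewrite -ge0_integralZl_EFin//; first last.
- by apply: emeasurable_funD; exact: mpow.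
- by move=> x _; rewrite adde_ge0// lee_fin powR_ge0.
apply: ge0_le_integral => //.
- by apply: mpow; exact: measurable_funD.
- apply: emeasurable_funM => //; apply: emeasurable_funD; exact: mpow.
- move=> x _; rewrite -EFinD -EFinM lee_fin.
  apply: le_trans (powD_le p0 (normr_ge0 _) (normr_ge0 _)).
  by apply: ge0_ler_powR; rewrite ?nnegrE ?addr_ge0// ler_normD.
Qed.

Lemma powR_shift_der (q : R) (x : R) : 0 <= x ->
  is_derive x 1 (fun x => (1 + x) `^ q) (q * (1 + x) `^ (q - 1)).
Proof.
move=> x0; have x1 : 0 < 1 + x by rewrite ltr_wpDr.
have h1 := is_derive1_powR q x1.
have h2 : is_derive x (1 : R) (fun x : R => 1 + x) 1.
  by rewrite -[X in is_derive _ _ _ X]add0r; exact: is_deriveD.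
have := @is_derive1_comp R (fun y : R => y `^ q) (fun x => 1 + x) x _ _ h1 h2.
by rewrite mulr1.
Qed.

Definition wgt (x : R) : R := (1 + `|x|)^-1.

Lemma wgt_gt0 x : 0 < wgt x.
Proof. by rewrite invr_gt0 ltr_wpDr. Qed.

Lemma measurable_wgt : measurable_fun setT wgt.
Proof.
apply: continuous_measurable_fun => x; apply: cvgV; first by rewrite gt_eqF// ltr_wpDr.
apply: cvgD; first exact: cvg_cst.
by apply: cvg_norm; exact: cvg_id.
Qed.

Lemma continuous_wgt_pow (q : R) : continuous (fun x => (1 + `|x|) `^ q).
Proof.
move=> x; have x1 : 0 < 1 + `|x| by rewrite ltr_wpDr.
apply: (@continuous_comp _ _ _ (fun x => 1 + `|x|) (fun y : R => y `^ q)).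
  apply: cvgD; first exact: cvg_cst.
  by apply: cvg_norm; exact: cvg_id.
apply: differentiable_continuous; apply/derivable1_diffP.
exact: (@ex_derive _ _ _ _ _ _ _ (is_derive1_powR q x1)).
Qed.

Lemma cvg_wgt_pow (q : R) : 0 < q -> (1 + x) `^ (- q) @[x --> +oo] --> (0 : R).
Proof.
move=> q0; apply/cvgrPdist_lt => e e0; near=> x.
have x1 : e^-1 `^ q^-1 < 1 + x.
  rewrite -ltrBlDl; near: x; apply: nbhs_pinfty_gt; exact: num_real.
have p0 : 0 < e^-1 `^ q^-1 by rewrite powR_gt0// invr_gt0.
rewrite sub0r normrN ger0_norm ?powR_ge0// powRN.
have h : e^-1 < (1 + x) `^ q.
  have := gt0_ltr_powR q0 _ _ x1; rewrite !nnegrE -powRrM mulVf ?gt_eqF// powRr1 ?invr_ge0 ?(ltW e0)//.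
  by apply; [exact: ltW|exact: ltW (lt_trans p0 x1)].
by rewrite invf_plt ?posrE//; apply: lt_trans h; rewrite invr_gt0.
Unshelve. all: by end_near. Qed.

(** By symmetry the integral is twice that over the half-line, where the primitive (1 + x)^(1 - p) /
    (1 - p) tends to 0 at infinity because p > 1. *)
Lemma pint_wgt p : 1 < p -> (pint p wgt < +oo)%E.
Proof.
move=> p1; rewrite /pint.
rewrite (_ : (fun x => _) = (fun x => ((1 + `|x|) `^ (- p))%:E)); last first.
  apply/funext => x; rewrite (gtr0_norm (wgt_gt0 x)) /wgt -powR_inv1; last by rewrite addr_ge0.
  by rewrite -powRrM mulN1r.
have cf := @continuous_wgt_pow (- p).
rewrite (@ge0_symfun_integralT _ (fun x => (1 + `|x|) `^ (- p)))//=; last by move=> x; rewrite /= normrN.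
rewrite -set_itvcy.
pose F x := (1 - p)^-1 * (1 + x) `^ (1 - p).
have p10 : 1 - p != 0 by rewrite subr_eq0 lt_eqF.
have dF x : 0 <= x -> is_derive x 1 F ((1 + `|x|) `^ (- p)).
  move=> x0; have h := powR_shift_der (1 - p) x0.
  have -> : (1 + `|x|) `^ (- p) = (1 - p)^-1 * ((1 - p) * (1 + x) `^ (1 - p - 1)).
    rewrite mulrA mulVf// mul1r (ger0_norm x0); congr (_ `^ _); ring.
  exact: is_deriveZ.
rewrite (@ge0_continuous_FTC2y _ (fun x => (1 + `|x|) `^ (- p)) F 0 0).
- by rewrite -EFinB -EFinM ltry.
- by move=> x _; exact: powR_ge0.
- exact: continuous_subspaceT.
- have q0 : 0 < p - 1 by rewrite subr_gt0.
  rewrite -(mulr0 (1 - p)^-1); apply: cvgM; first exact: cvg_cst.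
  by rewrite -(opprB p); exact: cvg_wgt_pow.
- by move=> x x0; exact: (@ex_derive _ _ _ _ _ _ _ (dF _ (ltW x0))).
- apply: cvg_at_right_filter.
  have d0 := dF 0 (lexx _).
  apply: differentiable_continuous; apply/derivable1_diffP.
  exact: (@ex_derive _ _ _ _ _ _ _ d0).
- move=> x; rewrite in_itv/= andbT => x0; rewrite derive1E.
  exact: (@derive_val _ _ _ _ _ _ _ (dF _ (ltW x0))).
Qed.

End Weight.

(** * The closed span in L^p and dominated convergence in it *)

Section Approximable.
Context (R : realType).
Implicit Types (f h v H : R -> R) (C e x : R).
Local Notation mu := (@lebesgue_measure R).
Variables (p : R) (p1 : 1 < p) (u : nat -> R -> R).
Hypothesis mu_ : forall k, measurable_fun setT (u k).

Let p0 : 0 <= p. Proof. exact: ltW (lt_trans ltr01 p1). Qed.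

Lemma pow_cvg0 (d : nat -> R) : d @ \oo --> (0 : R) ->
  (fun n => `|d n| `^ p) @ \oo --> (0 : R).
Proof.
move=> hd; apply/cvgrPdist_lt => e e0; near=> n.
have d1 : `|d n| < 1.
  by rewrite -normrN -sub0r; near: n; exact: cvgr_dist_lt.
have de : `|d n| < e.
  by rewrite -normrN -sub0r; near: n; exact: cvgr_dist_lt.
rewrite sub0r normrN ger0_norm ?powR_ge0//; apply: le_lt_trans de.
have [->|dn0] := eqVneq (d n) 0; first by rewrite normr0 powR0// gt_eqF// (lt_trans ltr01 p1).
by apply: ge1r_powR; [rewrite normr_gt0 dn0 ltW|exact: ltW].
Unshelve. all: by end_near. Qed.

Lemma pint_dct (D : nat -> R -> R) H e : (forall n, measurable_fun setT (D n)) ->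
  (forall x, D ^~ x @ \oo --> (0 : R)) -> (forall n x, `|D n x| <= H x) ->
  measurable_fun setT H -> (pint p H < +oo)%E -> 0 < e ->
  exists n, (pint p (D n) <= e%:E)%E.
Proof.
move=> mD cD bD mH iH e0.
have H0 x : 0 <= H x := le_trans (normr_ge0 _) (bD 0%N x).
have := @dominated_convergence _ _ R mu setT measurableT
  (fun n x => (`|D n x| `^ p)%:E) (fun=> 0%:E) (fun x => (`|H x| `^ p)%:E).
case.
- by move=> n; exact: mpow.
- exact: measurable_cst.
- by apply: aeW => x _; apply: cvg_EFin; [exact: nearW|exact: pow_cvg0].
- apply/integrableP; split; first exact: mpow.
  by under eq_integral do rewrite gee0_abs ?lee_fin ?powR_ge0//.
- apply: aeW => x n _; rewrite gee0_abs ?lee_fin ?powR_ge0//.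
  by rewrite ge0_ler_powR ?nnegrE// (ger0_norm (H0 x)).
move=> _ _; rewrite integral0 => /fine_cvgP[hf hc].
near \oo => n; exists n.
have hn : (\int[mu]_x (`|D n x| `^ p)%:E)%E \is a fin_num by near: n; exact: hf.
rewrite /pint -(fineK hn) lee_fin.
have : `|0 - fine (\int[mu]_x (`|D n x| `^ p)%:E)%E| < e by near: n; exact: cvgr_dist_lt.
by rewrite sub0r normrN => /ltW; apply: le_trans; exact: ler_norm.
Unshelve. all: by end_near. Qed.

Definition ucomb (N : nat) (c : nat -> R) x := \sum_(k < N) c k * u k x.

Definition Ap f := measurable_fun setT f /\ forall e, 0 < e ->
  exists N c, (pint p (fun x => (f x - ucomb N c x)%R) <= e%:E)%E.

Lemma measurable_ucomb N c : measurable_fun setT (ucomb N c).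
Proof.
rewrite /ucomb; apply: (@measurable_sum _ _ R setT _ _ (fun (k : 'I_N) x => c k * u k x)).
by move=> k; apply: measurable_funM => //; exact: measurable_cst.
Qed.

Lemma ucomb_pad N M c x : (N <= M)%N ->
  ucomb N c x = ucomb M (fun k => if (k < N)%N then c k else 0) x.
Proof.
move=> NM; rewrite /ucomb -(big_mkord xpredT (fun k => c k * u k x)).
rewrite -(big_mkord xpredT (fun k => (if (k < N)%N then c k else 0) * u k x)).
rewrite (@big_cat_nat _ _ _ N 0 M)//= [X in _ + X]big_nat_cond [X in _ + X]big1 ?addr0.
  by apply: eq_big_nat => i /andP[_ ->].
by move=> i /andP[/andP[h _] _]; rewrite ltnNge h mul0r.
Qed.

Lemma Ap_ext f h : Ap f -> f =1 h -> Ap h.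
Proof. by move=> hf /funext <-. Qed.

Lemma Ap_ucomb N c : Ap (ucomb N c).
Proof.
split=> [|e e0]; first exact: measurable_ucomb.
exists N, c; rewrite (@pint_ext _ _ _ (fun=> 0)); last by move=> x; rewrite subrr.
rewrite /pint integral0_eq ?lee_fin ?ltW// => x _.
by rewrite normr0 powR0// gt_eqF// (lt_trans ltr01 p1).
Qed.

Lemma Ap_Z (k : R) f : Ap f -> Ap (fun x => k * f x).
Proof.
move=> [mf hf]; split=> [|e e0]; first by apply: measurable_funM => //; exact: measurable_cst.
have k0 : 0 < `|k| `^ p + 1 by rewrite ltr_wpDl ?powR_ge0.
have [N [c h]] := hf _ (divr_gt0 e0 k0); exists N, (fun i => k * c i).
rewrite (@pint_ext _ _ _ (fun x => k * (f x - ucomb N c x))); last first.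
  move=> x; rewrite mulrBr; congr (_ - _); rewrite /ucomb mulr_sumr.
  by apply: eq_bigr => i _; rewrite mulrA.
rewrite pintZ; last by apply: measurable_funB => //; exact: measurable_ucomb.
apply: le_trans (lee_wpmul2l _ h) _; first by rewrite lee_fin powR_ge0.
by rewrite -EFinM lee_fin mulrCA ler_piMr ?(ltW e0)// ler_pdivrMr// mul1r lerDl.
Qed.

Lemma two_pow : 0 < 2 `^ p * 2 :> R.
Proof. by rewrite mulr_gt0// powR_gt0. Qed.

Lemma Ap_D f h : Ap f -> Ap h -> Ap (fun x => f x + h x).
Proof.
move=> [mf hf] [mh hh]; split=> [|e e0]; first exact: measurable_funD.
have e1 : 0 < e / (2 `^ p * 2) by rewrite divr_gt0// two_pow.
have [N [c hc]] := hf _ e1; have [M [d hd]] := hh _ e1.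
exists (maxn N M), (fun k => (if (k < N)%N then c k else 0) + (if (k < M)%N then d k else 0)).
rewrite (@pint_ext _ _ _ (fun x => (f x - ucomb N c x) + (h x - ucomb M d x))); last first.
  move=> x; rewrite (ucomb_pad c x (leq_maxl N M)) (ucomb_pad d x (leq_maxr N M)).
  rewrite addrACA -opprD; congr (_ - _); rewrite /ucomb -big_split/=.
  by apply: eq_bigr => i _; rewrite mulrDl.
apply: le_trans (pintD p0 _ _) _.
- by apply: measurable_funB => //; exact: measurable_ucomb.
- by apply: measurable_funB => //; exact: measurable_ucomb.
apply: le_trans (lee_wpmul2l _ (leeD hc hd)) _; first by rewrite lee_fin powR_ge0.
rewrite -EFinD -EFinM lee_fin le_eqVlt; apply/orP; left; apply/eqP.
have := two_pow; set q := 2 `^ p => q0; field.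
by rewrite gt_eqF// -(pmulr_lgt0 _ (ltr0n R 2)).
Qed.

Lemma Ap_lim f : measurable_fun setT f ->
  (forall e, 0 < e -> exists2 h, Ap h & (pint p (fun x => (f x - h x)%R) <= e%:E)%E) -> Ap f.
Proof.
move=> mf H; split=> // e e0.
have e1 : 0 < e / (2 `^ p * 2) by rewrite divr_gt0// two_pow.
have [h [mh hh] fh] := H _ e1; have [N [c hc]] := hh _ e1.
exists N, c.
rewrite (@pint_ext _ _ _ (fun x => (f x - h x) + (h x - ucomb N c x))); last by move=> x; ring.
apply: le_trans (pintD p0 _ _) _.
- exact: measurable_funB.
- by apply: measurable_funB => //; exact: measurable_ucomb.
apply: le_trans (lee_wpmul2l _ (leeD fh hc)) _; first by rewrite lee_fin powR_ge0.
rewrite -EFinD -EFinM lee_fin le_eqVlt; apply/orP; left; apply/eqP.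
have := two_pow; set q := 2 `^ p => q0; field.
by rewrite gt_eqF// -(pmulr_lgt0 _ (ltr0n R 2)).
Qed.

Lemma Ap_0 : Ap (fun=> 0).
Proof. by apply: Ap_ext (Ap_ucomb 0 (fun=> 0)) _ => x; rewrite /ucomb big_ord0. Qed.

Lemma Ap_B f h : Ap f -> Ap h -> Ap (fun x => f x - h x).
Proof. by move=> hf hh; apply: Ap_ext (Ap_D hf (Ap_Z (-1) hh)) _ => x; rewrite mulN1r. Qed.

Lemma Ap_sum N (F : nat -> R -> R) : (forall k, Ap (F k)) -> Ap (fun x => \sum_(k < N) F k x).
Proof.
move=> h; elim: N => [|N IH]; first by apply: Ap_ext Ap_0 _ => x; rewrite big_ord0.
by apply: Ap_ext (Ap_D IH (h N)) _ => x; rewrite big_ord_recr.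
Qed.

Lemma Ap_dct (F : nat -> R -> R) f H : (forall n, Ap (F n)) ->
  (forall x, F ^~ x @ \oo --> f x) -> (forall n x, `|F n x| <= H x) ->
  measurable_fun setT H -> (pint p H < +oo)%E -> Ap f.
Proof.
move=> hF cF bF mH iH.
have mF n : measurable_fun setT (F n) by case: (hF n).
have mf : measurable_fun setT f by apply: measurable_fun_cvg mF _ => x _; exact: cF.
have fH x : `|f x| <= H x.
  by apply: (cvgr_to_le (cvg_norm (cF x))); apply: nearW => n; exact: bF.
apply: Ap_lim => // e e0.
have [|x|n x|||n hn] := @pint_dct (fun n x => f x - F n x) (fun x => 2 * H x) e _ _ _ _ _ e0.
- by move=> n; exact: measurable_funB.
- rewrite -(subrr (f x)); apply: cvgB => //; exact: cvg_cst.
- by rewrite mulr_natl mulr2n; apply: le_trans (ler_normB _ _) _; exact: lerD.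
- by apply: measurable_funM => //; exact: measurable_cst.
- rewrite pintZ//; move: iH; rewrite -ge0_fin_numE ?pint_ge0// => h.
  by rewrite -(fineK h) -EFinM ltry.
by exists (F n).
Qed.

(** The form in which most limits are taken below: pointwise convergence under a multiple of the
    envelope. *)
Lemma Ap_dctw (F : nat -> R -> R) f C : (forall n, Ap (F n)) ->
  (forall x, F ^~ x @ \oo --> f x) -> (forall n x, `|F n x| <= C * wgt x) -> Ap f.
Proof.
move=> hF cF bF; apply: Ap_dct hF cF bF _ _.
  by apply: measurable_funM; [exact: measurable_cst|exact: measurable_wgt].
rewrite pintZ; last exact: measurable_wgt.
have := pint_wgt p1; rewrite -ge0_fin_numE ?pint_ge0// => h.
by rewrite -(fineK h) -EFinM ltry.
Qed.

End Approximable.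

(** * From translates of the Gaussian to indicators of intervals *)

Section GaussianSpan.
Context (R : realType).
Implicit Types (f h v H : R -> R) (C e x c nu th : R).
Variables (p : R) (p1 : 1 < p) (u : nat -> R -> R).
Hypothesis mu_ : forall k, measurable_fun setT (u k).
Hypothesis Hgauss : forall nu, Ap p u (fun x => gauss (x - nu)).

(** All translates are carried along, since intervals are wanted at every place while the
    constructions are centred at 0. *)
Definition Aps f := forall c, Ap p u (fun x => f (x - c)).

Lemma wgt_shift x c : wgt (x - c) <= (1 + `|c|) * wgt x.
Proof.
rewrite /wgt ler_pdivlMr ?ltr_wpDr// mulrC ler_pdivrMr ?ltr_wpDr//.
have := ler_normD (x - c) c; rewrite subrK.
have := mulr_ge0 (normr_ge0 (x - c)) (normr_ge0 c); lra.
Qed.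

Lemma Aps_dct (F : nat -> R -> R) f C : 0 <= C -> (forall n, Aps (F n)) ->
  (forall x, F ^~ x @ \oo --> f x) -> (forall n x, `|F n x| <= C * wgt x) -> Aps f.
Proof.
move=> C0 hF cF bF c.
apply: (@Ap_dctw R p p1 u mu_ (fun n x => F n (x - c)) _ (C * (1 + `|c|))) => [n|x|n x].
- exact: hF.
- exact: cF.
- by apply: le_trans (bF _ _) _; rewrite -mulrA ler_wpM2l// wgt_shift.
Qed.

Lemma Aps_ext f h : Aps f -> f =1 h -> Aps h.
Proof. by move=> hf /funext <-. Qed.

Lemma Aps_Z (k : R) f : Aps f -> Aps (fun x => k * f x).
Proof. by move=> hf c; exact: Ap_Z (hf c). Qed.

Lemma Aps_D f h : Aps f -> Aps h -> Aps (fun x => f x + h x).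
Proof. by move=> hf hh c; exact: Ap_D. Qed.

Lemma Aps_sum N (F : nat -> R -> R) : (forall k, Aps (F k)) ->
  Aps (fun x => \sum_(k < N) F k x).
Proof. by move=> h c; apply: (Ap_sum p1 mu_ N (F := fun k x => F k (x - c))) => k; exact: h. Qed.

Lemma half_gauss (j : nat) : exists2 C, 0 <= C &
  forall x, `|x| ^+ j * expR (- (x ^+ 2 / 2)) <= C * wgt x.
Proof.
have [B hB] := @hg_bound R 0 j.+1; have B0 : 0 <= B.
  by apply: le_trans (hB 0); rewrite mulr_ge0// exprn_ge0// addr_ge0.
exists (2 ^+ j.+1 * B) => [|x]; first by rewrite mulr_ge0// exprn_ge0.
rewrite /wgt ler_pdivlMr ?ltr_wpDr//; have := hB (x / 2); rewrite hg0.
rewrite (ger0_norm (expR_ge0 _)) => h.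
apply: le_trans (ler_wpM2l (exprn_ge0 j.+1 (ler0n R 2)) h).
rewrite mulrA -exprMn mulrAC; apply: ler_pM.
- by rewrite mulr_ge0 ?exprn_ge0 ?addr_ge0.
- exact: expR_ge0.
- rewrite exprSr; apply: ler_pM; rewrite ?exprn_ge0 ?addr_ge0//.
    apply: lerXn2r; rewrite ?nnegrE ?mulr_ge0 ?addr_ge0//.
    by rewrite normrM normfV [`|2|]ger0_norm//; lra.
  by rewrite normrM normfV [`|2|]ger0_norm//; have := normr_ge0 x; lra.
- by rewrite ler_expR exprMn; have := sqr_ge0 x; lra.
Qed.

Definition gauss_root x : R := expR (- (x ^+ 2 / 2)).

Lemma gauss_sqr x : gauss x = gauss_root x ^+ 2.
Proof. by rewrite /gauss /gauss_root -expRM_natl; congr expR; field. Qed.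

Lemma gauss_root_gt0 x : 0 < gauss_root x. Proof. exact: expR_gt0. Qed.

Lemma gauss_root_le1 x : gauss_root x <= 1.
Proof. by rewrite /gauss_root -expR0 ler_expR oppr_le0 divr_ge0// sqr_ge0. Qed.

(** Half of the Gaussian exponent absorbs the exponential, as nu |x| <= x^2 / 2 + nu^2 / 2. *)
Lemma gauss_tilt (j : nat) nu : exists2 C, 0 <= C &
  forall x, `|x| ^+ j * gauss x * expR (nu * `|x|) <= C * wgt x.
Proof.
have [C C0 h] := half_gauss j; exists (expR (nu ^+ 2 / 2) * C) => [|x].
  by rewrite mulr_ge0// expR_ge0.
rewrite -mulrA -[leRHS]mulrA; apply: le_trans (ler_wpM2l (expR_ge0 (nu ^+ 2 / 2)) (h x)).
rewrite [leRHS]mulrCA -expRD -expRD; apply: ler_wpM2l; first exact: exprn_ge0.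
rewrite ler_expR -[x ^+ 2]real_normK ?num_real//.
by have := sqr_ge0 (`|x| - nu); lra.
Qed.

Lemma exp_quad (t : R) : `|expR t - 1 - t| <= t ^+ 2 * expR `|t|.
Proof.
have [c hc E] := MVT_der 0 t (@der_exp R); have [d hd E'] := MVT_der 0 c (@der_exp R).
rewrite !subr0 expR0 in hc E hd E'.
have -> : expR t - 1 - t = t * (expR c - 1) by rewrite E; ring.
rewrite E' !normrM (ger0_norm (expR_ge0 _)) mulrA mulrAC.
rewrite -[t ^+ 2]real_normK ?num_real// expr2; apply: ler_pM => //.
- exact: ler_wpM2l.
- by rewrite ler_expR; apply: le_trans (ler_norm _) (le_trans hd hc).
Qed.

Lemma cvg_bound_inv (F : nat -> R) l C : (forall n, `|F n - l| <= C / n.+1%:R) ->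
  F @ \oo --> l.
Proof.
move=> h; apply/cvgrPdist_le => e e0.
have := archi_boundP (divr_ge0 (normr_ge0 C) (ltW e0)); set N := Num.bound _ => hN.
near=> n; rewrite distrC; apply: le_trans (h n) _.
rewrite ler_pdivrMr// mulrC -ler_pdivrMr//.
apply: le_trans (_ : `|C| / e <= _); first by rewrite ler_wpM2r ?invr_ge0 ?(ltW e0)// ler_norm.
apply: le_trans (ltW hN) _; rewrite ler_nat; apply: leqW.
by near: n; exact: nbhs_infty_ge.
Unshelve. all: by end_near. Qed.

Definition tilt (n : nat) nu x : R := x ^+ n * gauss x * expR (nu * x).

(** At n = 0, completing the square gives a multiple of the Gaussian centred at nu / 2; each
    derivative in nu then raises n by one. *)
Lemma Aps_tilt n nu : Aps (tilt n nu).
Proof.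
elim: n nu => [|n IH] nu.
  move=> c; apply: Ap_ext (Ap_Z mu_ (expR (nu ^+ 2 / 4)) (Hgauss (c + nu / 2))) _ => x.
  by rewrite /tilt expr0 mul1r /gauss -!expRD; congr expR; field.
(* Since |nu + s m| <= |nu| + 1, one envelope serves all the difference quotients: n + 2 for their
   quadratic remainder, n + 1 for their limit. *)
have [C C0 hC] := gauss_tilt n.+2 (`|nu| + 1).
have [C' C'0 hC'] := gauss_tilt n.+1 (`|nu| + 1).
pose s (m : nat) : R := m.+1%:R^-1.
have s0 m : 0 < s m by rewrite invr_gt0.
have s1 m : s m <= 1 by rewrite invf_ple ?posrE// invr1 ler1n.
pose F m x := (s m)^-1 * (tilt n (nu + s m) x - tilt n nu x).
have est m x : `|F m x - tilt n.+1 nu x| <= s m * (C * wgt x).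
  have -> : F m x - tilt n.+1 nu x =
      (s m)^-1 * (x ^+ n * gauss x * expR (nu * x)) * (expR (s m * x) - 1 - s m * x).
    rewrite /F /tilt mulrDl expRD exprS; field; exact: lt0r_neq0.
  rewrite !normrM normfV (gtr0_norm (s0 m)) (ger0_norm (expR_ge0 _)) (ger0_norm (expR_ge0 _)).
  apply: le_trans (ler_wpM2l _ (exp_quad _)) _.
    by rewrite !mulr_ge0// ?expR_ge0// invr_ge0 ltW.
  apply: le_trans (ler_wpM2l (ltW (s0 m)) (hC x)).
  have -> : (s m)^-1 * (`|x ^+ n| * gauss x * expR (nu * x)) * ((s m * x) ^+ 2 * expR `|s m * x|) =
      s m * (`|x| ^+ n.+2 * gauss x * (expR (nu * x) * expR `|s m * x|)).
    rewrite -[n.+2]addn2 exprD real_normK ?num_real// normrX; field; exact: lt0r_neq0.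
  apply: ler_wpM2l; first exact: ltW.
  apply: ler_wpM2l; first by rewrite mulr_ge0 ?exprn_ge0 ?expR_ge0.
  rewrite -expRD ler_expR mulrDl; apply: lerD.
    by apply: le_trans (ler_norm _) _; rewrite normrM.
  by rewrite normrM (gtr0_norm (s0 m)) ler_wpM2r.
apply: (@Aps_dct F _ (C + C')).
- exact: addr_ge0.
- move=> m; have h := Aps_D (Aps_Z (s m)^-1 (IH (nu + s m))) (Aps_Z (- (s m)^-1) (IH nu)).
  by apply: Aps_ext h _ => x; rewrite /F; ring.
- move=> x; apply: (@cvg_bound_inv _ _ (C * wgt x)) => m.
  by rewrite mulrC; exact: est.
- move=> m x; rewrite -[F m x](subrK (tilt n.+1 nu x)).
  apply: le_trans (ler_normD _ _) _; rewrite mulrDl; apply: lerD.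
    apply: le_trans (est m x) _; rewrite ler_piMl// mulr_ge0//.
    exact: ltW (wgt_gt0 x).
  apply: le_trans (hC' x); rewrite /tilt !normrM normrX.
  rewrite [`|gauss x|]ger0_norm ?expR_ge0// [`|expR _|]ger0_norm ?expR_ge0//.
  rewrite ler_wpM2l ?mulr_ge0 ?exprn_ge0 ?expR_ge0// ler_expR.
  apply: le_trans (ler_norm _) _; rewrite normrM ler_wpM2r//; lra.
Qed.

Lemma exp_partial (t : R) N : 0 <= t -> \sum_(k < N) t ^+ k / k`!%:R <= expR t.
Proof.
move=> t0.
have -> : \sum_(k < N) t ^+ k / k`!%:R = series (exp_coeff t) N.
  by rewrite /series/= big_mkord.
rewrite /expR; apply: nondecreasing_cvgn_le; last exact: is_cvg_series_exp_coeff.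
by apply: nondecreasing_series => n _ _; rewrite /exp_coeff/= divr_ge0// exprn_ge0.
Qed.

Definition qq (n j : nat) x : R := x ^+ n * gauss x * gauss_root x ^+ j.

(** The factor [gauss_root] is expanded in its exponential series. The partial sums are bounded by
    exp (x^2 / 2), which uses up only half of the exponent of [gauss]. *)
Lemma Aps_qq n j : Aps (qq n j).
Proof.
elim: j n => [|j IH] n.
  by apply: Aps_ext (Aps_tilt n 0) _ => x; rewrite /tilt /qq mul0r expR0 expr0.
have [C C0 hC] := half_gauss n.
pose F N x := \sum_(k < N) ((- 2^-1) ^+ k / k`!%:R) * qq (n + k.*2) j x.
have E N x : F N x = qq n j x * \sum_(k < N) (- (x ^+ 2 / 2)) ^+ k / k`!%:R.
  rewrite /F mulr_sumr; apply: eq_bigr => k _.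
  rewrite /qq exprD -mul2n exprM -[- (_ / 2)]mulrN [(x ^+ 2 * _) ^+ k]exprMn.
  by move: ((- 2^-1) ^+ k) (x ^+ 2 ^+ k) => A B; ring.
apply: (@Aps_dct F _ C C0).
- move=> N; apply: (Aps_sum N (F := fun k x => ((- 2^-1) ^+ k / k`!%:R) * qq (n + k.*2) j x)) => k.
  exact/Aps_Z/IH.
- move=> x; under eq_fun do rewrite E.
  have -> : qq n j.+1 x = qq n j x * gauss_root x by rewrite /qq exprSr; ring.
  apply: cvgM; first exact: cvg_cst.
  have := is_cvg_series_exp_coeff (- (x ^+ 2 / 2)).
  rewrite /gauss_root /expR => h; apply: cvg_trans h; apply: near_eq_cvg; apply: nearW => N.
  by rewrite /series/= big_mkord.
- move=> N x; rewrite E normrM; apply: le_trans (hC x).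
  have -> : `|qq n j x| = `|x| ^+ n * gauss x * gauss_root x ^+ j.
    rewrite /qq !normrM normrX [`|gauss x|]ger0_norm ?expR_ge0//.
    by rewrite [`|gauss_root x ^+ j|]ger0_norm// exprn_ge0// ltW// gauss_root_gt0.
  apply: le_trans (_ : `|x| ^+ n * gauss x * 1 * expR (x ^+ 2 / 2) <= _).
    apply: ler_pM => //.
    - by rewrite !mulr_ge0 ?exprn_ge0 ?expR_ge0// ltW// gauss_root_gt0.
    - apply: ler_wpM2l; first by rewrite mulr_ge0 ?exprn_ge0 ?expR_ge0.
      by rewrite exprn_ile1// ?gauss_root_le1// ltW// gauss_root_gt0.
    - have t0 : 0 <= x ^+ 2 / 2 by rewrite divr_ge0// sqr_ge0.
      apply: le_trans (exp_partial N t0); apply: le_trans (ler_norm_sum _ _ _) _.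
      apply: ler_sum => k _; rewrite normrM normrX normrN normfV normr_nat.
      by rewrite (ger0_norm t0).
  rewrite mulr1 -mulrA ler_wpM2l ?exprn_ge0// /gauss -expRD ler_expR.
  by lra.
Qed.

Lemma Aps_poly (q : {poly R}) : Aps (fun x => gauss_root x ^+ 2 * q.[gauss_root x]).
Proof.
apply: Aps_ext (Aps_sum (size q) (F := fun k x => q`_k * qq 0 k x) (fun k => Aps_Z _ (Aps_qq 0 k))) _.
move=> x /=; rewrite horner_coef mulr_sumr; apply: eq_bigr => k _.
by rewrite /qq expr0 mul1r gauss_sqr; ring.
Qed.

(* With M of order n th^-n this tends to the indicator of th <= y on [0, 1], and it is
   divisible by y^2. *)
Definition sharp (n M : nat) (y : R) : R := 1 - (1 - y ^+ n.+2) ^+ M.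

Lemma Aps_sharp n M : Aps (fun x => sharp n M (gauss_root x)).
Proof.
apply: Aps_ext (Aps_poly ('X^n * \sum_(i < M) (1 - 'X^(n.+2)) ^+ i)) _ => x /=.
rewrite hornerM horner_sum hornerXn mulrA -exprD add2n /sharp.
under eq_bigr do rewrite horner_exp hornerD hornerC hornerN hornerXn.
have -> : 1 - (1 - gauss_root x ^+ n.+2) ^+ M = - ((1 - gauss_root x ^+ n.+2) ^+ M - 1) by ring.
by rewrite subrX1; ring.
Qed.

Lemma bernoulli_le (w : R) M : 0 <= w <= 1 -> 1 - (1 - w) ^+ M <= M%:R * w.
Proof.
move=> /andP[w0 w1]; elim: M => [|M IH]; first by rewrite expr0 subrr mul0r.
rewrite exprS -natr1.
have h : 0 <= (1 - w) ^+ M <= 1 by rewrite exprn_ge0 ?subr_ge0//= exprn_ile1// ?subr_ge0// gerBl.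
move: IH h; set q := (1 - w) ^+ M; move=> IH /andP[q0 q1].
by have := mulr_ge0 w0 (_ : 0 <= 1 - q); rewrite subr_ge0 => /(_ q1); clear -IH; lra.
Qed.

Lemma sharp_itv n M (y : R) : 0 <= y <= 1 -> 0 <= sharp n M y <= 1.
Proof.
move=> /andP[y0 y1]; rewrite /sharp subr_ge0 gerBl.
have h : 0 <= 1 - y ^+ n.+2 <= 1.
  by rewrite subr_ge0 exprn_ile1//= gerBl exprn_ge0.
by move/andP: h => [h1 h2]; rewrite exprn_ile1// exprn_ge0.
Qed.

(** M n lies between (n + 1) th^-(n + 2) and twice that, so that M n y^(n + 2) is at least n + 1 for
    y >= th and tends to 0 for y < th. *)
Lemma Aps_level th : 0 < th <= 1 -> Aps (fun x => (th <= gauss_root x)%R%:R).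
Proof.
move=> /andP[t0 t1].
pose M n := (n.+1 * (Num.truncn (th ^- n.+2)).+1)%N.
have ti1 n : 1 <= th ^- n.+2 by rewrite invf_ge1 ?exprn_gt0// exprn_ile1// ltW.
have Ml n : n.+1%:R * th ^- n.+2 <= (M n)%:R.
  by rewrite /M natrM ler_wpM2l// ltW// truncnS_gt.
have Mu n : (M n)%:R <= 2 * (n.+1%:R * th ^- n.+2).
  rewrite /M natrM mulrCA ler_wpM2l// -natr1.
  have := @truncn_le R (th ^- n.+2); rewrite (le_trans ler01 (ti1 n)) => h.
  by have := ti1 n; move: h; lra.
have up n y : 0 <= y <= 1 -> sharp n (M n) y <= 2 * (n.+1%:R * (y / th) ^+ n.+2).
  move=> /andP[y0 y1]; apply: le_trans (bernoulli_le _ _) _.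
    by rewrite exprn_ge0//= exprn_ile1.
  rewrite expr_div_n; apply: le_trans (ler_wpM2r (exprn_ge0 _ y0) (Mu n)) _.
  by rewrite le_eqVlt; apply/orP; left; apply/eqP; ring.
have yi x : 0 <= gauss_root x <= 1 by rewrite (ltW (gauss_root_gt0 x)) gauss_root_le1.
have [C C0 hC] := half_gauss 0.
apply: (@Aps_dct (fun n x => sharp n (M n) (gauss_root x)) _ (2 / th * C)).
- by rewrite mulr_ge0// divr_ge0// ltW.
- by move=> n; exact: Aps_sharp.
- move=> x; set y := gauss_root x; have /andP[y0 y1] := yi x.
  (* For y >= th the error is at most exp (- M n y^(n + 2)) <= 1 / (n + 1); for y < th Bernoulli's
     inequality leaves (n + 1) (y / th)^n, up to a factor 2. *)
  have [ty|yt] := leP th y.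
    apply: (@cvg_bound_inv _ _ 1) => n.
    rewrite /sharp addrAC subrr add0r normrN ger0_norm; last first.
      by rewrite exprn_ge0// subr_ge0 exprn_ile1.
    apply: le_trans (_ : expR (- y ^+ n.+2) ^+ M n <= _).
      apply: lerXn2r; rewrite ?nnegrE ?subr_ge0 ?exprn_ile1 ?expR_ge0//.
      by have := expR_ge1Dx (- y ^+ n.+2).
    rewrite -expRM_natl mulrN expRN div1r lef_pV2 ?posrE ?expR_gt0//.
    apply: le_trans (expR_ge1Dx _); apply: le_trans (_ : (M n)%:R * y ^+ n.+2 <= _); last by rewrite lerDr.
    apply: le_trans (ler_wpM2r _ (Ml n)); last by rewrite exprn_ge0.
    rewrite -mulrA ler_peMr// mulrC ler_pdivlMr ?exprn_gt0// mul1r.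
    by apply: lerXn2r; rewrite ?nnegrE// ltW.
  pose r := y / th; have r0 : 0 <= r by rewrite divr_ge0// ltW.
  have r1 : r < 1 by rewrite ltr_pdivrMr// mul1r.
  have r01 : 0 <= r < 1 by rewrite r0.
  apply: (@squeeze_cvgr _ _ _ _ (fun=> 0) (fun n => 2 * ((1 - Num.sqrt r)^-1 * Num.sqrt r ^+ n))).
  - apply: nearW => n; have /andP[-> _] := sharp_itv n (M n) (yi x).
    rewrite /=; apply: le_trans (up n y (yi x)) _; rewrite -/r ler_wpM2l//.
    apply: le_trans (geo_pow n r01); rewrite ler_wpM2l// -addn2 exprD.
    by rewrite ler_piMr ?exprn_ge0// exprn_ile1// ltW.
  - exact: cvg_cst.
  - by rewrite -[X in _ --> X](mulr0 (2 : R)); apply: cvgM; [exact: cvg_cst|exact: geo_pow_cvg].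
- move=> n x; have /andP[s0 s1] := sharp_itv n (M n) (yi x).
  rewrite ger0_norm//; set y := gauss_root x.
  have /andP[y0 y1] := yi x.
  apply: le_trans (_ : 2 / th * y <= _); last first.
    rewrite -[leRHS]mulrA; apply: ler_wpM2l; first by rewrite divr_ge0// ltW.
    by have := hC x; rewrite expr0 mul1r.
  have -> : 2 / th * y = 2 * (y / th) by ring.
  have r0 : 0 <= y / th by rewrite divr_ge0// ltW.
  (* The envelope 2 y / th: for y / th > 1 / 2 it exceeds 1, and otherwise (n + 1) 2^-(n + 1) <= 1
     takes care of the extra powers. *)
  have [r1|r1] := leP (y / th) 2^-1; last first.
    by apply: le_trans s1 _; rewrite mulrC -ler_pdivrMr// div1r ltW.
  apply: le_trans (up n y (yi x)) _; rewrite ler_wpM2l// exprS mulrCA ler_piMr//.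
  apply: le_trans (_ : n.+1%:R * 2^-1 ^+ n.+1 <= _).
    by rewrite ler_wpM2l//; apply: lerXn2r; rewrite ?nnegrE ?invr_ge0.
  rewrite exprVn ler_pdivrMr ?exprn_gt0// mul1r -natrX ler_nat.
  exact: ltnW (ltn_expl _ _).
Qed.

(** [gauss_root] is even and decreasing in |x|, so an interval of half-width w is a superlevel set
    of its translate to the midpoint, at height exp (- w^2 / 2). *)
Lemma Ap_itv (l r : R) : l <= r -> Ap p u (fun x => (l <= x <= r)%R%:R).
Proof.
move=> lr; pose w := (r - l) / 2; pose c := (l + r) / 2.
have w0 : 0 <= w by rewrite divr_ge0// subr_ge0.
have h := @Aps_level (expR (- (w ^+ 2 / 2))).
apply: Ap_ext (h _ c) _ => [|x].
  by rewrite expR_gt0 -expR0 ler_expR oppr_le0 divr_ge0// sqr_ge0.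
congr (_%:R); rewrite /gauss_root ler_expR lerN2 ler_pM2r ?invr_gt0//.
rewrite -[_ ^+ 2]real_normK ?num_real// ler_sqr ?nnegrE//.
rewrite ler_norml /w /c.
by congr nat_of_bool; apply/idP/idP => /andP[h1 h2]; apply/andP; split; lra.
Qed.

End GaussianSpan.

(** * From intervals to all of real L^p *)

Section Density.
Context (R : realType).
Implicit Types (f h v H : R -> R) (C e x c nu th L : R).
Variables (p : R) (p1 : 1 < p) (u : nat -> R -> R).
Hypothesis mu_ : forall k, measurable_fun setT (u k).
Hypothesis Hitv : forall l r, l <= r -> Ap p u (fun x => (l <= x <= r)%R%:R).

Definition box L x : R := (- L <= x <= L)%R%:R.

Lemma box_ge0 L x : 0 <= box L x. Proof. exact: ler0n. Qed.

Lemma box_le1 L x : box L x <= 1.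
Proof. by rewrite /box; case: (_ && _). Qed.

Lemma box_wgt L x : 0 <= L -> box L x <= (1 + L) * wgt x.
Proof.
move=> L0; rewrite /box /wgt ler_pdivlMr ?ltr_wpDr//.
case: (boolP (- L <= x <= L)) => h; rewrite ?mul1r ?mul0r; last by rewrite addr_ge0.
move: h; rewrite -ler_norml => h.
by rewrite lerD2l.
Qed.

(** Cutting off by [box L] keeps every indicator under the envelope (1 + L) [wgt], so that the sets
    concerned form a lambda-system. It contains the rays [y, +oo[, a generating class stable under
    intersection. *)
Lemma Ap_borel L (A : set R) : 0 <= L -> measurable A -> Ap p u (fun x => \1_A x * box L x).
Proof.
move=> L0.
pose H := [set A : set R | Ap p u (fun x => \1_A x * box L x)].
suff : @measurable _ (measurableTypeR R) `<=` H by move=> h /h.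
rewrite [X in X `<=` _]RGenCInfty.measurableE.
apply: lambda_system_subset => //.
- move=> _ _ [x ->] [y ->]; exists (Num.max x y).
  apply/seteqP; split => t /=; rewrite !in_itv/= !andbT ge_max.
    by case=> -> ->.
  by move=> /andP[].
- split; first by move=> ? _ ? _.
  + apply: Ap_ext (Hitv (_ : - L <= L)) _ => [|x]; first by lra.
    by rewrite indicT/= mul1r.
  + move=> S T TS hS hT; apply: Ap_ext (Ap_B p1 mu_ hS hT) _ => x.
    rewrite -mulrBl !indicE in_setD; congr (_ * _).
    case: (boolP (x \in T)) => [xT|xT]; last by rewrite subr0 andbT.
    by rewrite mem_set ?subrr//; apply: TS; rewrite inE in xT.
  + move=> F ndF hF; apply: (@Ap_dctw R p p1 u mu_ (fun n x => \1_(F n) x * box L x) _ (1 + L)).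
    * exact: hF.
    * move=> x; apply: cvgM; last exact: cvg_cst.
      have [xF|xF] := boolP (x \in \bigcup_i F i).
        have [n _ Fn] : (\bigcup_i F i) x by rewrite inE in xF.
        apply: cvg_near_cst; near=> m; rewrite !indicE xF mem_set//.
        have nm : (n <= m)%N by near: m; exact: nbhs_infty_ge.
        by have := ndF _ _ nm; rewrite subsetEset => h; exact: h.
      apply: cvg_near_cst; apply: nearW => m; rewrite !indicE (negbTE xF) memNset//.
      by move=> Fm; move/negP: xF; apply; rewrite inE; exists m.
    * move=> n x; rewrite normrM [`|box L x|]ger0_norm ?box_ge0//.
      apply: le_trans (box_wgt x L0); rewrite ler_piMl ?box_ge0// indicE.
      by case: (_ \in _); rewrite ?normr1 ?normr0.
- move=> _ [y ->].
  (* A ray cut by the box is a segment or empty. *)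
  have [h|h] := leP (Num.max y (- L)) L.
    apply: Ap_ext (Hitv h) _ => x; rewrite /box indicE -natrM mulnb; congr (_%:R).
    by rewrite ge_max -andbA; congr nat_of_bool; congr (_ && _); rewrite mem_setE in_itv/= andbT.
  apply: Ap_ext (Ap_0 p1 mu_) _ => x; rewrite /box indicE -natrM mulnb.
  rewrite mem_setE in_itv/= andbT; case: (boolP (_ && _)) => // /andP[h1 /andP[h2 h3]].
  by move: h; rewrite ltNge ge_max (le_trans h1 h3) (le_trans h2 h3).
Unshelve. all: by end_near. Qed.

(** The simple approximations by dyadic levels, cut off to [- n, n], increase at most to f, so f
    itself is the envelope. *)
Lemma Ap_nneg f : measurable_fun setT f -> (forall x, 0 <= f x) ->
  (pint p f < +oo)%E -> Ap p u f.
Proof.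
move=> mf f0 fi.
pose ap := @approx _ (measurableTypeR R) R setT (EFin \o f).
have f0' x : [set: R] x -> (0 <= (EFin \o f) x)%E by rewrite lee_fin.
have mfE : measurable_fun setT (EFin \o f) by exact/measurable_EFinP.
have mA n k : measurable (@dyadic_approx _ (measurableTypeR R) R setT (EFin \o f) n k).
  rewrite /dyadic_approx; case: ifPn => [kn|_]//; rewrite -preimage_comp.
  by apply: mfE => //; apply/measurable_image_EFin; exact: measurable_itv.
have mB n : measurable (@integer_approx _ (measurableTypeR R) R setT (EFin \o f) n).
  rewrite /integer_approx; apply: emeasurable_fun_c_infty => //.
have ap0 n x : 0 <= ap n x.
  rewrite /ap /approx; apply: addr_ge0; last by rewrite mulr_ge0// indicE.
  apply: sumr_ge0 => k _; rewrite indicE.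
  by rewrite !mulr_ge0// invr_ge0 exprn_ge0.
apply: (@Ap_dct R p p1 u mu_ (fun n x => ap n x * box n%:R x) _ f) => //.
- move=> n; pose c k : R := k%:R * 2 ^- n.
  apply: Ap_ext (Ap_D p1 mu_ (Ap_sum p1 mu_ (n * 2 ^ n)
     (F := fun k x => c k * (\1_(@dyadic_approx _ (measurableTypeR R) R setT (EFin \o f) n k) x * box n%:R x)) _)
     (Ap_Z mu_ n%:R (Ap_borel (ler0n _ n) (mB n)))) _.
    by move=> k; exact: (Ap_Z mu_ (c k) (Ap_borel (ler0n _ n) (mA n k))).
  move=> x /=; rewrite /ap /approx mulrDl mulr_suml; congr (_ + _); last by rewrite mulrA.
  by apply: eq_bigr => k _; rewrite mulrA.
- move=> x; rewrite -[f x]mulr1; apply: cvgM.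
    have := @cvg_approx _ (measurableTypeR R) R setT (EFin \o f) x f0' I (ltry _).
    exact.
  apply: cvg_near_cst; near=> n; rewrite /box -ler_norml.
  suff -> : `|x| <= n%:R by [].
  apply: le_trans (ltW (archi_boundP (normr_ge0 x))) _; rewrite ler_nat.
  by near: n; exact: nbhs_infty_ge.
- move=> n x; rewrite ger0_norm ?mulr_ge0 ?box_ge0//.
  apply: le_trans (_ : ap n x <= _); first by rewrite ler_piMr ?box_le1.
  by have := @le_approx _ (measurableTypeR R) R setT (EFin \o f) n x f0' I; rewrite lee_fin.
Unshelve. all: by end_near. Qed.

Lemma Ap_real f : measurable_fun setT f -> (pint p f < +oo)%E -> Ap p u f.
Proof.
move=> mf fi; have p0 : 0 <= p := ltW (lt_trans ltr01 p1).
have mn : measurable_fun setT (fun x => `|f x|) by exact: measurableT_comp.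
have m2 h : measurable_fun setT h -> measurable_fun setT (fun x => 2^-1 * h x).
  by move=> mh; apply: measurable_funM => //; exact: measurable_cst.
pose f1 x := 2^-1 * (`|f x| + f x); pose f2 x := 2^-1 * (`|f x| - f x).
have m1 : measurable_fun setT f1 by apply: m2; exact: measurable_funD.
have m2' : measurable_fun setT f2 by apply: m2; exact: measurable_funB.
have ab x : `|f x| + f x >= 0 /\ `|f x| - f x >= 0.
  by have := ler_norm (f x); have := ler_norm (- f x); rewrite normrN; split; lra.
have A1 : Ap p u f1.
  apply: Ap_nneg => [|x|]; first by [].
    by rewrite mulr_ge0 ?invr_ge0//; case: (ab x).
  apply: le_lt_trans (pint_le p0 m1 mf _) fi => x.
  have [h1 h2] := ab x; rewrite /f1 normrM (ger0_norm h1) ger0_norm ?invr_ge0//; lra.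
have A2 : Ap p u f2.
  apply: Ap_nneg => [|x|]; first by [].
    by rewrite mulr_ge0 ?invr_ge0//; case: (ab x).
  apply: le_lt_trans (pint_le p0 m2' mf _) fi => x.
  have [h1 h2] := ab x; rewrite /f2 normrM (ger0_norm h2) ger0_norm ?invr_ge0//; lra.
by apply: Ap_ext (Ap_B p1 mu_ A1 A2) _ => x; rewrite /f1 /f2; field.
Qed.

End Density.

(** * Assembly in complex L^p *)

Section Completeness.
Context (R : realType).
Implicit Types (p e x nu C : R).
Local Notation mu := (@lebesgue_measure R).

Lemma cLnormE p (f : R -> R[i]) :
  cLnorm p f = ((\int[mu]_x (normc (f x) `^ p)%:E) `^ p^-1)%E.
Proof.
rewrite /cLnorm unlock; congr (_ `^ _)%E; apply: eq_integral => x _.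
by rewrite abse_EFin ger0_norm ?normc_ge0// poweR_EFin.
Qed.

Lemma gen_wgt (a : R) : 0 < a -> exists C, forall x, `|gen a 0 x| <= C * wgt x.
Proof.
move=> a0; have [M1 h1] := gen_decay a0 0 0; have [M2 h2] := gen_decay a0 0 1.
exists (M1 + M2) => x; rewrite /wgt ler_pdivlMr ?ltr_wpDr// mulrDr mulr1.
apply: lerD; first by have := h1 x; rewrite expr0 mul1r.
by have := h2 x; rewrite expr1 normrM mulrC.
Qed.

Lemma measurable_gen (a c : R) : 0 < a -> measurable_fun setT (fun x => gen a 0 (x - c)).
Proof.
move=> a0; apply: continuous_measurable_fun.
apply: (@contcomp R (gen a 0) (fun x => x - c)); first exact: der_cont (@der_gen R a 0).
by apply: contB; [exact: cont_id|exact: cont_cst].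
Qed.

Lemma pint_wgtZ p C : 1 < p -> (pint p (fun x => C * wgt x)%R < +oo)%E.
Proof.
move=> p1; rewrite pintZ; last exact: measurable_wgt.
have := pint_wgt p1; rewrite -ge0_fin_numE ?pint_ge0// => h.
by rewrite -(fineK h) -EFinM ltry.
Qed.

Lemma pint_gen p (a c : R) : 1 < p -> 0 < a ->
  (pint p (fun x => gen a 0 (x - c)) < +oo)%E.
Proof.
move=> p1 a0; have p0 : 0 <= p := ltW (lt_trans ltr01 p1).
have [C hC] := gen_wgt a0.
have C0 : 0 <= C.
  by have := le_trans (normr_ge0 _) (hC 0); rewrite pmulr_lge0// wgt_gt0.
apply: le_lt_trans (pint_wgtZ (C * (1 + `|c|)) p1).
apply: pint_le => //; first exact: measurable_gen.
  by apply: measurable_funM; [exact: measurable_cst|exact: measurable_wgt].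
move=> x; apply: le_trans (hC _) (le_trans _ (ler_norm _)).
by rewrite -mulrA ler_wpM2l// wgt_shift.
Qed.

(** Approximants of precision 1 / (n + 1) converge pointwise, and their errors share the envelope C
    / (1 + |x - nu|), which is comparable to [wgt]. *)
Lemma Ap_gauss p (a : R) (lam : nat -> R) C : 1 < p -> 0 < a ->
  (forall nu e, 0 < e -> exists N, gauss_approximable a C e nu N lam) ->
  forall nu, Ap p (fun k x => gen a 0 (x - lam k)) (fun x => gauss (x - nu)).
Proof.
move=> p1 a0 h nu; set u := fun k x => _.
have mu_ k : measurable_fun setT (u k) by exact: measurable_gen.
have [F hF] : exists F : nat -> R -> R, forall n, Ap p u (F n) /\ forall x,
    `|gauss (x - nu) - F n x| <= n.+1%:R^-1 /\ (1 + `|x - nu|) * `|gauss (x - nu) - F n x| <= C.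
  suff /choice[F hF] : forall n, exists f : R -> R, Ap p u f /\ forall x,
    `|gauss (x - nu) - f x| <= n.+1%:R^-1 /\ (1 + `|x - nu|) * `|gauss (x - nu) - f x| <= C.
    by exists F.
  move=> n; have n0 : 0 < n.+1%:R^-1 :> R by rewrite invr_gt0.
  have [N [c hc]] := h nu _ n0; exists (ucomb u N c); split; last exact: hc.
  exact: Ap_ucomb.
have [B B0 hB] := half_gauss R 0.
have C0 : 0 <= C.
  have [_ /(_ nu)[_ hh]] := hF 0%N; apply: le_trans hh.
  by rewrite mulr_ge0// addr_ge0.
apply: (@Ap_dctw R p p1 u mu_ F _ ((B + C) * (1 + `|nu|))).
- by move=> n; case: (hF n).
- move=> x; apply: (@cvg_bound_inv R _ _ 1) => n; rewrite distrC div1r.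
  by case: (hF n) => _ /(_ x)[].
- move=> n x; have [_ /(_ x)[_ h2]] := hF n.
  rewrite -[F n x](subrK (gauss (x - nu))) -normrN opprD opprB.
  apply: le_trans (ler_normB _ _) _; rewrite mulrDl mulrDl addrC; apply: lerD.
    rewrite -mulrA; apply: le_trans (ler_wpM2l B0 (wgt_shift x nu)).
    apply: le_trans (hB _); rewrite expr0 mul1r ger0_norm ?expR_ge0// /gauss ler_expR.
    by have := sqr_ge0 (x - nu); lra.
  rewrite -mulrA; apply: le_trans (ler_wpM2l C0 (wgt_shift x nu)).
  by rewrite /wgt ler_pdivlMr ?ltr_wpDr// mulrC.
Qed.

Lemma measurable_normc (f : R -> R[i]) :
  measurable_fun setT (fun x => complex.Re (f x)) ->
  measurable_fun setT (fun x => complex.Im (f x)) ->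
  measurable_fun setT (fun x => normc (f x)).
Proof.
move=> m1 m2.
have -> : (fun x => normc (f x)) =
    (fun x => Num.sqrt (complex.Re (f x) ^+ 2 + complex.Im (f x) ^+ 2)).
  by apply/funext => x; case: (f x).
apply: (measurableT_comp (@continuous_measurable_fun R (@Num.sqrt R) (@sqrt_continuous R))).
by apply: measurable_funD; exact: measurable_funX.
Qed.

Lemma pint_normc_part p (f : R -> R[i]) (g : R -> R) : 0 < p ->
  measurable_fun setT (fun x => complex.Re (f x)) ->
  measurable_fun setT (fun x => complex.Im (f x)) ->
  (cLnorm p f < +oo)%E -> measurable_fun setT g ->
  (forall x, `|g x| <= normc (f x)) -> (pint p g < +oo)%E.
Proof.
move=> p0 m1 m2 hf mg gf.
have h : (pint p (fun x => normc (f x)) < +oo)%E.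
  have := poweR_lty p hf; rewrite cLnormE -poweRrM mulVf ?gt_eqF// poweRe1; last first.
    by apply: integral_ge0 => x _; rewrite lee_fin powR_ge0.
  apply: le_lt_trans; rewrite le_eqVlt; apply/orP; left; apply/eqP.
  by apply: eq_integral => x _; rewrite ger0_norm ?normc_ge0.
apply: le_lt_trans h; apply: pint_le => //; first exact: ltW.
  exact: measurable_normc.
by move=> x; rewrite [X in _ <= X]ger0_norm ?normc_ge0.
Qed.

(** The u k are real, so real and imaginary parts are approximated separately and their coefficients
    combined, after padding both to a common length. *)
Lemma complete_from_real p (u : nat -> R -> R) : 1 < p ->
  (forall k, measurable_fun setT (u k)) -> (forall k, (pint p (u k) < +oo)%E) ->
  (forall f, measurable_fun setT f -> (pint p f < +oo)%E -> Ap p u f) ->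
  complete_in_Lp p (fun n x => (u n x)%:C%C).
Proof.
move=> p1 mu_ iu density; have p0 : 0 < p := lt_trans ltr01 p1.
split=> [n|f [m1 m2 hf] e e0].
  split; [exact: mu_|exact: measurable_cst|].
  rewrite cLnormE; apply: poweR_lty; apply: le_lt_trans (iu n).
  rewrite le_eqVlt; apply/orP; left; apply/eqP; apply: eq_integral => x _.
  by rewrite normcR.
have hRe := density _ m1 (pint_normc_part p0 m1 m2 hf m1 (fun x => Re_le_normc (f x))).
have hIm := density _ m2 (pint_normc_part p0 m1 m2 hf m2 (fun x => Im_le_normc (f x))).
(* The factor 2^p is the loss in [pintD]; of the 4, one factor 2 pays for the two parts and the
   other makes the final inequality strict. *)
have q0 : 0 < 2 `^ p * 4 :> R by rewrite mulr_gt0// powR_gt0.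
have d0 : 0 < e `^ p / (2 `^ p * 4) by rewrite divr_gt0// powR_gt0.
have [N [c hc]] := hRe.2 _ d0; have [M [d hd]] := hIm.2 _ d0.
pose cc k := ((if (k < N)%N then c k else 0) +i* (if (k < M)%N then d k else 0))%C.
exists (maxn N M), cc.
pose F x := f x - \sum_(k < maxn N M) cc k * (u k x)%:C%C.
have FE x : complex.Re (F x) = complex.Re (f x) - ucomb u N c x /\
            complex.Im (F x) = complex.Im (f x) - ucomb u M d x.
  rewrite (ucomb_pad u c x (leq_maxl N M)) (ucomb_pad u d x (leq_maxr N M)) /F.
  suff -> : \sum_(k < maxn N M) cc k * (u k x)%:C%C =
      (ucomb u (maxn N M) (fun k => if (k < N)%N then c k else 0) x +i*
       ucomb u (maxn N M) (fun k => if (k < M)%N then d k else 0) x)%C.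
    by case: (f x).
  rewrite /ucomb; elim: (maxn N M) => [|m IH]; first by rewrite !big_ord0.
  by rewrite !big_ord_recr/= IH; apply: cext; rewrite /= ?mulr0 ?subr0 ?addr0 ?add0r.
have mF1 : measurable_fun setT (fun x => complex.Re (F x)).
  under eq_fun do rewrite (FE _).1; apply: measurable_funB => //.
  exact: measurable_ucomb.
have mF2 : measurable_fun setT (fun x => complex.Im (F x)).
  under eq_fun do rewrite (FE _).2; apply: measurable_funB => //.
  exact: measurable_ucomb.
have key : (pint p (fun x => normc (F x)) <= (e `^ p / 2)%:E)%E.
  apply: le_trans (_ : (pint p (fun x => (`|complex.Re (F x)| + `|complex.Im (F x)|)%R) <= _)%E).
    apply: pint_le; first exact: ltW.
    - exact: measurable_normc.
    - by apply: measurable_funD; exact: measurableT_comp.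
    - move=> x; rewrite ger0_norm ?normc_ge0// [leRHS]ger0_norm ?addr_ge0//.
      rewrite -ler_sqr ?nnegrE ?normc_ge0 ?addr_ge0// normc2 sqrrD !real_normK ?num_real//.
      by rewrite -addrA [_ *+ 2 + _]addrC addrA lerDl mulrn_wge0// mulr_ge0.
  apply: le_trans (pintD (ltW p0) _ _) _; [exact: measurableT_comp|exact: measurableT_comp|].
  have e1 : (pint p (fun x => `|complex.Re (F x)|%R) <= (e `^ p / (2 `^ p * 4))%:E)%E.
    apply: le_trans hc; rewrite le_eqVlt; apply/orP; left; apply/eqP.
    by apply: eq_integral => x _; rewrite normr_id (FE x).1.
  have e2 : (pint p (fun x => `|complex.Im (F x)|%R) <= (e `^ p / (2 `^ p * 4))%:E)%E.
    apply: le_trans hd; rewrite le_eqVlt; apply/orP; left; apply/eqP.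
    by apply: eq_integral => x _; rewrite normr_id (FE x).2.
  apply: le_trans (lee_wpmul2l _ (leeD e1 e2)) _; first by rewrite lee_fin powR_ge0.
  rewrite -EFinD -EFinM lee_fin le_eqVlt; apply/orP; left; apply/eqP.
  have qq : 2 `^ p != 0 :> R by rewrite gt_eqF// powR_gt0.
  by field.
rewrite cLnormE.
have -> : (\int[mu]_x (normc (F x) `^ p)%:E = pint p (fun x => normc (F x)))%E.
  by apply: eq_integral => x _; rewrite ger0_norm ?normc_ge0.
have fin : pint p (fun x => normc (F x)) \is a fin_num.
  by rewrite ge0_fin_numE ?pint_ge0//; apply: le_lt_trans key (ltry _).
rewrite -(fineK fin) in key *; rewrite lee_fin in key; rewrite poweR_EFin lte_fin.
set r := fine _ in key *.
have r0 : 0 <= r by apply: fine_ge0; exact: pint_ge0.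
have -> : e = (e `^ p) `^ p^-1 by rewrite -powRrM mulfV ?gt_eqF// powRr1// ltW.
apply: gt0_ltr_powR; rewrite ?invr_gt0 ?nnegrE ?powR_ge0//.
apply: le_lt_trans key _; rewrite ltr_pdivrMr// ltr_pMr ?powR_gt0// ltr1n //.
Qed.

End Completeness.

Theorem theorem2p3 (R : realType) (a b : R) (ha : 0 < a) (hb : 0 < b)
    (hab : rat_lin_indep2 a b) :
  exists (lam : nat -> R) (g : R -> R),
    [/\ forall n : nat, lam n.+1 - lam n = a \/ lam n.+1 - lam n = b,
        schwartz g,
        forall x : R, 0 <= g x &
        forall p : R, 1 < p ->
          complete_in_Lp p (fun n : nat => translate g (lam n))].
Proof.
have [lam [steps [C hC]]] := visiting_sequence ha hb hab.
exists lam, (gen a 0); split => //; first exact: schwartz_gen.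
  by move=> x; exact: gen0_ge0.
move=> p p1; have mu_ k : measurable_fun setT (fun x : R => gen a 0 (x - lam k)).
  exact: measurable_gen.
apply: (@complete_from_real R p (fun k (x : R) => gen a 0 (x - lam k))) => //.
  by move=> k; exact: pint_gen.
move=> f mf fi; apply: Ap_real => // l r lr; apply: Ap_itv => //.
exact: Ap_gauss hC.
Qed.
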